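(* Let $\alpha>0$ and let $\psi\in C^0([-1,1];(0,\infty))$ satisfy $\psi(1)=\psi(-1)>\alpha$ and $\psi(x)=\psi(-x)$ for all $x\in(-1,1)$. Suppose that there exists a minimiser $u\in N_\alpha(\psi)$ of $W^h$, i.e. $W^h(u)=\inf_{v\in N_\alpha(\psi)}W^h(v)$. Then $u\in C^2([-1,1])$, $u''$ is weakly differentiable and $u'''\in BV(-1,1)$. On the complement of the coincidence set, $\mathcal N:=\{x\in(-1,1)\mid u(x)<\psi(x)\}$, the minimiser is even smooth, i.e. $u|_{\mathcal N}\in C^\infty(\mathcal N)$.
   Context: The admissible sets are $$N_\alpha=\{v\in H^2((-1,1);(0,\infty))\mid v(1)=v(-1)=\alpha,\ v'(1)=v'(-1)=0,\ v(x)=v(-x)\ \text{for all }x\in[-1,1]\},$$ $$N_\alpha(\psi)=\{v\in N_\alpha\mid v(x)\le\psi(x)\ \text{for all }x\in[-1,1]\}.$$ The hyperbolic curvature and the hyperbolic elastica functional of the graph of a positive function $v\in H^2(-1,1)$ are $$\kappa_h(x)=\frac{v(x)v''(x)}{(1+v'(x)^2)^{3/2}}+\frac{1}{\sqrt{1+v'(x)^2}},\qquad W^h(v)=\int_{-1}^1\kappa_h(x)^2\,\frac{\sqrt{1+v'(x)^2}}{v(x)}\,dx .$$ $BV(-1,1)$ denotes the functions of bounded variation on $(-1,1)$. *)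

(* Defs.v *)
From mathcomp Require Import all_boot all_order all_algebra.
From mathcomp Require Import all_classical all_reals all_analysis.

Set Implicit Arguments.
Unset Strict Implicit.
Unset Printing Implicit Defensive.
Import Order.TTheory GRing.Theory Num.Theory.
Import numFieldNormedType.Exports.
Local Open Scope classical_set_scope.
Local Open Scope ring_scope.

Local Notation mu := (@lebesgue_measure _).

(* On an open set, [derivable] at every order gives C^oo, since a derivable
   function is continuous; the values of f outside O play no role. *)
Definition smooth_on (R : realType) (O : set R) (f : R -> R) : Prop :=
  forall (n : nat) (x : R), O x -> derivable (derive1n n f) x 1.

Definition test_function (R : realType) (O : set R) (phi : R -> R) : Prop :=
  [/\ smooth_on setT phi,
      compact (closure [set x | phi x != 0]) &
      closure [set x | phi x != 0] `<=` O].

(* [locally_integrable O _] contains the openness of O and measurability on O. *)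
Definition is_weak_derivative (R : realType) (O : set R) (f g : R -> R) : Prop :=
  [/\ locally_integrable O f, locally_integrable O g &
      forall phi : R -> R, test_function O phi ->
        \int[mu]_(x in O) (f x * derive1 phi x) = - \int[mu]_(x in O) (g x * phi x)].

Definition weakly_differentiable (R : realType) (O : set R) (f : R -> R) : Prop :=
  exists g, is_weak_derivative O f g.

(* A chosen weak derivative, unique only up to a null set: everything below
   that is built on it depends only on its almost-everywhere class. *)
Definition weak_derive (R : realType) (O : set R) (f : R -> R) : R -> R :=
  get [set g | is_weak_derivative O f g].

Definition L2 (R : realType) (O : set R) (f : R -> R) : Prop :=
  f \_ O \in Lfun (@lebesgue_measure R) 2%:E.

Definition ae_eq_on (R : realType) (O : set R) (f g : R -> R) : Prop :=
  {ae @lebesgue_measure R, forall x, O x -> f x = g x}.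

Definition Iopen (R : realType) : set R := `](-1 : R), 1[%classic.
Definition Iclosed (R : realType) : set R := `[(-1 : R), 1]%classic.

Definition continuous_representative (R : realType) (f g : R -> R) : Prop :=
  {within @Iclosed R, continuous g} /\ ae_eq_on (@Iopen R) f g.

(* H^2(-1,1), where a class is identified with its representative that is
   continuous up to the boundary. Functions are total on R, with irrelevant
   values outside [-1,1]. *)
Definition H2 (R : realType) (v : R -> R) : Prop :=
  let D := weak_derive (@Iopen R) in
  [/\ {within @Iclosed R, continuous v},
      weakly_differentiable (@Iopen R) v,
      weakly_differentiable (@Iopen R) (D v) &
      [/\ L2 (@Iopen R) v, L2 (@Iopen R) (D v) & L2 (@Iopen R) (D (D v))]].

Definition hyp_curvature (R : realType) (v : R -> R) (x : R) : R :=
  let v' := weak_derive (@Iopen R) v in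
  let v'' := weak_derive (@Iopen R) v' in
  v x * v'' x / (1 + v' x ^+ 2) `^ (3 / 2) + 1 / Num.sqrt (1 + v' x ^+ 2).

Definition Wh (R : realType) (v : R -> R) : \bar R :=
  (\int[mu]_(x in @Iopen R)
     (hyp_curvature v x ^+ 2
      * (Num.sqrt (1 + weak_derive (@Iopen R) v x ^+ 2) / v x))%:E)%E.

(* The boundary values of v' are those of the continuous representative of v'
   on [-1,1], which exists because H^2(-1,1) embeds into C^1([-1,1]). *)
Definition Nadm (R : realType) (alpha : R) : set (R -> R) :=
  [set v | [/\ H2 v,
               forall x, Iopen x -> 0 < v x,
               v 1 = alpha /\ v (-1) = alpha,
               exists2 v' : R -> R,
                 continuous_representative (weak_derive (@Iopen R) v) v' &
                 v' 1 = 0 /\ v' (-1) = 0 &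
               forall x, Iclosed x -> v x = v (- x)]].

Definition Nadm_obstacle (R : realType) (alpha : R) (psi : R -> R) :
    set (R -> R) :=
  Nadm alpha `&` [set v | forall x, Iclosed x -> v x <= psi x].

Definition minimiser (R : realType) (F : (R -> R) -> \bar R)
    (A : set (R -> R)) (u : R -> R) : Prop :=
  A u /\ F u = ereal_inf (F @` A).

(* C^k([-1,1]): k times continuously differentiable on the open interval, with
   all derivatives up to order k extending continuously to the closed one. *)
Definition Ck_closed (R : realType) (k : nat) (f : R -> R) : Prop :=
  [/\ {within @Iclosed R, continuous f},
      forall (j : nat) (x : R), (j < k)%N -> Iopen x -> derivable (derive1n j f) x 1 &
      forall j : nat, (j <= k)%N -> exists2 g : R -> R,
        {within @Iclosed R, continuous g} & forall x, Iopen x -> g x = derive1n j f x].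

(* BV(-1,1) as a space of almost-everywhere classes. The endpoint values of the
   representative are irrelevant, a function of bounded variation on the open
   interval being bounded. *)
Definition in_BV (R : realType) (f : R -> R) : Prop :=
  exists2 g : R -> R, bounded_variation (-1) 1 g & ae_eq_on (@Iopen R) f g.

Definition noncoincidence (R : realType) (u psi : R -> R) : set R :=
  [set x | Iopen x /\ u x < psi x].

(* Main.v *)
(** With [s = (1 + p^2)^(-1/2)], [Wh v] is the integral of [L(v, v', v'')], where
    [L(v, p, q) = v q^2 s^5 + 2 q s^3 + s / v]. Two integrations by parts write the
    first variation at [u] along [f] as the integral of [D f''], where
    [D = L_q - E] and [E' = L_p - (primitive of L_v)]. Lowering [u] by an even
    nonnegative [f] is always admissible. For [f] take the symmetrisation of a second
    difference of a C^{1,1} convex function whose second derivative is the indicator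
    of an interval of length [e]; as [e] tends to 0 this shows that
    [k x = D x + D (- x)] is concave on its Lebesgue points. Where [u < psi] both
    signs of [f] are admissible, so [k] is affine there, in particular near the
    endpoints, because [psi > alpha] at them. Hence [k = c + (primitive of m)] with [m]
    monotone, bounded, and locally constant off the coincidence set. By evenness
    [2 L_q = k x + E x + E (- x)] is continuous, and so is [u''], because [L_q] is
    affine in [q] with positive leading coefficient. The equation then expresses
    [u'''] through [m] and absolutely continuous functions, whence [u'''] is BV. Off
    the coincidence set [m' = 0], and the algebra generated by the functions involved
    is stable under differentiation, whence smoothness. *)

Require Import Defs.
From mathcomp Require Import all_boot all_order all_algebra.
From mathcomp Require Import all_classical all_reals all_analysis.
From mathcomp Require Import measurable_realfun.
From mathcomp Require Import ring lra.
Import Order.TTheory GRing.Theory Num.Theory.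
Import numFieldNormedType.Exports.
Local Open Scope classical_set_scope.
Local Open Scope ring_scope.
Set Implicit Arguments.
Unset Strict Implicit.
Unset Printing Implicit Defensive.

(** * Primitives and absolutely continuous functions *)

(** The obstacle is that [L_q] is a priori only integrable, so [k] has meaningful values only off a
    null set. Concavity is therefore stated on a dense set and turned into [c + (primitive of m)]
    without any continuity of [k]; continuity is read off from the formula afterwards. Second
    differences are the right test directions because the convex functions used are maxima of
    functions affine in their base point: their second difference in the base point is nonnegative
    and has compact support, while their second derivatives average [k] next to three given points.
    Affinity of [k] near the endpoints is what bounds [m]: concavity alone would allow infinite
    slopes there, and [u'''] could be unbounded. Pointwise values of a chosen weak derivative are
    not controlled, so the argument runs on triples [v, p, q] of explicit representatives. The first
    variation needs no differentiation under the integral sign: the integrand is expanded with a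
    remainder of order [t^2] relative to the weight [(1 + |q|)^2], which is integrable since [q] is
    square integrable. *)

Section Integration.
Context {R : realType}.
Local Notation mu := (@lebesgue_measure R).
Local Notation I := (@Iopen R).
Local Notation J f := (\int[mu]_(x in I) f x).
Implicit Types (f g h : R -> R) (x y : R).

Definition intg f := mu.-integrable I (EFin \o f).

Lemma intgP f : intg f <-> mu.-integrable I (EFin \o f).
Proof. by []. Qed.

Lemma IopenE x : I x <-> -1 < x < 1.
Proof. by rewrite /Iopen /= in_itv. Qed.

Lemma IclosedE x : Iclosed x <-> -1 <= x <= 1.
Proof. by rewrite /Iclosed /= in_itv. Qed.

Lemma Iopen_closed x : I x -> Iclosed x.
Proof. by rewrite IopenE IclosedE => /andP[/ltW -> /ltW ->]. Qed.

Lemma measurable_Iopen : measurable (I : set (measurableTypeR R)).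
Proof. exact: measurable_itv. Qed.

Hint Resolve measurable_Iopen : core.

Lemma open_Iopen : open I.
Proof. exact: interval_open. Qed.

Lemma mu_Iopen_lty : (mu I < +oo)%E.
Proof.
rewrite /Iopen lebesgue_measure_itv /= lte_fin.
by case: ifPn => _; rewrite ?ltry// -EFinB ltry.
Qed.

Lemma intg_measurable f : intg f -> measurable_fun I f.
Proof. by move=> /integrableP[/measurable_EFinP]. Qed.

Lemma intg_bounded f M : measurable_fun I f -> (forall x, I x -> `|f x| <= M) ->
  intg f.
Proof.
move=> mf fM; apply: measurable_bounded_integrable => //.
  exact: mu_Iopen_lty.
exists M; split; first exact: num_real.
by move=> y My x /= Ix; rewrite (le_trans (fM x Ix))// ltW.
Qed.

Lemma eq_intg f g : (forall x, I x -> f x = g x) -> intg f -> intg g.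
Proof.
move=> fg; apply: eq_integrable => // x /set_mem Ix /=.
by rewrite fg.
Qed.

Lemma intgD f g : intg f -> intg g -> intg (fun x => f x + g x).
Proof. move=> fi gi; exact: (integrableD _ fi gi). Qed.

Lemma intgZ k f : intg f -> intg (fun x => k * f x).
Proof. by move=> fi; apply: (integrableZl _ k fi). Qed.

Lemma intgN f : intg f -> intg (fun x => - f x).
Proof. by move=> fi; apply: (integrableN fi). Qed.

Lemma intgB f g : intg f -> intg g -> intg (fun x => f x - g x).
Proof. by move=> fi gi; apply: intgD => //; exact: intgN. Qed.

Lemma le_intg f g : measurable_fun I f -> (forall x, I x -> `|f x| <= g x) ->
  intg g -> intg f.
Proof.
move=> mf fg; apply: le_integrable => //; first exact/measurable_EFinP.
by move=> x Ix /=; rewrite lee_fin (le_trans (fg x Ix))// ler_norm.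
Qed.

Lemma intgM h f M : measurable_fun I h -> (forall x, I x -> `|h x| <= M) ->
  intg f -> intg (fun x => h x * f x).
Proof.
move=> mh hM fi; apply: (@le_intg _ (fun x => M * `|f x|)).
- by apply: measurable_funM => //; exact: intg_measurable.
- by move=> x Ix; rewrite normrM ler_wpM2r// hM.
- by apply: intgZ; exact: (integrable_norm fi).
Qed.

Lemma intg_cst c : intg (fun=> c).
Proof. by apply: (@intg_bounded _ `|c|). Qed.

Lemma within_measurable f : {within @Iclosed R, continuous f} -> measurable_fun I f.
Proof.
move=> cf; apply: (@measurable_funS _ _ _ _ (@Iclosed R)).
- exact: measurable_itv.
- exact: Iopen_closed.
- by apply: subspace_continuous_measurable_fun => //; exact: measurable_itv.
Qed.

Lemma within_bounded f : {within @Iclosed R, continuous f} ->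
  exists2 M : R, 0 < M & forall x, Iclosed x -> `|f x| <= M.
Proof.
move=> cf; have cI : compact (f @` @Iclosed R).
  by apply: continuous_compact => //; exact: segment_compact.
have [M [_ HM]] := compact_bounded cI.
exists (`|M| + 1); first by rewrite ltr_wpDl.
move=> x Ix; apply: (HM (`|M| + 1)); last by exists x.
by rewrite (le_lt_trans (ler_norm M))// ltrDl.
Qed.

Lemma intg_within f : {within @Iclosed R, continuous f} -> intg f.
Proof.
move=> cf; have [M _ fM] := within_bounded cf.
apply: (@intg_bounded _ M); first exact: within_measurable.
by move=> x /Iopen_closed; exact: fM.
Qed.

Lemma intgMc h f : {within @Iclosed R, continuous h} -> intg f ->
  intg (fun x => h x * f x).
Proof.
move=> ch fi; have [M _ hM] := within_bounded ch.
apply: (@intgM _ _ M) => //; first exact: within_measurable.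
by move=> x /Iopen_closed; exact: hM.
Qed.

Lemma RintD f g : intg f -> intg g -> J (fun x => f x + g x) = J f + J g.
Proof. by move=> fi gi; rewrite -RintegralD. Qed.

Lemma RintB f g : intg f -> intg g -> J (fun x => f x - g x) = J f - J g.
Proof. by move=> fi gi; rewrite -RintegralB. Qed.

Lemma RintZ k f : intg f -> J (fun x => k * f x) = k * J f.
Proof. by move=> fi; rewrite -RintegralZl. Qed.

Lemma eq_Rint f g : (forall x, I x -> f x = g x) -> J f = J g.
Proof. by move=> fg; apply: eq_Rintegral => x /set_mem; exact: fg. Qed.

Lemma aeS (P Q : R -> Prop) : (forall x, P x -> Q x) ->
  {ae mu, forall x, P x} -> {ae mu, forall x, Q x}.
Proof. by apply: filterS; exact: (ae_filter_ringOfSetsType mu). Qed.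

Lemma Rint_ae f g : measurable_fun I f -> measurable_fun I g ->
  ae_eq_on I f g -> J f = J g.
Proof.
move=> mf mg fg; congr fine; apply: ae_eq_integral => //.
- exact/measurable_EFinP.
- exact/measurable_EFinP.
- by apply: aeS fg => x fg /fg ->.
Qed.

Lemma intg_ae f g : measurable_fun I f -> measurable_fun I g ->
  ae_eq_on I f g -> intg f -> intg g.
Proof.
move=> mf mg fg /integrableP[_ foo]; apply/integrableP; split.
  exact/measurable_EFinP.
rewrite (_ : (\int[mu]_(x in I) _)%E = (\int[mu]_(x in I) `|(f x)%:E|)%E) //.
apply: ae_eq_integral => //.
- by do 2 apply: measurableT_comp => //.
- by do 2 apply: measurableT_comp => //.
- by apply: aeS fg => x fg /fg /= ->.
Qed.

(** * Primitives as integrals against a step kernel *)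

Definition step x (t : R) : R := (t <= x)%R%:R.

Lemma measurable_step x (D : set R) : measurable_fun D (step x).
Proof.
apply: measurable_funTS.
rewrite (_ : step x = \1_(`]-oo, x]%classic)).
  by apply: measurable_indic; exact: measurable_itv.
by apply/funext => t; rewrite indicE mem_setE in_itv.
Qed.

Lemma step_le1 x t : `|step x t| <= 1.
Proof. by rewrite /step; case: (t <= x); rewrite ?normr1 ?normr0. Qed.

Lemma intg_step f x : intg f -> intg (fun t => f t * step x t).
Proof.
move=> fi; apply: (@eq_intg (fun t => step x t * f t)).
  by move=> t _; rewrite mulrC.
apply: (@intgM _ _ 1) => //; first exact: measurable_step.
by move=> t _; exact: step_le1.
Qed.

(** Integrating over all of the interval against a kernel keeps one fixed domain, so that linearity
    and Fubini apply directly. It also makes [prim f] total: zero to the left of -1 and constant to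
    the right of 1. *)
Definition prim f x : R := J (fun t => f t * step x t).

Lemma primE f x : prim f x = \int[mu]_(t in `]-oo, x]) (f \_ I) t.
Proof.
rewrite /prim Rintegral_mkcond [RHS]Rintegral_mkcond.
apply: eq_Rintegral => t _; rewrite /patch /step.
rewrite [t \in `]-oo, x]%classic](_ : _ = (t <= x)); last first.
  by rewrite mem_setE in_itv.
by case: (t \in I); case: (t <= x); rewrite ?mulr1 ?mulr0.
Qed.

Lemma prim_ge1 f x : 1 <= x -> prim f x = J f.
Proof.
move=> x1; apply: eq_Rint => t /IopenE/andP[_ t1].
by rewrite /step (ltW (lt_le_trans t1 x1)) mulr1.
Qed.

Lemma Rint0 : J (fun=> 0) = 0.
Proof. by rewrite /Rintegral integral0. Qed.

Lemma prim_leN1 f x : x <= -1 -> prim f x = 0.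
Proof.
move=> x1; rewrite -(Rint0).
apply: eq_Rint => t /IopenE/andP[t1 _].
by rewrite /step leNgt (le_lt_trans x1 t1) mulr0.
Qed.

Lemma primD f g x : intg f -> intg g ->
  prim (fun t => f t + g t) x = prim f x + prim g x.
Proof.
move=> fi gi; rewrite /prim -RintD; try exact: intg_step.
by apply: eq_Rint => t _; rewrite mulrDl.
Qed.

Lemma primZ k f x : intg f -> prim (fun t => k * f t) x = k * prim f x.
Proof.
move=> fi; rewrite /prim -RintZ; try exact: intg_step.
by apply: eq_Rint => t _; rewrite mulrA.
Qed.

Lemma primB f g x : intg f -> intg g ->
  prim (fun t => f t - g t) x = prim f x - prim g x.
Proof.
move=> fi gi; rewrite /prim -RintB; try exact: intg_step.
by apply: eq_Rint => t _; rewrite mulrBl.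
Qed.

Lemma eq_prim f g x : (forall t, I t -> f t = g t) -> prim f x = prim g x.
Proof. by move=> fg; apply: eq_Rint => t It; rewrite fg. Qed.

Lemma prim_ae f g x : intg f -> intg g -> ae_eq_on I f g -> prim f x = prim g x.
Proof.
move=> fi gi fg; apply: Rint_ae.
- exact: intg_measurable (intg_step _ fi).
- exact: intg_measurable (intg_step _ gi).
- by apply: aeS fg => t fg /fg ->.
Qed.

Lemma intg_patch f : intg f -> mu.-integrable setT (EFin \o (f \_ I)).
Proof.
move=> fi; rewrite -restrict_EFin.
by apply/integrable_restrict => //; rewrite setTI.
Qed.

Lemma prim_fun f : (fun x => \int[mu]_(t in [set` `]-oo, x]]) (f \_ I) t) = prim f.
Proof. by apply/funext => x; rewrite primE. Qed.

Lemma intg_patchS f y : intg f -> mu.-integrable `]-oo, y] (EFin \o (f \_ I)).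
Proof.
move=> fi; apply: integrableS (intg_patch fi) => //; exact: measurable_itv.
Qed.

Lemma prim_ae_derive f : intg f ->
  {ae mu, forall x, I x -> is_derive x (1 : R) (prim f) (f x)}.
Proof.
move=> fi.
have /= := @FTC1Ny R (f \_ I) (fun y => intg_patchS y fi)
  (integrable_locally_restrict measurable_Iopen fi).
rewrite prim_fun.
apply: aeS => x [dx Ex] Ix; apply: DeriveDef => //.
by rewrite -derive1E Ex patchE mem_set.
Qed.

Lemma prim_cont_derive f x : intg f -> I x -> {for x, continuous f} ->
  is_derive x (1 : R) (prim f) (f x).
Proof.
move=> fi Ix cf.
have x1 : x < x + 1 by rewrite ltrDl.
have nI : nbhs x I by apply: open_nbhs_nbhs; split => //; exact: open_Iopen.
have := @continuous_FTC1 R (f \_ I) -oo%O x _ x1 (intg_patchS _ fi).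
rewrite /= prim_fun => -[||dx Ex].
- by rewrite ltNyr.
- suff : (f \_ I) @ x --> (f \_ I) x by [].
  rewrite [X in _ --> X]patchE mem_set//; apply: cvg_trans cf.
  apply: near_eq_cvg; near=> t; rewrite patchE mem_set//.
  by near: t.
- by apply: DeriveDef => //; rewrite -derive1E Ex patchE mem_set.
Unshelve. all: by end_near. Qed.

Lemma prim_continuous f : intg f -> {within @Iclosed R, continuous (prim f)}.
Proof.
move=> fi.
have -> : prim f = fun x => parameterized_integral mu (-1) x (f \_ I).
  apply/funext => x; rewrite primE /parameterized_integral.
  rewrite Rintegral_mkcond [RHS]Rintegral_mkcond.
  apply: eq_Rintegral => t _; rewrite /patch.
  have [tI|tI] := boolP (t \in I); last by rewrite !if_same.
  congr (if _ then _ else _); rewrite !mem_setE !in_itv /=.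
  by move/set_mem/IopenE/andP: tI => [/ltW -> _].
apply: (@parameterized_integral_continuous _ (-1) 1); first by lra.
apply: integrableS (intg_patch fi) => //; exact: measurable_itv.
Qed.

Lemma prim_eq0 f : intg f -> (forall x, I x -> prim f x = 0) ->
  ae_eq_on I f (fun=> 0).
Proof.
move=> fi f0; apply: aeS (prim_ae_derive fi) => x df Ix.
have nI : nbhs x I by apply: open_nbhs_nbhs; split => //; exact: open_Iopen.
have d0 : is_derive x (1 : R) (prim f) 0.
  apply: (@near_eq_is_derive _ _ _ (fun=> 0)) => //.
  near=> t; rewrite f0//; near: t; exact: nI.
by rewrite -(@derive_val _ _ _ _ _ _ _ (df Ix)) (@derive_val _ _ _ _ _ _ _ d0).
Unshelve. all: by end_near. Qed.

Lemma integral_EFin f : intg f ->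
  (\int[mu]_x ((f \_ I) x)%:E = (J f)%:E)%E.
Proof.
move=> fi; rewrite Rintegral_mkcond /Rintegral fineK//.
exact: integrable_fin_num (intg_patch fi).
Qed.

Lemma integral_step_EFin f x : intg f ->
  (\int[mu]_y ((f \_ I) y * step x y)%:E = (prim f x)%:E)%E.
Proof.
move=> fi; rewrite /prim -integral_EFin; last exact: intg_step.
apply: eq_integral => y _; congr EFin; rewrite !patchE.
by case: ifP => _ //; rewrite mul0r.
Qed.

Lemma measurable_patch f : intg f -> measurable_fun setT (f \_ I).
Proof.
move=> fi; apply/measurable_EFinP; rewrite -restrict_EFin.
have /integrableP[] := intg_patch fi.
by rewrite restrict_EFin.
Qed.

Lemma measurable_step_prod :
  measurable_fun [set: measurableTypeR R * measurableTypeR R]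
    (fun z : measurableTypeR R * measurableTypeR R => step z.1 z.2).
Proof.
rewrite (_ : (fun _ => _) = fun z : measurableTypeR R * measurableTypeR R =>
   if (z.2 <= z.1)%R then 1 else 0 : R); last first.
  by apply/funext => z; rewrite /step; case: ifP.
apply: measurable_fun_ifT => //.
by apply: measurable_fun_ler.
Qed.

(** The kernel is at most 1, so by Tonelli the iterated integral of the absolute value is at most
    the product of the two L1 norms. *)
Lemma integrable_step_prod f g : intg f -> intg g ->
  (mu \x mu)%E.-integrable setT
    (fun z => ((f \_ I) z.1 * ((g \_ I) z.2 * step z.1 z.2))%:E).
Proof.
move=> fi gi.
have mK : measurable_fun [set: measurableTypeR R * measurableTypeR R]
    (fun z => ((f \_ I) z.1 * ((g \_ I) z.2 * step z.1 z.2))%:E).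
  apply/measurable_EFinP; apply: measurable_funM.
    by apply: measurableT_comp => //; exact: measurable_patch.
  apply: measurable_funM; last exact: measurable_step_prod.
  by apply: measurableT_comp => //; exact: measurable_patch.
apply/integrable12ltyP => //.
apply: (@le_lt_trans _ _ (\int[mu]_x (`|(f \_ I) x|%:E * (J (fun y => `|g y|))%:E))%E).
  apply: ge0_le_integral => //.
  - by move=> x _; apply: integral_ge0.
  - have mK' := measurableT_comp (@abse_measurable R setT) mK.
    exact: (measurable_fun_fubini_tonelli_F (m2 := mu) _ mK' (fun=> abse_ge0 _)).
  - apply: emeasurable_funM => //; apply/measurable_EFinP.
    by apply: measurableT_comp => //; exact: measurable_patch.
  - move=> x _ /=.
    have gn : intg (fun y => `|g y|) by exact: (integrable_norm gi).
    rewrite -integral_EFin// -integralZl//; last exact: intg_patch.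
    apply: ge0_le_integral => //.
    + apply/measurable_EFinP; apply: measurableT_comp => //.
      apply: measurable_funM => //; apply: measurable_funM.
        exact: measurable_patch.
      exact: measurable_step.
    + apply: measurable_funeM; apply/measurable_EFinP.
      exact: measurable_patch.
    + move=> y _; rewrite -EFinM lee_fin !normrM ler_wpM2l//.
      rewrite (_ : ((fun y => `|g y|) \_ I) y = `|(g \_ I) y|); last first.
        by rewrite !patchE; case: ifP => //; rewrite normr0.
      by rewrite ler_piMr// step_le1.
rewrite integralZr//; last first.
  by have := integrable_norm (intg_patch fi).
have := integral_EFin (integrable_norm fi).
rewrite (_ : (fun x => _) = (fun x => `|(f \_ I) x|%:E)); last first.
  by apply/funext => y; rewrite !patchE /=; case: ifP => //; rewrite normr0.
by move=> ->; rewrite -EFinM ltry.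
Qed.

Lemma intg_prim f g : intg f -> intg g -> intg (fun x => prim f x * g x).
Proof. by move=> fi gi; apply: intgMc => //; exact: prim_continuous. Qed.

Lemma ae_neq y : {ae mu, forall x : R, x != y}.
Proof.
exists [set y]; split; first exact: measurable_set1.
- exact: lebesgue_measure_set1.
- by move=> x /= /negP; rewrite negbK => /eqP.
Qed.

(** As a function of [x], [step x y] is the indicator of [[y, +oo[], which is the complement of
    [step y] up to the single point [y]. This evaluates the inner integral when Fubini exchanges the
    order. *)
Lemma prim_tail g y : intg g -> intg (fun x => g x * step x y) /\
  J (fun x => g x * step x y) = J g - prim g y.
Proof.
move=> gi.
have mg : measurable_fun I (fun x => g x * step x y).
  apply: measurable_funM; first exact: intg_measurable.
  apply: measurable_funTS.
  rewrite (_ : (fun _ => _) = \1_(`[y, +oo[%classic)).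
    by apply: measurable_indic; exact: measurable_itv.
  by apply/funext => t; rewrite /step indicE mem_setE in_itv andbT.
have ii : intg (fun x => g x - g x * step y x).
  by apply: intgB => //; exact: intg_step.
have ae : ae_eq_on I (fun x => g x - g x * step y x) (fun x => g x * step x y).
  apply: aeS (ae_neq y) => x xy _; rewrite /step; case: ltgtP xy => // xy _.
    by rewrite mulr1 mulr0 subrr.
  by rewrite mulr0 mulr1 subr0.
split; first exact: intg_ae (intg_measurable ii) mg ae ii.
rewrite /prim -RintB//; last exact: intg_step.
by apply/esym; exact: Rint_ae (intg_measurable ii) mg ae.
Qed.

(* Fubini on the triangle [y <= x]. *)
Lemma Rint_parts f g : intg f -> intg g ->
  J (fun x => prim f x * g x) = J f * J g - J (fun x => prim g x * f x).
Proof.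
move=> fi gi.
have := lebesgue_integral_fubini.Fubini (integrable_step_prod gi fi).
rewrite /= (_ : (\int[mu]_x _)%E = (J (fun x => prim f x * g x))%:E); last first.
  rewrite -integral_EFin; last exact: intg_prim.
  apply: eq_integral => x _.
  under eq_integral do rewrite EFinM.
  rewrite integralZl//=; last first.
    have := intg_patch (intg_step x fi); apply: eq_integrable => // y _ /=.
    by rewrite !patchE; case: ifP => //; rewrite mul0r.
  rewrite integral_step_EFin// -EFinM !patchE; case: ifP => _.
    by rewrite mulrC.
  by rewrite mul0r.
rewrite (_ : (\int[mu]_x _)%E = (J (fun x => J g * f x - prim g x * f x))%:E).
  move=> [->]; rewrite RintB//; [by rewrite RintZ// mulrC|exact: intgZ|].
  exact: intg_prim.
rewrite -integral_EFin; last first.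
  by apply: intgB; [exact: intgZ|exact: intg_prim].
apply: eq_integral => y _.
have [ii Ei] := prim_tail y gi.
rewrite (_ : (\int[mu]_x _)%E = (\int[mu]_x (((f \_ I) y)%:E *
    (((fun x => g x * step x y) \_ I) x)%:E))%E); last first.
  apply: eq_integral => x _; rewrite -EFinM; congr EFin.
  by rewrite !patchE; case: ifP => _; rewrite ?mul0r ?mulr0// mulrCA.
rewrite integralZl//; last exact: intg_patch.
rewrite integral_EFin// Ei -EFinM; congr EFin.
rewrite !patchE; case: ifP => _; last by rewrite mul0r.
by rewrite mulrBr mulrC [X in _ - X]mulrC.
Qed.

(** Both densities are cut off at [x] before [Rint_parts] is applied; at points below [x] the
    cut-off leaves the primitives unchanged. *)
Lemma prim_parts f g x : intg f -> intg g ->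
  prim (fun t => prim f t * g t + f t * prim g t) x = prim f x * prim g x.
Proof.
move=> fi gi.
have := Rint_parts (intg_step x fi) (intg_step x gi).
have E (a b : R -> R) : J (fun t => prim (fun s => a s * step x s) t * (b t * step x t)) =
    prim (fun t => prim a t * b t) x.
  apply: eq_Rint => t It; rewrite mulrA /step.
  case: leP => tx; last by rewrite !mulr0.
  rewrite !mulr1; congr (_ * _); apply: eq_Rint => s Is.
  rewrite /step; case: (leP s t) => st; last by rewrite !mulr0.
  by rewrite (le_trans st tx) !mulr1.
rewrite !E -!/(prim _ _) => /esym/eqP; rewrite subr_eq => /eqP ->.
rewrite primD; [|exact: intg_prim|by apply: (eq_intg _ (intg_prim gi fi)) => t _; rewrite mulrC].
by congr (_ + _); apply: eq_prim => t _; rewrite mulrC.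
Qed.

(** The density is an argument, so that no derivative has to be chosen; it matters only up to a null
    set, by [AC_ae] and [AC_unique]. Since [F] is constrained on the closed interval, continuity up
    to the boundary and the boundary terms of [AC_ibp] come for free. *)
Definition AC F f := intg f /\ forall x, Iclosed x -> F x = F (-1) + prim f x.

Lemma Iclosed_N1 : Iclosed (-1 : R).
Proof. by apply/IclosedE; lra. Qed.

Lemma Iclosed_1 : Iclosed (1 : R).
Proof. by apply/IclosedE; lra. Qed.

Lemma within_eq f g : (forall x, Iclosed x -> f x = g x) ->
  {within @Iclosed R, continuous f} -> {within @Iclosed R, continuous g}.
Proof.
move=> fg; apply: subspace_eq_continuous => x /set_mem Ix.
exact: fg.
Qed.

Lemma AC_within F f : AC F f -> {within @Iclosed R, continuous F}.
Proof.
move=> [fi Ff]; apply: (@within_eq (fun x => F (-1) + prim f x)).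
  by move=> x Ix; rewrite -Ff.
move=> x; apply: cvgD; first exact: cvg_cst.
exact: prim_continuous.
Qed.

Lemma AC_prim f : intg f -> AC (prim f) f.
Proof. by move=> fi; split => // x _; rewrite [prim f (-1)]prim_leN1// add0r. Qed.

Lemma AC_eq F G f g : (forall x, Iclosed x -> F x = G x) ->
  (forall x, I x -> f x = g x) -> AC F f -> AC G g.
Proof.
move=> FG fg [fi Ff]; split; first exact: eq_intg fi.
move=> x Ix; rewrite -!FG//; last exact: Iclosed_N1.
by rewrite Ff//; congr (_ + _); apply: eq_prim.
Qed.

Lemma AC_ae F f g : AC F f -> measurable_fun I g -> ae_eq_on I f g -> AC F g.
Proof.
move=> [fi Ff] mg fg.
have gi : intg g by exact: intg_ae (intg_measurable fi) mg fg fi.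
split => // x Ix; rewrite Ff//; congr (_ + _).
exact: prim_ae.
Qed.

Lemma AC_cst c : AC (fun=> c) (fun=> 0).
Proof.
split; first exact: intg_cst.
move=> x _; rewrite /prim (@eq_Rint _ (fun=> 0)) ?Rint0 ?addr0// => t _.
by rewrite mul0r.
Qed.

Opaque intg prim.

Lemma ACD F f G g : AC F f -> AC G g -> AC (fun x => F x + G x) (fun x => f x + g x).
Proof.
move=> [fi Ff] [gi Gg]; split; first exact: intgD.
by move=> x Ix; rewrite primD// Ff// Gg//; ring.
Qed.

Lemma ACZ k F f : AC F f -> AC (fun x => k * F x) (fun x => k * f x).
Proof.
move=> [fi Ff]; split; first exact: intgZ.
by move=> x Ix; rewrite primZ// Ff//; ring.
Qed.

Lemma ACN F f : AC F f -> AC (fun x => - F x) (fun x => - f x).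
Proof.
by move=> /(ACZ (-1)); apply: AC_eq => x _; rewrite mulN1r.
Qed.

Lemma ACB F f G g : AC F f -> AC G g -> AC (fun x => F x - G x) (fun x => f x - g x).
Proof. by move=> Ff /ACN; exact: ACD. Qed.

Lemma ACM F f G g : AC F f -> AC G g ->
  AC (fun x => F x * G x) (fun x => f x * G x + F x * g x).
Proof.
move=> Ff Gg; have cF := AC_within Ff; have cG := AC_within Gg.
case: Ff Gg => fi Ff [gi Gg].
have fGi : intg (fun x => f x * G x).
  by apply: (eq_intg _ (intgMc cG fi)) => t _; rewrite mulrC.
have Fgi : intg (fun x => F x * g x) by exact: intgMc.
have pfi : intg (fun x => prim f x * g x) by exact: intg_prim.
have pgi : intg (fun x => f x * prim g x).
  by apply: (eq_intg _ (intg_prim gi fi)) => t _; rewrite mulrC.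
split; first exact: intgD.
move=> x Ix; rewrite (@eq_prim _ (fun t => G (-1) * f t + F (-1) * g t +
    (prim f t * g t + f t * prim g t))); last first.
  move=> t /Iopen_closed It; rewrite (Ff t It) (Gg t It).
  by move: (prim f t) (prim g t) (F (-1)) (G (-1)) => *; ring.
rewrite (primD x (intgD (intgZ _ fi) (intgZ _ gi)) (intgD pfi pgi)).
rewrite (primD x (intgZ _ fi) (intgZ _ gi)) (primZ _ x fi) (primZ _ x gi).
rewrite (prim_parts _ fi gi) (Ff x Ix) (Gg x Ix).
by move: (prim f x) (prim g x) (F (-1)) (G (-1)) => *; ring.
Qed.

Lemma AC_ibp F f G g : AC F f -> AC G g ->
  J (fun x => f x * G x + F x * g x) = F 1 * G 1 - F (-1) * G (-1).
Proof.
move=> Ff Gg; have [_ /(_ 1 Iclosed_1) ->] := ACM Ff Gg.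
rewrite prim_ge1//.
by rewrite addrAC subrr add0r.
Qed.

Lemma AC_unique F f g : AC F f -> AC F g -> ae_eq_on I f g.
Proof.
move=> [fi Ff] [gi Gg].
have := @prim_eq0 (fun x => f x - g x) (intgB fi gi).
move=> /(_ _)/(aeS _); apply => [x /[apply] /eqP|x Ix].
  by rewrite subr_eq0 => /eqP.
rewrite primB//; apply/eqP; rewrite subr_eq0; apply/eqP.
by have := Gg x (Iopen_closed Ix); rewrite (Ff x (Iopen_closed Ix)) => /addrI.
Qed.

Lemma nbhs_Iopen x : I x -> nbhs x I.
Proof. by move=> Ix; apply: open_nbhs_nbhs; split => //; exact: open_Iopen. Qed.

Lemma AC_derive F f x : AC F f -> I x -> {for x, continuous f} ->
  is_derive x (1 : R) F (f x).
Proof.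
move=> [fi Ff] Ix cf.
apply: (@near_eq_is_derive _ _ _ (fun t => F (-1) + prim f t)) => //.
  near=> t; rewrite -Ff//; apply: Iopen_closed; near: t; exact: nbhs_Iopen.
rewrite -[f x]add0r; apply: is_deriveD.
exact: prim_cont_derive.
Unshelve. all: by end_near. Qed.

Lemma derive0_cst h : {within @Iclosed R, continuous h} ->
  (forall x, I x -> is_derive x (1 : R) h 0) -> forall x, Iclosed x -> h x = h (-1).
Proof.
move=> ch dh x /IclosedE/andP[]; rewrite le_eqVlt => /predU1P[<-//|x1 x2].
have [||c _] := @MVT _ h (fun=> 0) (-1) x x1.
- by move=> t; rewrite in_itv /= => /andP[t1 t2]; apply: dh; apply/IopenE; lra.
- apply: continuous_subspaceW ch => t /=; rewrite in_itv /= => /andP[t1 tx].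
  by apply/IclosedE; rewrite t1 (le_trans tx x2).
- by rewrite mul0r => /eqP; rewrite subr_eq0 => /eqP.
Qed.

Lemma within_interior f x : {within @Iclosed R, continuous f} -> I x ->
  {for x, continuous f}.
Proof.
move=> cf /IopenE Ix; have N11 : -1 < 1 :> R by lra.
by have [+ _ _] := (continuous_within_itvP f N11).1 cf; apply; rewrite in_itv.
Qed.

Lemma AC_C1 F f : {within @Iclosed R, continuous F} ->
  {within @Iclosed R, continuous f} ->
  (forall x, I x -> is_derive x (1 : R) F (f x)) -> AC F f.
Proof.
move=> cF cf dF; have fi := intg_within cf; split => // x Ix.
have /(_ _ _ x Ix) := @derive0_cst (fun t => F t - prim f t).
rewrite [prim f (-1)]prim_leN1// subr0 => /(_ _ _)/eqP.
rewrite subr_eq => E; apply/eqP/E.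
  by move=> t; apply: cvgB; [exact: cF|exact: prim_continuous].
move=> t It; rewrite -(subrr (f t)); apply: is_deriveB; first exact: dF.
apply: prim_cont_derive => //.
exact: within_interior.
Qed.

(** * Reflection in the origin *)

Lemma Iopen_opp x : I (- x) <-> I x.
Proof. by split => /IopenE Ix; apply/IopenE; move: Ix; lra. Qed.

Lemma Iclosed_opp x : Iclosed (- x) <-> Iclosed x.
Proof. by split => /IclosedE Ix; apply/IclosedE; move: Ix; lra. Qed.

Lemma patch_opp f x : ((fun t => f (- t)) \_ I) x = (f \_ I) (- x).
Proof.
by rewrite !patchE; congr (if _ then _ else _); apply/idP/idP => /set_mem ?;
  apply/mem_set; apply/Iopen_opp; rewrite ?opprK.
Qed.

Lemma intg_unpatch f : mu.-integrable setT (EFin \o (f \_ I)) -> intg f.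
Proof.
by rewrite -restrict_EFin; exact: (integrable_mkcond _ measurable_Iopen).2.
Qed.

Lemma measurable_oppmR :
  measurable_fun [set: measurableTypeR R] (-%R : measurableTypeR R -> measurableTypeR R).
Proof. exact: oppr_measurable. Qed.

Lemma integral_oppE (h : measurableTypeR R -> \bar R) : measurable_fun setT h ->
  (forall x, 0 <= h x)%E -> (\int[mu]_x h (- (x : R))%R = \int[mu]_x h x)%E.
Proof.
move=> mh h0.
have := ge0_integral_pushforward measurable_oppmR mu measurableT mh (fun x _ => h0 x).
rewrite preimage_setT => <-.
by apply: eq_measure_integral => A mA _; exact: lebesgue_measureN.
Qed.

Lemma intg_opp f : intg f -> intg (fun t => f (- t)).
Proof.
move=> fi; have mf := measurable_patch fi.
have /integrableP[m1 oo] := intg_patch fi.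
apply: intg_unpatch; apply/integrableP; split.
  apply/measurable_EFinP; rewrite (_ : _ \_ I = (f \_ I) \o -%R); last first.
    by apply/funext => x; rewrite patch_opp.
  exact: measurableT_comp mf measurable_oppmR.
rewrite (_ : (\int[mu]_x _)%E = (\int[mu]_x `|((f \_ I) x)%:E|)%E) //.
rewrite -[RHS]integral_oppE//; last first.
  by apply: measurableT_comp => //; apply/measurable_EFinP.
by apply: eq_integral => x _; rewrite /= patch_opp.
Qed.

Lemma Rint_opp f : intg f -> J (fun t => f (- t)) = J f.
Proof.
move=> fi; have mf := measurable_patch fi.
rewrite Rintegral_mkcond [RHS]Rintegral_mkcond /Rintegral; congr fine.
transitivity (\int[pushforward mu (-%R : measurableTypeR R -> measurableTypeR R)]_x ((f \_ I) x)%:E)%E.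
  rewrite integral_pushforward//=.
  - by rewrite preimage_setT; apply: eq_integral => x _ /=; rewrite patch_opp.
  - exact/measurable_EFinP.
  - rewrite preimage_setT; have := intg_patch (intg_opp fi).
    by apply: eq_integrable => // x _ /=; rewrite patch_opp.
by apply: eq_measure_integral => A mA _; exact: lebesgue_measureN.
Qed.

(** Reflection carries the integral up to [x] to the integral from [- x] onwards, which [prim_tail]
    evaluates. *)
Lemma prim_opp f x : intg f -> prim (fun t => f (- t)) x = J f - prim f (- x).
Proof.
move=> fi; have [ii <-] := prim_tail (- x) fi.
rewrite -(Rint_opp ii); apply: eq_Rint => t _.
by rewrite /step lerN2.
Qed.

Lemma AC_opp F f : AC F f -> AC (fun t => F (- t)) (fun t => - f (- t)).
Proof.
move=> [fi Ff]; split; first exact/intgN/intg_opp.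
move=> x Ix; rewrite (@eq_prim _ (fun t => -1 * f (- t))); last first.
  by move=> t _; rewrite mulN1r.
rewrite primZ; last exact: intg_opp.
rewrite prim_opp// mulN1r opprK.
rewrite (Ff _ Iclosed_1) (Ff (- x)); last exact/Iclosed_opp.
rewrite -(prim_ge1 f (lexx 1)).
by move: (F (-1)) (prim f 1) (prim f (- x)) => *; ring.
Qed.

End Integration.

(** * Test functions and weak derivatives *)

Section Weak.
Context {R : realType}.
Local Notation mu := (@lebesgue_measure R).
Local Notation I := (@Iopen R).
Local Notation J f := (\int[mu]_(x in I) f x).
Implicit Types (f g h : R -> R) (x y : R).
Opaque intg prim.

Lemma dvD f g x a b : is_derive x (1 : R) f a -> is_derive x (1 : R) g b ->
  is_derive x (1 : R) (fun t => f t + g t) (a + b).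
Proof. by move=> ? ?; exact: is_deriveD. Qed.

Lemma dvB f g x a b : is_derive x (1 : R) f a -> is_derive x (1 : R) g b ->
  is_derive x (1 : R) (fun t => f t - g t) (a - b).
Proof. by move=> ? ?; exact: is_deriveB. Qed.

Lemma dvN f x a : is_derive x (1 : R) f a -> is_derive x (1 : R) (fun t => - f t) (- a).
Proof. by move=> ?; exact: is_deriveN. Qed.

Lemma dvM f g x a b : is_derive x (1 : R) f a -> is_derive x (1 : R) g b ->
  is_derive x (1 : R) (fun t => f t * g t) (a * g x + f x * b).
Proof.
move=> fa gb; apply: (is_derive_eq (is_deriveM fa gb)).
by rewrite addrC; congr (_ + _); rewrite [LHS]mulrC.
Qed.

Lemma dvc (c x : R) : is_derive x (1 : R) (fun=> c) 0.
Proof. exact: is_derive_cst. Qed.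

Lemma dvid x : is_derive x (1 : R) (fun t => t) 1.
Proof. exact: is_derive_id. Qed.

Lemma dvcomp f g x a b : is_derive (g x) (1 : R) f a -> is_derive x (1 : R) g b ->
  is_derive x (1 : R) (fun t => f (g t)) (a * b).
Proof. by move=> ? ?; exact: is_derive1_comp. Qed.

Lemma dv_derive1 f x a : is_derive x (1 : R) f a -> derive1 f x = a.
Proof. by move=> fa; rewrite derive1E derive_val. Qed.

Lemma dv_near f g x a : (\forall t \near x, f t = g t) ->
  is_derive x (1 : R) f a -> is_derive x (1 : R) g a.
Proof. exact: near_eq_is_derive. Qed.

Lemma dv_cont f x a : is_derive x (1 : R) f a -> {for x, continuous f}.
Proof. by move=> fa; apply: differentiable_continuous; apply/derivable1_diffP. Qed.

(** Every smoothness claim of the development comes from a class of functions stable under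
    differentiation. An iterated derivative agrees with a member of the class on [O] only; openness
    of [O] lets this agreement survive one more differentiation. *)
Lemma smooth_closure (O : set R) (S : set (R -> R)) : open O ->
  (forall f, S f -> exists2 g, S g & forall x, O x -> is_derive x (1 : R) f (g x)) ->
  forall f, S f -> smooth_on O f.
Proof.
move=> oO HS.
have key n f : S f -> exists2 g, S g & forall x, O x -> derive1n n f x = g x.
  elim: n => [|n IHn] Sf; first by exists f.
  have [g Sg fg] := IHn Sf; have [g' Sg' gg'] := HS g Sg.
  exists g' => // x Ox; rewrite derive1nS; apply: dv_derive1.
  apply: dv_near (gg' x Ox).
  have : nbhs x O by apply: open_nbhs_nbhs.
  by apply: filterS => t Ot; rewrite fg.
move=> f Sf n x Ox; have [g Sg fg] := key n f Sf; have [g' _ gg'] := HS g Sg.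
have : is_derive x (1 : R) (derive1n n f) (g' x).
  apply: dv_near (gg' x Ox).
  have : nbhs x O by apply: open_nbhs_nbhs.
  by apply: filterS => t Ot; rewrite fg.
by case.
Qed.

Lemma smooth_derive1 (O : set R) f : smooth_on O f -> smooth_on O (derive1 f).
Proof. by move=> sf n x Ox; rewrite -derive1Sn; exact: sf. Qed.

Lemma smooth_dv (O : set R) f x : smooth_on O f -> O x ->
  is_derive x (1 : R) f (derive1 f x).
Proof.
by move=> sf Ox; apply: DeriveDef; [exact: (sf 0)|rewrite derive1E].
Qed.

(** The family [x^(-k) exp(-1/x)], extended by zero. The index is needed because differentiating the
    case [k = 0] produces higher negative powers; the linear span of the family is stable under
    differentiation. *)
Definition bump_fun (k : nat) x : R :=
  if 0 < x then x^-1 ^+ k * expR (- x^-1) else 0.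

(** With [y = 1/x], the exponential series gives [y^(k+2) / (k+2)! <= exp y]. Quadratic decay at 0
    suffices for the derivative there to exist and vanish, by [dv_sq]. *)
Lemma bump_fun_bound k x : 0 <= bump_fun k x <= (k.+2)`!%:R * x ^+ 2.
Proof.
rewrite /bump_fun; case: ifPn => x0; last by rewrite lexx mulr_ge0 ?sqr_ge0.
have y0 : 0 < x^-1 by rewrite invr_gt0.
have f0 : 0 < (k.+2)`!%:R :> R by rewrite ltr0n fact_gt0.
apply/andP; split; first by rewrite mulr_ge0 ?exprn_ge0 ?ltW ?expR_gt0.
have := @expR_ge1Dxn _ _ k.+1 (ltW y0).
rewrite expRN ler_pdivrMr ?expR_gt0// => H.
have : x^-1 ^+ k.+2 / (k.+2)`!%:R <= expR x^-1 by apply: le_trans H; rewrite lerDr.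
rewrite ler_pdivrMr// => {}H.
rewrite mulrAC -ler_pdivrMr ?exprn_gt0//.
by rewrite -exprVn -exprD addn2 mulrC.
Qed.

Lemma dv_sq f (C : R) : 0 < C -> (forall h : R, `|f h| <= C * h ^+ 2) ->
  is_derive (0 : R) (1 : R) f 0.
Proof.
move=> C0 fC.
have f0 : f 0 = 0.
  by have := fC 0; rewrite expr0n mulr0 normr_le0 => /eqP.
have H : (fun h : R => h^-1 *: (f (h *: (1 : R) + 0) - f 0)) @ 0^' --> (0 : R).
  apply/cvgrPdist_le => e e0; near=> h.
  have h0 : h != 0 by near: h; exact: nbhs_dnbhs_neq.
  rewrite f0 subr0 addr0 sub0r normrN [h *: 1]mulr1 normrM.
  rewrite normfV mulrC ler_pdivrMr ?normr_gt0//.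
  apply: (le_trans (fC h)); rewrite -[h ^+ 2]ger0_norm ?sqr_ge0// normrX expr2.
  rewrite mulrA ler_wpM2r// mulrC -ler_pdivlMr//.
  near: h; apply: nbhs_dnbhs; apply/nbhs_normP; exists (e / C); first exact: divr_gt0.
  by move=> h /=; rewrite sub0r normrN => /ltW.
by apply: DeriveDef; [apply/cvg_ex; exists 0|exact: cvg_lim].
Unshelve. all: by end_near. Qed.

Lemma dvX n f x a : is_derive x (1 : R) f a ->
  is_derive x (1 : R) (fun t => f t ^+ n) (n%:R * f x ^+ n.-1 * a).
Proof.
move=> fa; rewrite (_ : (fun t => _) = f ^+ n); first exact: (is_deriveX n fa).
by apply/funext => t; rewrite exprfctE.
Qed.

Lemma dv_bump_fun k x :
  is_derive x (1 : R) (bump_fun k) (- k%:R * bump_fun k.+1 x + bump_fun k.+2 x).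
Proof.
have [x0|x0|->] := ltgtP x 0.
- rewrite /bump_fun ltNge (ltW x0) /= mulr0 addr0.
  apply: (dv_near _ (dvc 0 x)).
  by near=> t; rewrite ltNge ltW//; near: t; exact: lt_nbhsl.
- rewrite /bump_fun x0.
  apply: (@dv_near (fun t => t^-1 ^+ k * expR (- t^-1))).
    by near=> t; rewrite ifT//; near: t; exact: lt_nbhsr.
  have di : is_derive x (1 : R) (fun t => t^-1) (- x ^- 2).
    apply: (is_derive_eq (@is_deriveV R id x 1 1 (lt0r_neq0 x0) (dvid x))).
    by rewrite [LHS]mulr1.
  have de := dvcomp (is_derive_expR _) (dvN di).
  have dX := dvX k di.
  apply: (is_derive_eq (dvM dX de)).
  rewrite -exprVn opprK.
  move: x^-1 (expR _) => y z.
  by case: k {dX} => [|n]; rewrite /= ?mulr0n ?exprS; [ring|rewrite -natr1; ring].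
- rewrite {2 3}/bump_fun ltxx mulr0 addr0.
  apply: (@dv_sq _ (k.+2)`!%:R); first by rewrite ltr0n fact_gt0.
  by move=> h; have /andP[h0 h1] := bump_fun_bound k h; rewrite ger0_norm.
Unshelve. all: by end_near. Qed.

(** For [a <= b] and [N > 0] this is positive exactly on []a, b[]. It tends to infinity there as [N]
    grows, so that the bumps tend to the indicator of the interval. *)
Definition bump_arg (a b N : R) x := N * ((x - a) * (b - x)).

Inductive bump_alg (a b N : R) : (R -> R) -> Prop :=
| bump_alg_fun k : bump_alg a b N (fun x => bump_fun k (bump_arg a b N x))
| bump_alg_c c : bump_alg a b N (fun=> c)
| bump_alg_id : bump_alg a b N (fun x => x)
| bump_algD f g : bump_alg a b N f -> bump_alg a b N g -> bump_alg a b N (fun x => f x + g x)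
| bump_algM f g : bump_alg a b N f -> bump_alg a b N g -> bump_alg a b N (fun x => f x * g x).

Lemma bump_alg_dv a b N f : bump_alg a b N f ->
  exists2 g, bump_alg a b N g & forall x, is_derive x (1 : R) f (g x).
Proof.
elim => [k|c||{}f1 f2 _ [g1 S1 d1] _ [g2 S2 d2]|{}f1 f2 S1' [g1 S1 d1] S2' [g2 S2 d2]].
- exists (fun x => (- k%:R * bump_fun k.+1 (bump_arg a b N x)
                 + bump_fun k.+2 (bump_arg a b N x)) * (N * ((a + b) + (- 2 * x)))).
    apply: bump_algM; first apply: bump_algD.
    + by apply: (bump_algM (bump_alg_c _ _ _ _) (bump_alg_fun _ _ _ _)).
    + exact: bump_alg_fun.
    + apply: (bump_algM (bump_alg_c _ _ _ _)); apply: (bump_algD (bump_alg_c _ _ _ _)).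
      exact: (bump_algM (bump_alg_c _ _ _ _) (bump_alg_id _ _ _)).
  move=> x; apply: (dvcomp (dv_bump_fun _ _)).
  apply: (is_derive_eq (dvM (dvc N x) (dvM (dvB (dvid x) (dvc a x)) (dvB (dvc b x) (dvid x))))).
  by ring.
- by exists (fun=> 0) => [|x]; [exact: bump_alg_c|exact: dvc].
- by exists (fun=> 1) => [|x]; [exact: bump_alg_c|exact: dvid].
- by exists (fun x => g1 x + g2 x) => [|x]; [exact: bump_algD|exact: dvD].
- exists (fun x => g1 x * f2 x + f1 x * g2 x) => [|x]; last exact: dvM.
  by apply: bump_algD; exact: bump_algM.
Qed.

Definition bump a b N x := bump_fun 0 (bump_arg a b N x).

Lemma bump_smooth a b N : smooth_on setT (bump a b N).
Proof.
apply: (@smooth_closure _ (bump_alg a b N)); first exact: openT.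
  by move=> f /bump_alg_dv[g Sg fg]; exists g.
exact: bump_alg_fun.
Qed.

Lemma bump_ge0 a b N x : 0 <= bump a b N x.
Proof. by have /andP[] := bump_fun_bound 0 (bump_arg a b N x). Qed.

Lemma bump_le1 a b N x : bump a b N x <= 1.
Proof.
rewrite /bump /bump_fun; case: ifP => // h; rewrite expr0 mul1r.
by rewrite -expR0 ler_expR oppr_le0 invr_ge0 ltW.
Qed.

Lemma bump_out a b N x : a <= b -> 0 < N -> ~~ (a < x < b) -> bump a b N x = 0.
Proof.
move=> ab N0 axb; rewrite /bump /bump_fun ifF//; apply/negP.
rewrite /bump_arg pmulr_rgt0// => h; move/negP: axb; apply.
apply/andP; split; rewrite ltNge; apply/negP => h'; move: h; rewrite ltNge => /negP[].
  by rewrite mulr_le0_ge0 ?subr_le0 ?subr_ge0 ?(le_trans h').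
by rewrite mulr_ge0_le0 ?subr_le0 ?subr_ge0 ?(le_trans ab).
Qed.

Lemma bump_in a b N x : 0 < N -> a < x < b ->
  bump a b N x = expR (- ((N * ((x - a) * (b - x)))^-1)).
Proof.
move=> N0 /andP[ax xb]; rewrite /bump /bump_fun /bump_arg ifT ?expr0 ?mul1r//.
by rewrite !mulr_gt0// subr_gt0.
Qed.

Lemma bump_cvg a b x : a <= b ->
  bump a b n.+1%:R x @[n --> \oo] --> ((a < x < b)%R%:R : R).
Proof.
move=> ab; have [h|h] := boolP (a < x < b); last first.
  by under eq_fun do rewrite bump_out//; exact: cvg_cst.
under eq_fun do rewrite bump_in//.
have -> : true%:R = expR (- 0) :> R by rewrite oppr0 expR0.
apply: continuous_cvg; first exact: continuous_expR.
apply: cvgN; under eq_fun do rewrite invfM.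
suff : (fun n => n.+1%:R^-1 * ((x - a) * (b - x))^-1) @ \oo --> 0 * ((x - a) * (b - x))^-1.
  by rewrite mul0r; exact.
by apply: cvgM; [exact: cvg_harmonic|exact: cvg_cst].
Qed.

#[local] Hint Resolve measurable_Iopen : core.

Lemma Rint_dominated (f_ : nat -> R -> R) f g :
  (forall n, measurable_fun I (f_ n)) -> measurable_fun I f -> intg g ->
  (forall n x, I x -> `|f_ n x| <= g x) ->
  (forall x, I x -> f_ n x @[n --> \oo] --> f x) ->
  J (f_ n) @[n --> \oo] --> J f.
Proof.
move=> mf_ mf gi fg cf.
have fg' x : I x -> `|f x| <= g x.
  move=> Ix; have : `|f_ n x| @[n --> \oo] --> `|f x| by apply: cvg_norm; exact: cf.
  by move=> /cvgr_to_le; apply; near=> n; exact: fg.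
have fi : intg f by exact: le_intg gi.
move: (gi) (fi) => /intgP gI /intgP fI.
apply: fine_cvg; rewrite fineK; last exact: integrable_fin_num.
apply: (@dominated_cvg _ _ _ mu _ _ _ _ (EFin \o g)) => //.
- by move=> n; apply/measurable_EFinP; exact: (mf_ n).
- by move=> x Ix; apply/fine_cvgP; split; [exact: nearW|exact: cf].
Unshelve. all: by end_near. Qed.

(** * Test functions on the open interval *)

Lemma test_intro (c d : R) f : smooth_on setT f -> -1 < c -> d < 1 ->
  (forall x, ~~ (c <= x <= d) -> f x = 0) -> test_function I f.
Proof.
move=> sf c1 d1 f0.
have sub : closure [set x | f x != 0] `<=` `[c, d].
  apply: (@subset_trans _ (closure `[c, d])).
    apply: closure_subset => x /= fx; rewrite in_itv /=.
    by apply: contraNT fx => /f0 ->.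
  by rewrite -(closure_id _).1//; exact: itv_closed.
split => //.
- apply: (subclosed_compact _ _ sub); first exact: closed_closure.
  exact: segment_compact.
- move=> x /sub /=; rewrite in_itv /= => /andP[cx xd]; apply/IopenE.
  by rewrite (lt_le_trans c1 cx) (le_lt_trans xd d1).
Qed.

(** The closed support avoids both endpoints and its complement is open, so the function vanishes
    near each of them. *)
Lemma test_support f : test_function I f ->
  exists2 e : R, 0 < e < 1 & forall x, ~~ (-1 + e <= x <= 1 - e) -> f x = 0.
Proof.
move=> [_ cK KI]; set K := closure _ in cK KI.
have oK : open (~` K) by apply: closed_openC; exact: closed_closure.
have nK y : ~ I y -> exists2 e : R, 0 < e & forall x, `|y - x| < e -> f x = 0.
  move=> Iy; have : nbhs y (~` K) by apply: open_nbhs_nbhs; split => // /KI.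
  move=> /nbhs_normP[e e0 He]; exists e => // x xy.
  have := He x xy; apply: contra_notP => /eqP fx; exact: subset_closure.
have out x : ~ I x -> f x = 0.
  by move=> Ix; have [e e0 ->//] := nK x Ix; rewrite subrr normr0.
have nI1 : ~ I 1 by move=> /IopenE; lra.
have nI2 : ~ I (-1) by move=> /IopenE; lra.
have [e1 e10 H1] := nK 1 nI1.
have [e2 e20 H2] := nK (-1) nI2.
pose m := Num.min (Num.min e1 e2) 1.
have m0 : 0 < m by rewrite !lt_min e10 e20 ltr01.
have m1 : m <= e1 by rewrite !ge_min lexx.
have m2 : m <= e2 by rewrite !ge_min lexx orbT.
have m3 : m <= 1 by rewrite ge_min lexx orbT.
exists (m / 2); first by lra.
move=> x Hx; have [Ix|] := pselect (I x); last exact: out.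
move/IopenE : Ix => /andP[x1 x2].
have /orP[h|h] : (x < -1 + m / 2) || (1 - m / 2 < x).
  by rewrite !ltNge -negb_and.
- by apply: H2; rewrite ltr0_norm; lra.
- by apply: H1; rewrite gtr0_norm; lra.
Qed.

Lemma test_out f x : test_function I f -> ~ I x -> f x = 0.
Proof.
move=> /test_support[e /andP[e0 _] fe] Ix; apply: fe; apply/negP => /andP[xe ex].
by apply: Ix; apply/IopenE; lra.
Qed.

Lemma bump_test a b (n : nat) : -1 < a -> a <= b -> b < 1 ->
  test_function I (bump a b n.+1%:R).
Proof.
move=> a1 ab b1; apply: (test_intro _ a1 b1); first exact: bump_smooth.
move=> x Hx; apply: bump_out => //; apply: contra Hx => /andP[/ltW -> /ltW ->].
by [].
Qed.

Lemma smooth_within f : smooth_on setT f -> continuous f.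
Proof. by move=> sf x; apply: dv_cont (smooth_dv sf _). Qed.

Lemma continuous_within (D : set R) f : continuous f -> {within D, continuous f}.
Proof. exact: continuous_subspaceT. Qed.

Lemma test_derive1 f : test_function I f -> test_function I (derive1 f).
Proof.
move=> tf; have [sf _ _] := tf; have [e /andP[e0 e1] fe] := test_support tf.
apply: (@test_intro (-1 + e / 2) (1 - e / 2)); [exact: smooth_derive1|lra|lra|].
move=> x Hx; apply: dv_derive1; apply: (dv_near _ (dvc 0 x)).
have : nbhs x (~` `[(-1 + e), (1 - e)]).
  apply: open_nbhs_nbhs; split; first by apply: closed_openC; exact: itv_closed.
  rewrite /= in_itv /=; move/negP: Hx; apply: contra_not => /andP[h1 h2].
  by apply/andP; split; lra.
by apply: filterS => t; rewrite /= in_itv /= => /negP /fe ->.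
Qed.

Lemma test_AC f : test_function I f -> AC f (derive1 f).
Proof.
move=> tf; have [sf _ _] := tf; have [sf' _ _] := test_derive1 tf.
apply: AC_C1; [exact: continuous_within (smooth_within sf)|
               exact: continuous_within (smooth_within sf')|].
by move=> x _; exact: (smooth_dv sf).
Qed.

(** Zero mean makes the primitive vanish to the right of the support as well as to the left, so its
    support is again compact in the open interval. *)
Lemma test_prim f : test_function I f -> J f = 0 -> exists2 F,
  test_function I F & forall x, derive1 F x = f x.
Proof.
move=> tf Jf; have [sf _ _] := tf; have [e /andP[e0 e1] fe] := test_support tf.
have [fi _] := test_AC tf.
have fi0 : intg f by exact: intg_within (continuous_within (smooth_within sf)).
have out x : ~~ (-1 + e <= x <= 1 - e) -> prim f x = 0.
  rewrite negb_and -!ltNge => /orP[xe|xe].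
    rewrite -(@Rint0 R); have -> : prim f x = J (fun t => f t * step x t) by [].
    apply: eq_Rint => t _; rewrite /step; case: (leP t x) => tx; last by rewrite mulr0.
    by rewrite fe ?mul0r// negb_and -!ltNge (le_lt_trans tx xe).
  have [_ ] := prim_tail x fi0; rewrite Jf sub0r => /esym/eqP.
  rewrite eqr_oppLR => /eqP ->; apply/eqP; rewrite oppr_eq0 -(@Rint0 R); apply/eqP.
  apply: eq_Rint => t _; rewrite /step; case: (leP x t) => tx; last by rewrite mulr0.
  by rewrite fe ?mul0r// negb_and -!ltNge (lt_le_trans xe tx) orbT.
have dF x : is_derive x (1 : R) (prim f) (f x).
  have [Ix|Ix] := pselect (I x).
    by apply: prim_cont_derive => //; exact: smooth_within.
  rewrite test_out//; apply: (dv_near _ (dvc 0 x)).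
  have : nbhs x (~` `[(-1 + e), (1 - e)]).
    apply: open_nbhs_nbhs; split; first by apply: closed_openC; exact: itv_closed.
    rewrite /= in_itv /=; apply: contra_not Ix => /andP[h1 h2].
    by apply/IopenE; lra.
  by apply: filterS => t; rewrite /= in_itv /= => /negP /out ->.
exists (prim f); last by move=> x; exact: dv_derive1.
apply: (@test_intro (-1 + e) (1 - e)) => //; [|lra|lra].
apply: (@smooth_closure _ [set g | g = prim f \/ exists n, g = derive1n n f]).
- exact: openT.
- move=> _ [->|[n ->]]; first by exists f => //; right; exists 0.
  exists (derive1n n.+1 f); first by right; exists n.+1.
  move=> x _; rewrite derive1nS; apply: DeriveDef; first exact: sf.
  by rewrite derive1E.
- by left.
Qed.

Lemma measurable_itvb a b (D : set R) :
  measurable_fun D (fun t => (a < t < b)%R%:R : R).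
Proof.
apply: measurable_funTS; rewrite (_ : (fun _ => _) = \1_(`]a, b[%classic)).
  by apply: measurable_indic; exact: measurable_itv.
by apply/funext => t; rewrite indicE mem_setE in_itv.
Qed.

Lemma loc_intg f c d : locally_integrable I f -> -1 < c -> d < 1 ->
  intg (f \_ `[c, d]).
Proof.
move=> [mf _ lf] c1 d1.
have sub : `[c, d] `<=` I.
  move=> x /=; rewrite in_itv /= => /andP[cx xd]; apply/IopenE; lra.
apply/intgP; rewrite -restrict_EFin; apply/integrable_restrict => //.
rewrite setIidr//; apply/integrableP; split.
  by apply/measurable_EFinP; exact: (measurable_funS measurable_Iopen sub mf).
by apply: lf => //; exact: segment_compact.
Qed.

Lemma aeI (P Q : R -> Prop) : {ae mu, forall x, P x} ->
  {ae mu, forall x, Q x} -> {ae mu, forall x, P x /\ Q x}.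
Proof.
move=> aP aQ; have F := ae_filter_ringOfSetsType mu.
by apply: filterS2 aP aQ => x Px Qx.
Qed.

(** On a compact subinterval, bumps converge boundedly to indicators of intervals, so by dominated
    convergence [f] integrates to zero over every interval there. Its primitive then vanishes, hence
    so does [f] almost everywhere; compact subintervals exhaust the domain. *)
Lemma fundamental_lemma f : locally_integrable I f ->
  (forall phi, test_function I phi -> J (fun x => f x * phi x) = 0) ->
  ae_eq_on I f (fun=> 0).
Proof.
move=> lf Hf.
have key c d : -1 < c -> d < 1 -> ae_eq_on I (f \_ `[c, d]) (fun=> 0).
  move=> c1 d1; set fc := f \_ `[c, d]; have fi : intg fc by exact: loc_intg.
  have ab0 a b : c <= a -> a <= b -> b <= d ->
      J (fun t => fc t * (a < t < b)%R%:R) = 0.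
    move=> ca ab bd.
    have H n : J (fun t => fc t * bump a b n.+1%:R t) = 0.
      rewrite -(Hf _ (@bump_test a b n _ ab _)); [|lra|lra].
      apply: eq_Rint => t It; rewrite /fc patchE; case: ifPn => // tcd.
      rewrite bump_out ?mulr0//; apply: contra tcd => /andP[h1 h2].
      by rewrite mem_setE in_itv /=; apply/andP; split; lra.
    have mb n : measurable_fun I (bump a b n.+1%:R).
      apply: within_measurable; apply: continuous_within; apply: smooth_within.
      exact: bump_smooth.
    have mi := measurable_itvb a b.
    suff L : (fun=> 0 : R) @ \oo --> J (fun t => fc t * (a < t < b)%R%:R).
      by apply/esym; exact: (cvg_unique _ (cvg_cst (0 : R)) L).
    rewrite (_ : (fun=> 0) = fun n => J (fun t => fc t * bump a b n.+1%:R t)); last first.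
      by apply/funext => n; rewrite H.
    apply: (@Rint_dominated _ _ (fun t => `|fc t|)).
    - by move=> n; apply: measurable_funM => //; exact: intg_measurable.
    - by apply: measurable_funM => //; exact: intg_measurable.
    - by apply/intgP; apply: integrable_norm; exact/intgP.
    - move=> n x Ix; rewrite normrM ler_piMr// ger0_norm ?bump_ge0//.
      exact: bump_le1.
    - by move=> x Ix; apply: cvgM; [exact: cvg_cst|exact: bump_cvg].
  apply: prim_eq0 => // x Ix.
  have E : prim fc x = J (fun t => fc t * step x t) by [].
  (* Up to [x], the restriction to [[c, d]] is integrated from [c] to [min x d]; if that bound is
     below [c], the integrand vanishes. *)
  rewrite E; have [bc|cb] := ltP (Num.min x d) c.
    rewrite -(@Rint0 R); apply: eq_Rint => t It; rewrite /fc patchE.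
    case: ifPn => tcd; last by rewrite mul0r.
    move: tcd; rewrite mem_setE in_itv /= => /andP[ct td].
    rewrite /step; case: (leP t x) => tx; last by rewrite mulr0.
    move: bc; rewrite ltNge => /negP[].
    by rewrite le_min; apply/andP; split; lra.
  have bd : Num.min x d <= d by rewrite ge_min lexx orbT.
  rewrite -(ab0 c _ (lexx c) cb bd); apply: Rint_ae.
  - exact: intg_measurable (intg_step x fi).
  - by apply: measurable_funM; [exact: intg_measurable|exact: measurable_itvb].
  apply: aeS (aeI (ae_neq c) (ae_neq (Num.min x d))) => t [tc tb] _; rewrite /fc patchE; case: ifPn => tcd; last by rewrite !mul0r.
  move: tcd; rewrite mem_setE in_itv /= => /andP[ct td].
  have ct' : c < t by rewrite lt_neqAle eq_sym tc ct.
  by rewrite /step ct' /= [t < _]lt_neqAle tb le_min td andbT.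
have K n : ae_eq_on I (f \_ `[-1 + n.+1%:R^-1, 1 - n.+1%:R^-1]) (fun=> 0).
  have n0 : 0 < n.+1%:R^-1 :> R by rewrite invr_gt0 ltr0n.
  by apply: key; [rewrite ltrDl|rewrite gtrDl oppr_lt0].
apply: aeS (ae_foralln K) => x H Ix; move/IopenE : (Ix) => /andP[x1 x2].
(* The distances to the two endpoints ask for two indices; their sum serves both. *)
have [k1 h1] := ltr_add_invr x1; have [k2 h2] := ltr_add_invr x2.
have := H (k1 + k2)%N Ix; rewrite patchE mem_set// /= in_itv /=.
have i1 : (k1 + k2).+1%:R^-1 <= k1.+1%:R^-1 :> R.
  by rewrite lef_pV2 ?posrE ?ltr0n// ler_nat ltnS leq_addr.
have i2 : (k1 + k2).+1%:R^-1 <= k2.+1%:R^-1 :> R.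
  by rewrite lef_pV2 ?posrE ?ltr0n// ler_nat ltnS leq_addl.
move: i1 i2 h1 h2; move: (_^-1) (_^-1) (_^-1) => a b c i1 i2 h1 h2.
by apply/andP; split; lra.
Qed.

Lemma AC_weak F f : AC F f -> is_weak_derivative I F f.
Proof.
move=> Ff; have [fi _] := Ff; have Fi := intg_within (AC_within Ff).
split.
- by apply: open_integrable_locally; [exact: open_Iopen|exact/intgP].
- by apply: open_integrable_locally; [exact: open_Iopen|exact/intgP].
move=> phi tphi; have Aphi := test_AC tphi.
have := AC_ibp Ff Aphi.
have n1 : ~ I 1 by move=> /IopenE; lra.
have n2 : ~ I (-1) by move=> /IopenE; lra.
rewrite (test_out tphi n1) (test_out tphi n2) !mulr0 subrr RintD.
- by move=> /eqP; rewrite addrC addr_eq0 => /eqP.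
- apply: (eq_intg _ (intgMc (AC_within Aphi) fi)) => t _.
  by rewrite mulrC.
- by apply: intgMc; [exact: (AC_within Ff)|case: Aphi].
Qed.

Lemma loc_intg_test f phi : locally_integrable I f -> test_function I phi ->
  intg (fun x => f x * phi x).
Proof.
move=> lf tphi; have [e /andP[e0 e1] fe] := test_support tphi.
have l1 : -1 < -1 + e by lra.
have l2 : 1 - e < 1 by lra.
apply: (eq_intg _ (intgMc (AC_within (test_AC tphi)) (loc_intg lf l1 l2))) => x Ix.
rewrite patchE mulrC; case: ifPn => // h; rewrite fe ?mulr0 ?mul0r//.
by apply: contra h => h; rewrite mem_setE in_itv.
Qed.

Lemma weak_unique F f g : is_weak_derivative I F f -> is_weak_derivative I F g ->
  ae_eq_on I f g.
Proof.
move=> [lF lf Hf] [_ lg Hg].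
have := @fundamental_lemma (fun x => f x - g x) (locally_integrableB lf lg).
move=> /(_ _)/(aeS _); apply => [x /[apply] /eqP|phi tphi].
  by rewrite subr_eq0 => /eqP.
rewrite (@eq_Rint _ _ (fun x => f x * phi x - g x * phi x)); last first.
  by move=> x _; rewrite mulrBl.
rewrite RintB; try exact: loc_intg_test.
apply/eqP; rewrite subr_eq0 -eqr_opp; apply/eqP.
by rewrite -(Hf _ tphi) -(Hg _ tphi).
Qed.

Lemma weak_derive_spec f : weakly_differentiable I f ->
  is_weak_derivative I f (weak_derive I f).
Proof. by move=> [g fg]; exact: (@getPex _ [set g | is_weak_derivative I f g] (ex_intro _ g fg)). Qed.

Lemma weak_derive_AC F f : AC F f -> ae_eq_on I (weak_derive I F) f.
Proof.
move=> Ff; apply: (@weak_unique F); last exact: AC_weak.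
by apply: weak_derive_spec; exists f; exact: AC_weak.
Qed.

Lemma weak_ae F G f : locally_integrable I G -> ae_eq_on I F G ->
  is_weak_derivative I F f -> is_weak_derivative I G f.
Proof.
move=> lG FG [lF lf Hf]; split => // phi tphi; rewrite -Hf//.
apply: Rint_ae.
- exact: intg_measurable (loc_intg_test lG (test_derive1 tphi)).
- exact: intg_measurable (loc_intg_test lF (test_derive1 tphi)).
- by apply: aeS FG => x H /H ->.
Qed.

Lemma test_lin k f g : test_function I f -> test_function I g ->
  test_function I (fun x => f x - k * g x).
Proof.
move=> tf tg; have [e /andP[e0 e1] fe] := test_support tf.
have [e' /andP[e0' e1'] fe'] := test_support tg.
have [s1 _ _] := tf; have [s2 _ _] := tg.
have m0 : 0 < Num.min e e' by rewrite lt_min e0 e0'.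
have m1 : Num.min e e' <= e by rewrite ge_min lexx.
have m2 : Num.min e e' <= e' by rewrite ge_min lexx orbT.
apply: (@test_intro (-1 + Num.min e e') (1 - Num.min e e')); [|lra|lra|].
  apply: (@smooth_closure _ [set h | exists n, h = fun x => derive1n n f x - k * derive1n n g x]).
  - exact: openT.
  - move=> _ [n ->]; exists (fun x => derive1n n.+1 f x - k * derive1n n.+1 g x).
      by exists n.+1.
    move=> x _; rewrite !derive1nS.
    have d1 : is_derive x (1 : R) (derive1n n f) (derive1 (derive1n n f) x).
      by apply: DeriveDef; [exact: s1|rewrite derive1E].
    have d2 : is_derive x (1 : R) (derive1n n g) (derive1 (derive1n n g) x).
      by apply: DeriveDef; [exact: s2|rewrite derive1E].
    by apply: (is_derive_eq (dvB d1 (dvM (dvc k x) d2))); rewrite mul0r add0r.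
  - by exists 0.
move=> x Hx; rewrite fe ?fe' ?mulr0 ?subrr//.
  by apply: contra Hx => /andP[h h']; apply/andP; split; lra.
by apply: contra Hx => /andP[h h']; apply/andP; split; lra.
Qed.

Lemma step01 x t : 0 <= step x t <= 1.
Proof. by rewrite /step; case: (t <= x); rewrite /= ?mulr1n ?mulr0n ?lexx ?ler01. Qed.

(** Subtracting from a test function the multiple of a fixed bump [rho] that has the same mean
    leaves the derivative of a test function, by [test_prim]. Hence [f - c] is orthogonal to all
    test functions, where [c] is the average of [f] weighted by [rho]. *)
Lemma dubois_reymond f : intg f ->
  (forall phi, test_function I phi -> J (fun x => f x * derive1 phi x) = 0) ->
  exists c, ae_eq_on I f (fun=> c).
Proof.
move=> fi Hf.
have h2 : -1 < - (1 / 2) :> R by lra.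
have h3 : 1 / 2 < 1 :> R by lra.
have h4 : - (1 / 2) <= 1 / 2 :> R by lra.
pose rho := bump (- (1 / 2)) (1 / 2) (1 : R).
have trho : test_function I rho by exact: (bump_test 0 h2 h4 h3).
have rhoi : intg rho by exact: intg_within (AC_within (test_AC trho)).
(* Were the mean of the nonnegative [rho] zero, its primitive would vanish identically, against its
   derivative [rho 0 > 0] at 0. *)
have Jrho : J rho != 0.
  apply/eqP => J0.
  have p0 x : I x -> prim rho x = 0.
    move=> Ix; apply/eqP; rewrite eq_le; apply/andP; split; last first.
      apply: Rintegral_ge0 => t _; have /andP[s0 s1] := step01 x t.
      by rewrite mulr_ge0 ?bump_ge0.
    rewrite -J0; apply: le_Rintegral => //.
    - exact/intgP/intg_step.
    - by move=> t _; have /andP[s0 s1] := step01 x t; rewrite ler_piMr ?bump_ge0.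
  have I0 : I 0 by apply/IopenE; lra.
  have cr : {for (0 : R), continuous rho} by apply: smooth_within; exact: bump_smooth.
  have d1 := prim_cont_derive rhoi I0 cr.
  have d2 : is_derive (0 : R) (1 : R) (prim rho) 0.
    apply: (dv_near _ (dvc 0 0)).
    by apply: filterS (nbhs_Iopen I0) => t /p0 ->.
  have : rho 0 = 0 by rewrite -(dv_derive1 d1) (dv_derive1 d2).
  rewrite /rho bump_in//; first by move/eqP; rewrite gt_eqF ?expR_gt0.
  by apply/andP; split; lra.
exists (J (fun x => f x * rho x) / J rho); set c := _ / _.
have lf : locally_integrable I f.
  by apply: open_integrable_locally; [exact: open_Iopen|exact/intgP].
have lfc : locally_integrable I (fun x => f x - c).
  apply: open_integrable_locally; [exact: open_Iopen|apply/intgP].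
  by apply: intgB => //; exact: intg_cst.
have := @fundamental_lemma _ lfc.
move=> /(_ _)/(aeS _); apply => [x /[apply] /eqP|phi tphi].
  by rewrite subr_eq0 => /eqP.
have phii : intg phi by exact: intg_within (AC_within (test_AC tphi)).
pose k := J phi / J rho.
have rhoi' : intg (fun x => f x * rho x) by exact: loc_intg_test.
have phii' : intg (fun x => f x * phi x) by exact: loc_intg_test.
have Jpsi : J (fun x => phi x - k * rho x) = 0.
  by rewrite RintB ?RintZ//; [rewrite /k divfK ?subrr|exact: intgZ].
have [F tF dF] := test_prim (test_lin k tphi trho) Jpsi.
have := Hf F tF.
rewrite (@eq_Rint _ _ (fun x => f x * phi x - k * (f x * rho x))); last first.
  by move=> x _; rewrite dF mulrBr [f x * (k * _)]mulrCA.
rewrite RintB ?RintZ//; last exact: intgZ.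
move=> /eqP; rewrite subr_eq0 => /eqP E.
rewrite (@eq_Rint _ _ (fun x => f x * phi x - c * phi x)); last first.
  by move=> x _; rewrite mulrBl.
by rewrite RintB ?RintZ ?E//; [rewrite /k /c mulrC mulrCA mulrC subrr|exact: intgZ].
Qed.

(** The primitive of the difference vanishes, and at interior points its derivative is the
    continuous difference itself; the endpoints follow by one-sided limits. *)
Lemma ae_eq_within f g : {within @Iclosed R, continuous f} ->
  {within @Iclosed R, continuous g} -> ae_eq_on I f g ->
  forall x, Iclosed x -> f x = g x.
Proof.
move=> cf cg fg.
pose h x := f x - g x.
have ch : {within @Iclosed R, continuous h}.
  by move=> x; apply: cvgB; [exact: cf|exact: cg].
have hi := intg_within ch.
have p0 x : I x -> prim h x = 0.
  move=> Ix; rewrite (@prim_ae _ _ (fun=> 0) x hi (intg_cst 0)); last first.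
    by apply: aeS fg => t /[apply]; rewrite /h => ->; rewrite subrr.
  by have [_ /(_ x (Iopen_closed Ix))] := AC_cst (0 : R); rewrite add0r => <-.
have hI x : I x -> h x = 0.
  move=> Ix; have d1 := prim_cont_derive hi Ix (within_interior ch Ix).
  have d2 : is_derive x (1 : R) (prim h) 0.
    apply: (dv_near _ (dvc 0 x)).
    by apply: filterS (nbhs_Iopen Ix) => t /p0 ->.
  by rewrite -(dv_derive1 d1) (dv_derive1 d2).
have N11 : -1 < 1 :> R by lra.
have [_ hl hr] := (continuous_within_itvP h N11).1 ch.
suff H x : Iclosed x -> h x = 0.
  by move=> x /H /eqP; rewrite subr_eq0 => /eqP.
move=> /IclosedE/andP[]; rewrite le_eqVlt => /predU1P[<- _|x1].
  suff L : h x @[x --> (-1)^'+] --> (0 : R) by exact: (cvg_unique _ hl L).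
  apply: cvg_near_cst; near=> t; apply: hI; apply/IopenE; apply/andP; split.
    by near: t; exact: nbhs_right_gt.
  by near: t; exact: nbhs_right_lt.
rewrite le_eqVlt => /predU1P[->|x2]; last by apply: hI; apply/IopenE; rewrite x1 x2.
suff L : h x @[x --> 1^'-] --> (0 : R) by exact: (cvg_unique _ hr L).
apply: cvg_near_cst; near=> t; apply: hI; apply/IopenE; apply/andP; split.
  by near: t; exact: nbhs_left_gt.
by near: t; exact: nbhs_left_lt.
Unshelve. all: by end_near. Qed.

(** [F - prim f] has weak derivative zero, so it is constant almost everywhere by [dubois_reymond],
    and everywhere by continuity. *)
Lemma weak_AC F f : {within @Iclosed R, continuous F} -> intg f ->
  is_weak_derivative I F f -> AC F f.
Proof.
move=> cF fi [_ _ wF]; have Fi := intg_within cF.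
have pc := prim_continuous fi.
have [c Hc] : exists c, ae_eq_on I (fun x => F x - prim f x) (fun=> c).
  apply: dubois_reymond; first by apply: intgB => //; exact: intg_within.
  move=> phi tphi; have Aphi := test_AC tphi.
  have [_ _ wp] := AC_weak (AC_prim fi).
  have di : intg (derive1 phi) by case: Aphi.
  rewrite (@eq_Rint _ _ (fun x => F x * derive1 phi x - prim f x * derive1 phi x)).
    by rewrite RintB ?(wF _ tphi) ?(wp _ tphi) ?subrr//; exact: intgMc.
  by move=> x _; rewrite mulrBl.
split => // x Ix.
have H : forall x, Iclosed x -> F x - prim f x = c.
  apply: ae_eq_within => //.
  - by move=> t; apply: cvgB; [exact: cF|exact: pc].
  - by apply: continuous_within; exact: cst_continuous.
have := H x Ix; rewrite -(H _ (@Iclosed_N1 R)) [prim f (-1)]prim_leN1// subr0.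
by move/eqP; rewrite subr_eq => /eqP.
Qed.

End Weak.

(** * The functional in terms of v, v' and v'' *)

Section Functional.
Context {R : realType}.
Local Notation mu := (@lebesgue_measure R).
Local Notation I := (@Iopen R).
Local Notation J f := (\int[mu]_(x in I) f x).
Implicit Types (f g h v u p q : R -> R) (x y : R).
Opaque intg prim.
#[local] Hint Resolve measurable_Iopen : core.

Lemma L2_sq f : L2 I f -> measurable_fun I f /\ intg (fun x => f x ^+ 2).
Proof.
move=> Lf; have sqi := Lfun2_integrable_sqr Lf; split.
  move: Lf; rewrite /L2 inE => /andP[]; rewrite inE /= => mf _.
  exact: (measurable_restrictT _ measurable_Iopen).2 mf.
apply: intg_unpatch; apply: eq_integrable sqi => // x _ /=.
by rewrite !patchE; case: ifP => // _; rewrite expr0n.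
Qed.

Lemma sq_L2 f : measurable_fun I f -> intg (fun x => f x ^+ 2) -> L2 I f.
Proof.
move=> mf sqi; rewrite /L2 inE; apply/andP; split.
  by rewrite inE /=; exact: (measurable_restrictT _ measurable_Iopen).1 mf.
rewrite inE /= /finite_norm unlock.
apply: poweR_lty.
have /integrableP[_] := intg_patch sqi; apply: le_lt_trans.
rewrite le_eqVlt; apply/orP; left; apply/eqP; apply: eq_integral => x _ /=.
rewrite !patchE; case: ifP => _; rewrite ?normr0 ?powR0//.
by rewrite powR_mulrn// normrX.
Qed.

Lemma sq_intg f : measurable_fun I f -> intg (fun x => f x ^+ 2) -> intg f.
Proof.
move=> mf sqi; apply: (@le_intg _ _ (fun x => 1 + f x ^+ 2)) => //.
  move=> x _; rewrite -(real_normK (num_real (f x))).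
  by move: (`|f x|) (normr_ge0 (f x)) => y y0; nra.
by apply: intgD => //; exact: intg_cst.
Qed.

Lemma sq_bounded f M : measurable_fun I f -> (forall x, I x -> `|f x| <= M) ->
  intg (fun x => f x ^+ 2).
Proof.
move=> mf fM; apply: (@intg_bounded _ _ (M ^+ 2)).
  exact: measurable_funX.
move=> x Ix; rewrite normrX lerXn2r ?nnegrE//; last exact: fM.
exact: le_trans (fM x Ix).
Qed.

Lemma sqD f g : measurable_fun I f -> measurable_fun I g ->
  intg (fun x => f x ^+ 2) -> intg (fun x => g x ^+ 2) ->
  intg (fun x => (f x + g x) ^+ 2).
Proof.
move=> mf mg sf sg; apply: (@le_intg _ _ (fun x => 2 * f x ^+ 2 + 2 * g x ^+ 2)).
- by apply: measurable_funX; exact: measurable_funD.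
- move=> x _; rewrite ger0_norm ?sqr_ge0//.
  by have := sqr_ge0 (f x - g x); rewrite !expr2; lra.
- by apply: intgD; exact: intgZ.
Qed.

(** Explicit representatives of [v'] and [v''], in place of the chosen [weak_derive]. The first is
    continuous, being absolutely continuous; of the second only the class is controlled. *)
Record adm (v p q : R -> R) : Prop := Adm {
  adm1 : AC v p; adm2 : AC p q; adm3 : intg (fun x => q x ^+ 2) }.

Lemma adm_weak v p q : adm v p q ->
  ae_eq_on I (weak_derive I v) p /\ ae_eq_on I (weak_derive I (weak_derive I v)) q.
Proof.
move=> [vp pq _]; have E1 := weak_derive_AC vp; split => //.
have [_ lD _] : is_weak_derivative I v (weak_derive I v).
  by apply: weak_derive_spec; exists p; exact: AC_weak.
have E1' : ae_eq_on I p (weak_derive I v) by apply: aeS E1 => x H /H.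
have W := weak_ae lD E1' (AC_weak pq).
by apply: (weak_unique _ W); apply: weak_derive_spec; exists q.
Qed.

Lemma adm_wmeas v p q : adm v p q ->
  measurable_fun I (weak_derive I v) /\
  measurable_fun I (weak_derive I (weak_derive I v)).
Proof.
move=> [vp pq _]; have E1 := weak_derive_AC vp.
have [_ lD _] : is_weak_derivative I v (weak_derive I v).
  by apply: weak_derive_spec; exists p; exact: AC_weak.
split; first by case: lD.
have E1' : ae_eq_on I p (weak_derive I v) by apply: aeS E1 => x H /H.
have W := weak_ae lD E1' (AC_weak pq).
have [_ [] //] : is_weak_derivative I (weak_derive I v) (weak_derive I (weak_derive I v)).
by apply: weak_derive_spec; exists q.
Qed.

Lemma adm_H2 v p q : adm v p q -> H2 v.
Proof.
move=> vpq; have [E1 E2] := adm_weak vpq; have [m1 m2] := adm_wmeas vpq.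
have [vp pq sq] := vpq.
have cv := AC_within vp; have cp := AC_within pq.
have [_ lD _] : is_weak_derivative I v (weak_derive I v).
  by apply: weak_derive_spec; exists p; exact: AC_weak.
have E1' : ae_eq_on I p (weak_derive I v) by apply: aeS E1 => x H /H.
have sae f g : measurable_fun I f -> measurable_fun I g -> ae_eq_on I f g ->
    intg (fun x => g x ^+ 2) -> intg (fun x => f x ^+ 2).
  move=> mf mg fg; apply: intg_ae; [exact: measurable_funX|exact: measurable_funX|].
  by apply: aeS fg => x H /H ->.
have csq f : {within @Iclosed R, continuous f} -> intg (fun x => f x ^+ 2).
  move=> cf; have [M _ HM] := within_bounded cf.
  apply: (@sq_bounded _ M); first exact: within_measurable.
  by move=> x /Iopen_closed; exact: HM.
split => //.
- by exists p; exact: AC_weak.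
- by exists q; exact: weak_ae lD E1' (AC_weak pq).
split.
- by apply: sq_L2; [exact: within_measurable|exact: csq].
- apply: sq_L2 => //; apply: (sae _ p) => //; [exact: within_measurable|exact: csq].
- apply: sq_L2 => //; apply: (sae _ q) => //.
  by case: pq => /intg_measurable.
Qed.

(** [p] is the continuous representative supplied by admissibility, the only one whose boundary
    values mean anything; [q] can remain the chosen weak derivative. *)
Lemma Nadm_adm alpha v : Nadm alpha v ->
  exists p q, [/\ adm v p q, p 1 = 0 & p (-1) = 0].
Proof.
move=> [[cv wv wDv [_ L1 L2]] _ _ [p [cp Dp] [p1 p2]] _].
have [m1 s1] := L2_sq L1; have [m2 s2] := L2_sq L2.
have A1 : AC v p.
  apply: (AC_ae _ (within_measurable cp) Dp).
  by apply: weak_AC => //; [exact: sq_intg|exact: weak_derive_spec].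
have lp : locally_integrable I p.
  apply: open_integrable_locally; [exact: open_Iopen|].
  exact/intgP/intg_within.
have A2 : AC p (weak_derive I (weak_derive I v)).
  apply: weak_AC => //; first exact: sq_intg.
  by apply: weak_ae lp Dp _; exact: weak_derive_spec.
by exists p, (weak_derive I (weak_derive I v)).
Qed.

Lemma adm_Nadm alpha v p q : adm v p q -> (forall x, I x -> 0 < v x) ->
  v 1 = alpha -> v (-1) = alpha -> p 1 = 0 -> p (-1) = 0 ->
  (forall x, Iclosed x -> v x = v (- x)) -> Nadm alpha v.
Proof.
move=> vpq v0 v1 v2 p1 p2 ve; split => //; first exact: adm_H2 vpq.
exists p => //; split; first by case: vpq => _ /AC_within.
by have [] := adm_weak vpq.
Qed.

Definition sg (z : R) : R := Num.sqrt (1 + z ^+ 2).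

Lemma sg_gt0 z : 0 < sg z.
Proof. by rewrite sqrtr_gt0 ltr_wpDr// sqr_ge0. Qed.

Lemma sg_ge1 z : 1 <= sg z.
Proof. by rewrite -[leLHS]sqrtr1 ler_sqrt ?lerDl ?sqr_ge0// addr_ge0 ?sqr_ge0. Qed.

Lemma dv_sg z : is_derive z (1 : R) sg (z / sg z).
Proof.
have h : 0 < 1 + z ^+ 2 by rewrite ltr_wpDr// sqr_ge0.
have dw := dvD (dvc 1 z) (dvX 2 (dvid z)).
apply: (is_derive_eq (@dvcomp R _ (fun t => 1 + t ^+ 2) z _ _ (is_derive1_sqrt h) dw)).
rewrite add0r mulr1 /= expr1 invfM -/(sg z) mulrAC mulrC mulrA.
by rewrite -mulrA mulKf ?pnatr_eq0// mulrC.
Qed.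

(* The integrand of [Wh], after expanding the square of the curvature. *)
Definition Lg (v0 z q0 : R) : R :=
  v0 * q0 ^+ 2 * (sg z)^-1 ^+ 5 + 2 * q0 * (sg z)^-1 ^+ 3 + (sg z)^-1 * v0^-1.

Lemma LgE v x : 0 < v x ->
  hyp_curvature v x ^+ 2 * (Num.sqrt (1 + weak_derive I v x ^+ 2) / v x) =
  Lg (v x) (weak_derive I v x) (weak_derive I (weak_derive I v) x).
Proof.
move=> v0; rewrite /hyp_curvature /Lg.
move: (weak_derive I v x) (weak_derive I (weak_derive I v) x) => a b.
have -> : (1 + a ^+ 2) `^ (3 / 2) = sg a ^+ 3.
  rewrite mulrC powRrM -[_ `^ 2^-1]/(_ `^ 2^-1) powR12_sqrt ?addr_ge0 ?sqr_ge0//.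
  by rewrite powR_mulrn ?sqrtr_ge0.
rewrite -/(sg a).
have s0 := sg_gt0 a; move: (sg a) s0 => s s0; move: (v x) v0 => w w0.
have ? := lt0r_neq0 s0; have ? := lt0r_neq0 w0.
by field; apply/andP.
Qed.

Lemma sg_continuous : continuous sg.
Proof. by move=> z; exact: dv_cont (dv_sg z). Qed.

Lemma isg_continuous : continuous (fun z => (sg z)^-1).
Proof.
by move=> z; apply: cvgV; [exact: lt0r_neq0 (sg_gt0 z)|exact: sg_continuous].
Qed.

Lemma within_comp f g : {within @Iclosed R, continuous f} -> continuous g ->
  {within @Iclosed R, continuous (fun x => g (f x))}.
Proof. by move=> cf cg x; apply: continuous_comp; [exact: cf|exact: cg]. Qed.

Lemma withinM f g : {within @Iclosed R, continuous f} ->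
  {within @Iclosed R, continuous g} ->
  {within @Iclosed R, continuous (fun x => f x * g x)}.
Proof. by move=> cf cg x; apply: cvgM; [exact: cf|exact: cg]. Qed.

Lemma withinD f g : {within @Iclosed R, continuous f} ->
  {within @Iclosed R, continuous g} ->
  {within @Iclosed R, continuous (fun x => f x + g x)}.
Proof. by move=> cf cg x; apply: cvgD; [exact: cf|exact: cg]. Qed.

Lemma withinN f : {within @Iclosed R, continuous f} ->
  {within @Iclosed R, continuous (fun x => - f x)}.
Proof. by move=> cf x; apply: cvgN; exact: cf. Qed.

Lemma within_cst (c : R) : {within @Iclosed R, continuous (fun=> c)}.
Proof. by apply: continuous_within; exact: cst_continuous. Qed.

Lemma withinX n f : {within @Iclosed R, continuous f} ->
  {within @Iclosed R, continuous (fun x => f x ^+ n)}.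
Proof.
move=> cf; elim: n => [|n IH]; first exact: within_cst.
rewrite (_ : (fun x => _) = fun x => f x * f x ^+ n); first exact: withinM.
by apply/funext => x; rewrite exprS.
Qed.

(* Inversion is not continuous at 0, so positivity is used through a cut-off from below. *)
Lemma within_lb f : {within @Iclosed R, continuous f} ->
  (forall x, Iclosed x -> 0 < f x) -> exists2 m : R, 0 < m & forall x, Iclosed x -> m <= f x.
Proof.
move=> cf f0; have N11 : -1 <= 1 :> R by lra.
have [c cI Hc] := EVT_min N11 cf.
have Ic : Iclosed c by apply/IclosedE; move: cI; rewrite in_itv.
by exists (f c); [exact: f0|move=> x /IclosedE Ix; apply: Hc; rewrite in_itv].
Qed.

Lemma withinV f : {within @Iclosed R, continuous f} ->
  (forall x, Iclosed x -> 0 < f x) -> {within @Iclosed R, continuous (fun x => (f x)^-1)}.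
Proof.
move=> cf f0; have [m m0 mf] := within_lb cf f0.
pose g (y : R) := (Num.max m y)^-1.
apply: (@within_eq R (fun x => g (f x))).
  by move=> x Ix; rewrite /g max_r// mf.
apply: within_comp => // y; apply: cvgV.
  by rewrite gt_eqF// lt_max m0.
apply: continuous_max; [exact: cvg_cst|exact: cvg_id].
Qed.

Lemma measurable_Lg v a b : {within @Iclosed R, continuous v} ->
  (forall x, Iclosed x -> 0 < v x) -> measurable_fun I a -> measurable_fun I b ->
  measurable_fun I (fun x => Lg (v x) (a x) (b x)).
Proof.
move=> cv v0 ma mb; have mv := within_measurable cv.
have mr := within_measurable (withinV cv v0).
have ms : measurable_fun I (fun x => (sg (a x))^-1).
  by apply: (measurableT_comp (continuous_measurable_fun isg_continuous) ma).
rewrite /Lg; apply: measurable_funD; first apply: measurable_funD.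
- by do 2 (apply: measurable_funM; last exact: measurable_funX) => //.
- apply: measurable_funM; last exact: measurable_funX.
  by apply: measurable_funM => //.
- exact: measurable_funM.
Qed.

Lemma intg_Lg v p q : adm v p q -> (forall x, Iclosed x -> 0 < v x) ->
  intg (fun x => Lg (v x) (p x) (q x)).
Proof.
move=> [vp pq sq] v0; have cv := AC_within vp; have cp := AC_within pq.
have cs n := @withinX n _ (within_comp cp isg_continuous).
have qi : intg q by case: pq.
rewrite /Lg; apply: intgD; first apply: intgD.
- apply: (eq_intg _ (intgMc (withinM cv (cs 5%N)) sq)) => x _.
  by rewrite mulrAC.
- have c2 : {within @Iclosed R, continuous (fun x => 2 * (sg (p x))^-1 ^+ 3)}.
    by apply: withinM; [exact: within_cst|exact: cs].
  by apply: (eq_intg _ (intgMc c2 qi)) => x _; rewrite mulrAC.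
- apply: intg_within; apply: withinM; last exact: withinV.
  exact: (within_comp cp isg_continuous).
Qed.

(** The integrand of [Wh] agrees with [Lg (v x) (p x) (q x)] only almost everywhere. Integrability
    makes the value finite, so minimality becomes an inequality between real integrals. *)
Lemma Wh_adm v p q : adm v p q -> (forall x, Iclosed x -> 0 < v x) ->
  Wh v = (J (fun x => Lg (v x) (p x) (q x)))%:E.
Proof.
move=> vpq v0; have [E1 E2] := adm_weak vpq; have [m1 m2] := adm_wmeas vpq.
have cv := AC_within (adm1 vpq).
have mp := within_measurable (AC_within (adm2 vpq)).
have mq : measurable_fun I q by case: vpq => _ [/intg_measurable].
rewrite /Rintegral fineK; last first.
  by apply: integrable_fin_num => //; exact/intgP/intg_Lg.
transitivity (\int[mu]_(x in I)
    (Lg (v x) (weak_derive I v x) (weak_derive I (weak_derive I v) x))%:E)%E.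
  apply: eq_integral => x /set_mem Ix; congr EFin; apply: LgE.
  by apply: v0; exact: Iopen_closed.
apply: ae_eq_integral => //.
- by apply/measurable_EFinP; exact: measurable_Lg.
- by apply/measurable_EFinP; exact: measurable_Lg.
- by apply: aeS (aeI E1 E2) => x [H1 H2] Ix; rewrite H1// H2.
Qed.

End Functional.

(** * First variation *)

Section Variation.
Context {R : realType}.
Local Notation mu := (@lebesgue_measure R).
Local Notation I := (@Iopen R).
Local Notation J f := (\int[mu]_(x in I) f x).
Implicit Types (f g h v u p q : R -> R) (x y : R).
Opaque intg prim.
#[local] Hint Resolve measurable_Iopen : core.

(* [F t = F0 + t * F1 + O(t^2)], uniformly relative to the weight [w]. The class is
   closed under the operations that build [Lg], so that [Wh] is differentiated
   without any estimate on second derivatives. *)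
Definition taylor (t0 : R) (w : R -> R) (F : R -> R -> R) (F0 F1 : R -> R) :=
  exists2 K : R, 0 <= K & forall x (t : R), I x -> 0 <= t <= t0 ->
    [/\ `|F0 x| <= K * w x, `|F1 x| <= K * w x &
        `|F t x - F0 x - t * F1 x| <= K * t ^+ 2 * w x].

Lemma taylor_affine t0 (w a b : R -> R) (K : R) : 0 <= K -> (forall x, I x -> 0 <= w x) ->
  (forall x, I x -> `|a x| <= K * w x) -> (forall x, I x -> `|b x| <= K * w x) ->
  taylor t0 w (fun t x => a x + t * b x) a b.
Proof.
move=> K0 w0 aK bK; exists K => // x t Ix _; split; [exact: aK|exact: bK|].
rewrite [a x + _]addrC addrK subrr normr0.
by apply: mulr_ge0; [apply: mulr_ge0 => //; exact: sqr_ge0|exact: w0].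
Qed.

Lemma taylorW t0 (w w' : R -> R) F F0 F1 : (forall x, I x -> w x <= w' x) ->
  taylor t0 w F F0 F1 -> taylor t0 w' F F0 F1.
Proof.
move=> ww [K K0 HK]; exists K => // x t Ix Ht; have [h1 h2 h3] := HK x t Ix Ht.
have wx := ww x Ix.
split; [apply: le_trans h1 _|apply: le_trans h2 _|apply: le_trans h3 _].
- exact: ler_wpM2l.
- exact: ler_wpM2l.
- by apply: ler_wpM2l => //; rewrite mulr_ge0// sqr_ge0.
Qed.

Lemma taylorD t0 (w : R -> R) F F0 F1 G G0 G1 :
  taylor t0 w F F0 F1 -> taylor t0 w G G0 G1 ->
  taylor t0 w (fun t x => F t x + G t x) (fun x => F0 x + G0 x) (fun x => F1 x + G1 x).
Proof.
move=> [K K0 HK] [K' K0' HK']; exists (K + K'); first exact: addr_ge0.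
move=> x t Ix Ht; have [h1 h2 h3] := HK x t Ix Ht; have [h1' h2' h3'] := HK' x t Ix Ht.
split.
- by rewrite mulrDl; apply: le_trans (ler_normD _ _) _; exact: lerD.
- by rewrite mulrDl; apply: le_trans (ler_normD _ _) _; exact: lerD.
- rewrite !mulrDl (_ : _ - _ = (F t x - F0 x - t * F1 x) + (G t x - G0 x - t * G1 x)).
    by apply: le_trans (ler_normD _ _) _; exact: lerD.
  by ring.
Qed.

(** Since [t <= 1] gives [t ^+ 2 <= t], the increment is at most [2 * K * t * w x] and the value at
    most [3 * K * w x]; the single constant [3 * K] serves all five bounds. *)
Lemma taylor_bound t0 (w : R -> R) F F0 F1 : t0 <= 1 -> taylor t0 w F F0 F1 ->
  exists2 K : R, 0 <= K & forall x (t : R), I x -> 0 <= t <= t0 ->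
    [/\ `|F0 x| <= K * w x, `|F1 x| <= K * w x, `|F t x| <= K * w x,
        `|F t x - F0 x| <= K * t * w x &
        `|F t x - F0 x - t * F1 x| <= K * t ^+ 2 * w x].
Proof.
move=> t01 [K K0 HK]; exists (3 * K); first exact: mulr_ge0.
move=> x t Ix Ht; have [h1 h2 h3] := HK x t Ix Ht.
have w0 : 0 <= K * w x by apply: le_trans h1.
have t1 : 0 <= t <= 1 by lra.
have tt : 0 <= t * (1 - t) by apply: mulr_ge0; lra.
have zz : 0 <= (K * w x) * (t * (1 - t)) by exact: mulr_ge0.
have zt : 0 <= (K * w x) * t by apply: mulr_ge0 => //; lra.
have z1 : 0 <= (K * w x) * (1 - t) by apply: mulr_ge0 => //; lra.
have ztt : 0 <= (K * w x) * t ^+ 2 by apply: mulr_ge0 => //; exact: sqr_ge0.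
have h4 : `|F t x - F0 x| <= 2 * K * t * w x.
  rewrite (_ : F t x - F0 x = (F t x - F0 x - t * F1 x) + t * F1 x); last by ring.
  apply: le_trans (ler_normD _ _) _; rewrite normrM (ger0_norm (proj1 (andP t1))).
  apply: (@le_trans _ _ (K * t ^+ 2 * w x + t * (K * w x))).
    by apply: lerD => //; apply: ler_wpM2l => //; case/andP: t1.
  by lra.
split; [by lra|by lra| |by lra|by lra].
rewrite (_ : F t x = (F t x - F0 x) + F0 x); last by ring.
apply: le_trans (ler_normD _ _) _.
apply: (@le_trans _ _ (2 * K * t * w x + K * w x)); first exact: lerD.
by lra.
Qed.

(** The remainder of a product is the remainder of [F] times [G], plus [F0] times the remainder of
    [G], plus a product of two quantities of order [t]: three terms of the same size, hence the
    factor 3. The weights multiply, which is how the square of the weight of [q] arises. *)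
Lemma taylorM t0 (w w' : R -> R) F F0 F1 G G0 G1 : t0 <= 1 ->
  taylor t0 w F F0 F1 -> taylor t0 w' G G0 G1 ->
  taylor t0 (fun x => w x * w' x) (fun t x => F t x * G t x)
    (fun x => F0 x * G0 x) (fun x => F1 x * G0 x + F0 x * G1 x).
Proof.
move=> t01 /(taylor_bound t01)[K K0 HK] /(taylor_bound t01)[L L0 HL].
have le a b c d : `|a| <= c -> `|b| <= d -> `|a * b| <= c * d :> R.
  by move=> ac bd; rewrite normrM ler_pM.
exists (3 * (K * L)); first by rewrite !mulr_ge0.
move=> x t Ix Ht; have [h0 h1 h2 h3 h4] := HK x t Ix Ht.
have [k0 k1 k2 k3 k4] := HL x t Ix Ht.
have z0 : 0 <= (K * w x) * (L * w' x) by rewrite mulr_ge0// (le_trans _ h0, le_trans _ k0).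
split.
- by apply: le_trans (le _ _ _ _ h0 k0) _; nra.
- apply: le_trans (ler_normD _ _) _.
  by apply: le_trans (lerD (le _ _ _ _ h1 k0) (le _ _ _ _ h0 k1)) _; nra.
- rewrite (_ : _ - _ = (F t x - F0 x - t * F1 x) * G t x +
      (F0 x * (G t x - G0 x - t * G1 x) + (t * F1 x) * (G t x - G0 x))); last by ring.
  apply: le_trans (ler_normD _ _) _.
  apply: le_trans (lerD (le _ _ _ _ h4 k2) (ler_normD _ _)) _.
  have tn : `|t| <= t by rewrite ger0_norm//; case/andP: Ht.
  apply: le_trans (lerD (lexx _) (lerD (le _ _ _ _ h0 k4) (le _ _ _ _ (le _ _ _ _ tn h1) k3))) _.
  by rewrite le_eqVlt; apply/orP; left; apply/eqP; ring.
Qed.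

(** The three summands of the constant bound, in turn, the inverse itself, its derivative together
    with the remainder of [F] over two values, and a product of two quantities of order [t] over
    three values. *)
Lemma taylorV t0 (c : R) F F0 F1 : 0 < c -> t0 <= 1 ->
  (forall x (t : R), I x -> 0 <= t <= t0 -> c <= F t x) -> (forall x, I x -> c <= F0 x) ->
  taylor t0 (fun=> 1) F F0 F1 ->
  taylor t0 (fun=> 1) (fun t x => (F t x)^-1) (fun x => (F0 x)^-1)
    (fun x => - F1 x * (F0 x)^-1 ^+ 2).
Proof.
move=> c0 t01 cF cF0 /(taylor_bound t01)[K K0 HK].
have i0 : 0 <= c^-1 by rewrite invr_ge0 ltW.
exists (c^-1 + K * c^-1 ^+ 2 + K ^+ 2 * c^-1 ^+ 3).
  by apply: addr_ge0; [apply: addr_ge0 => //|]; apply: mulr_ge0 => //; exact: exprn_ge0.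
move=> x t Ix Ht; have [h0 h1 h2 h3 h4] := HK x t Ix Ht; rewrite !mulr1 in h0 h1 h2 h3 h4 *.
have y0 : 0 < F t x by apply: lt_le_trans (cF x t Ix Ht).
have z0 : 0 < F0 x by apply: lt_le_trans (cF0 x Ix).
have iF : `|(F t x)^-1| <= c^-1.
  by rewrite gtr0_norm ?invr_gt0// lef_pV2 ?posrE// cF.
have iF0 : `|(F0 x)^-1| <= c^-1.
  by rewrite gtr0_norm ?invr_gt0// lef_pV2 ?posrE// cF0.
have E : (F t x)^-1 - (F0 x)^-1 - t * (- F1 x * (F0 x)^-1 ^+ 2) =
    - ((F t x - F0 x - t * F1 x) * ((F t x)^-1 * (F0 x)^-1)) +
    (t * F1 x) * ((F t x - F0 x) * ((F t x)^-1 * ((F0 x)^-1 * (F0 x)^-1))).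
  have := lt0r_neq0 y0; have := lt0r_neq0 z0.
  by move: (F t x) (F0 x) (F1 x) => a b d b0 a0; field; apply/andP.
have t00 : 0 <= t by case/andP: Ht.
have m0 : 0 <= c^-1 by rewrite invr_ge0 ltW.
have le a b e d : `|a| <= e -> `|b| <= d -> `|a * b| <= e * d :> R.
  by move=> ac bd; rewrite normrM ler_pM.
have tn : `|t| <= t by rewrite ger0_norm.
have k1 := le _ _ _ _ h4 (le _ _ _ _ iF iF0).
have k2 := le _ _ _ _ (le _ _ _ _ tn h1) (le _ _ _ _ h3 (le _ _ _ _ iF (le _ _ _ _ iF0 iF0))).
have k3 : `|- F1 x * (F0 x)^-1 ^+ 2| <= K * (c^-1 * c^-1).
  by rewrite mulNr normrN expr2; exact: le h1 (le _ _ _ _ iF0 iF0).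
rewrite E; move: (c^-1) m0 iF iF0 k1 k2 k3 => m m0 iF iF0 k1 k2 k3.
have p1 : 0 <= K * m ^+ 2 by rewrite mulr_ge0 ?exprn_ge0.
have p2 : 0 <= K ^+ 2 * m ^+ 3 by rewrite mulr_ge0 ?exprn_ge0.
split.
- by apply: le_trans iF0 _; lra.
- by apply: le_trans k3 _; lra.
- apply: le_trans (ler_normD _ _) _; rewrite normrN; apply: le_trans (lerD k1 k2) _.
  rewrite (_ : _ + _ = (K * m ^+ 2 + K ^+ 2 * m ^+ 3) * t ^+ 2); last by ring.
  by apply: ler_wpM2r; [exact: sqr_ge0|lra].
Qed.

Lemma taylor_sqrt t0 F F0 F1 : t0 <= 1 ->
  (forall x (t : R), I x -> 0 <= t <= t0 -> 1 <= F t x) -> (forall x, I x -> 1 <= F0 x) ->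
  taylor t0 (fun=> 1) F F0 F1 ->
  taylor t0 (fun=> 1) (fun t x => Num.sqrt (F t x)) (fun x => Num.sqrt (F0 x))
    (fun x => F1 x / 2 * (Num.sqrt (F0 x))^-1).
Proof.
move=> t01 cF cF0 /(taylor_bound t01)[K K0 HK].
exists (1 + K + K ^+ 2); first by rewrite !addr_ge0 ?exprn_ge0.
move=> x t Ix Ht; have [h0 h1 h2 h3 h4] := HK x t Ix Ht; rewrite !mulr1 in h0 h1 h2 h3 h4 *.
have a0 := cF x t Ix Ht; have b0 := cF0 x Ix.
have s1 : 1 <= Num.sqrt (F t x) by rewrite -[leLHS]sqrtr1 ler_sqrt// (le_trans _ a0).
have s2 : 1 <= Num.sqrt (F0 x) by rewrite -[leLHS]sqrtr1 ler_sqrt// (le_trans _ b0).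
have e1 : F t x = Num.sqrt (F t x) ^+ 2 by rewrite sqr_sqrtr// (le_trans _ a0).
have e2 : F0 x = Num.sqrt (F0 x) ^+ 2 by rewrite sqr_sqrtr// (le_trans _ b0).
have t00 : 0 <= t by case/andP: Ht.
move: (Num.sqrt (F t x)) (Num.sqrt (F0 x)) s1 s2 e1 e2 => a b s1 s2 e1 e2.
have ib : 0 < b^-1 <= 1 by rewrite invr_gt0 invf_le1; lra.
have bb : b * b^-1 = 1 by rewrite divff// gt_eqF//; lra.
have P1 : 0 <= K ^+ 2 by exact: exprn_ge0.
split.
- rewrite ger0_norm; last by lra.
  by move: h0; rewrite e2 ger0_norm ?sqr_ge0//; nra.
- rewrite !normrM (ger0_norm (_ : 0 <= b^-1)); last by case/andP: ib => /ltW.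
  rewrite [`|2^-1|]ger0_norm ?invr_ge0//.
  by move: h1 (normr_ge0 (F1 x)); move: (`|F1 x|) ib => z ib; nra.
- have d1 : `|a - b| <= K * t.
    have : `|a - b| <= `|F t x - F0 x|.
      rewrite e1 e2 subr_sqr normrM ler_peMr// ger0_norm; lra.
    by move=> h; apply: le_trans h h3.
  (* From [a^2 - b^2 - (a - b)^2 = 2 b (a - b)]: the error of the root is the error of [F] minus the
     squared increment, divided by [2 b]. *)
  have E : a - b - t * (F1 x / 2 * b^-1) =
      ((F t x - F0 x - t * F1 x) - (a - b) ^+ 2) * (b^-1 / 2).
    rewrite e1 e2.
    have -> : a - b = (a - b) * (b * b^-1) by rewrite bb mulr1.
    by field; rewrite gt_eqF//; lra.
  rewrite E normrM (ger0_norm (_ : 0 <= b^-1 / 2)); last first.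
    by rewrite divr_ge0//; case/andP: ib => /ltW.
  have d2 : `|(a - b) ^+ 2| <= K ^+ 2 * t ^+ 2.
    by rewrite normrX -exprMn lerXn2r// nnegrE mulr_ge0.
  have d3 := le_trans (ler_normB _ _) (lerD h4 d2).
  have q2 : 0 <= t ^+ 2 by exact: exprn_ge0.
  apply: le_trans (ler_pM _ _ d3 (_ : b^-1 / 2 <= 1)) _ => //.
  + by rewrite divr_ge0//; case/andP: ib => /ltW.
  + by case/andP: ib; lra.
  + by rewrite mulr1 -mulrDl ler_wpM2r//; lra.
Qed.

Lemma taylor_eq t0 (w w' : R -> R) (F G : R -> R -> R) (F0 F1 G0 G1 : R -> R) :
  (forall x, I x -> w x = w' x) -> (forall t x, I x -> F t x = G t x) ->
  (forall x, I x -> F0 x = G0 x) -> (forall x, I x -> F1 x = G1 x) ->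
  taylor t0 w F F0 F1 -> taylor t0 w' G G0 G1.
Proof.
move=> ww FG e0 e1 [K K0 HK]; exists K => // x t Ix Ht.
by rewrite -ww// -FG// -e0// -e1//; exact: HK.
Qed.

Lemma taylor_cst t0 (c : R) : taylor t0 (fun=> 1) (fun _ _ => c) (fun=> c) (fun=> 0).
Proof.
apply: (@taylor_eq _ (fun=> 1) _ (fun t x => c + t * 0) _ (fun=> c) (fun=> 0)) => //.
  by move=> t x _; rewrite mulr0 addr0.
by apply: (@taylor_affine _ _ _ _ `|c|) => // x _; rewrite mulr1 ?normr0.
Qed.

Lemma taylorX t0 n F F0 F1 : t0 <= 1 -> taylor t0 (fun=> 1) F F0 F1 ->
  taylor t0 (fun=> 1) (fun t x => F t x ^+ n) (fun x => F0 x ^+ n)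
    (fun x => n%:R * F0 x ^+ n.-1 * F1 x).
Proof.
move=> t01 HF; elim: n => [|n IH].
  apply: taylor_eq (taylor_cst t0 1) => // x _; rewrite !mul0r//.
apply: taylor_eq (taylorM t01 HF IH) => [x _|t x _|x _|x _].
- by rewrite mulr1.
- by rewrite exprS.
- by rewrite exprS.
- by case: n {IH} => [|n]; rewrite -?natr1 /= ?exprS; ring.
Qed.

(* Partial derivatives of [Lg] in the slots of the second derivative, of the first
   derivative and of the value. *)
Definition Lg_q (v0 p0 q0 : R) : R :=
  2 * v0 * q0 * (sg p0)^-1 ^+ 5 + 2 * (sg p0)^-1 ^+ 3.

Definition Lg_p (v0 p0 q0 : R) : R :=
  - (5 * v0 * q0 ^+ 2 * p0 * (sg p0)^-1 ^+ 7) - 6 * q0 * p0 * (sg p0)^-1 ^+ 5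
  - p0 * (sg p0)^-1 ^+ 3 * v0^-1.

Definition Lg_v (v0 p0 q0 : R) : R :=
  q0 ^+ 2 * (sg p0)^-1 ^+ 5 - (sg p0)^-1 * v0^-1 ^+ 2.

(** [Lg] is at most quadratic in its last slot and all its other factors are bounded, so the weight
    [(1 + |q|)^2] dominates every term. It is integrable because [q] is square integrable. *)
Lemma taylor_Lg u p q f f1 f2 : adm u p q -> (forall x, Iclosed x -> 0 < u x) ->
  AC f f1 -> AC f1 f2 -> (exists M : R, forall x, I x -> `|f2 x| <= M) ->
  exists2 t0 : R, 0 < t0 <= 1 &
   (forall x (t : R), Iclosed x -> 0 <= t <= t0 -> 0 < u x + t * f x) /\
   taylor t0 (fun x => (1 + `|q x|) ^+ 2)
    (fun t x => Lg (u x + t * f x) (p x + t * f1 x) (q x + t * f2 x))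
    (fun x => Lg (u x) (p x) (q x))
    (fun x => Lg_v (u x) (p x) (q x) * f x + Lg_p (u x) (p x) (q x) * f1 x
            + Lg_q (u x) (p x) (q x) * f2 x).
Proof.
move=> [up pq _] u0 ff1 f12 [M2 HM2].
have cu := AC_within up; have cp := AC_within pq.
have cf := AC_within ff1; have cf1 := AC_within f12.
have [m m0 um] := within_lb cu u0.
have [M M0 HM] := within_bounded cf.
(* [m] bounds [u] from below and [M] bounds [f], so [u + t * f >= m / 2] for [t <= t0]; the cap at 1
   is what the product and inverse rules ask for. *)
pose t0 := Num.min 1 (m / (2 * M)).
have t00 : 0 < t0 by rewrite lt_min ltr01 divr_gt0 ?mulr_gt0.
have t01 : t0 <= 1 by rewrite ge_min lexx.
have t0m : t0 <= m / (2 * M) by rewrite ge_min lexx orbT.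
exists t0; first by rewrite t00.
have lbu x (t : R) : Iclosed x -> 0 <= t <= t0 -> m / 2 <= u x + t * f x.
  move=> Ix /andP[t1 t2]; have h1 := um x Ix; have h2 := HM x Ix.
  have : `|t * f x| <= m / 2.
    rewrite normrM (ger0_norm t1); apply: le_trans (ler_pM _ _ t2 h2) _ => //.
    apply: le_trans (ler_wpM2r (ltW M0) t0m) _.
    have -> : m / (2 * M) * M = m / 2 by field; rewrite gt_eqF.
    by [].
  by rewrite ler_norml => /andP[h3 _]; lra.
have m2 : 0 < m / 2 by rewrite divr_gt0.
split; first by move=> x t Ix /(lbu x t Ix); exact: lt_le_trans.
have [Mu _ HMu] := within_bounded cu; have [Mp _ HMp] := within_bounded cp.
have [M1 _ HM1] := within_bounded cf1.
have aff (a b : R -> R) (Ka Kb : R) : (forall x, Iclosed x -> `|a x| <= Ka) ->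
    (forall x, Iclosed x -> `|b x| <= Kb) ->
    taylor t0 (fun=> 1) (fun t x => a x + t * b x) a b.
  move=> ha hb; apply: (@taylor_affine _ _ _ _ (`|Ka| + `|Kb|)) => //.
  - move=> x /Iopen_closed /ha; rewrite mulr1 => h.
    by apply: le_trans h _; apply: le_trans (ler_norm _) _; rewrite lerDl.
  - move=> x /Iopen_closed /hb; rewrite mulr1 => h.
    by apply: le_trans h _; apply: le_trans (ler_norm _) _; rewrite lerDr.
have Tu := aff _ _ _ _ HMu HM; have Tp := aff _ _ _ _ HMp HM1.
have Tr : taylor t0 (fun=> 1) (fun t x => (u x + t * f x)^-1) (fun x => (u x)^-1)
    (fun x => - f x * (u x)^-1 ^+ 2).
  apply: (taylorV m2 t01 _ _ Tu).
    by move=> x t /Iopen_closed; exact: lbu.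
  by move=> x /Iopen_closed Ix; have := um x Ix; lra.
have Tw : taylor t0 (fun=> 1) (fun t x => 1 + (p x + t * f1 x) ^+ 2) (fun x => 1 + p x ^+ 2)
    (fun x => 2 * p x * f1 x).
  apply: taylor_eq (taylorD (taylor_cst t0 1) (taylorX 2 t01 Tp)) => // x _.
  by rewrite /= expr1 add0r.
have Tsg := taylor_sqrt t01 _ _ Tw.
have ge1 (z : R) : 1 <= 1 + z ^+ 2 by rewrite lerDl sqr_ge0.
have {}Tsg := Tsg (fun x t _ _ => ge1 _) (fun x _ => ge1 _).
have Ts : taylor t0 (fun=> 1) (fun t x => (sg (p x + t * f1 x))^-1) (fun x => (sg (p x))^-1)
    (fun x => - (p x) * f1 x * (sg (p x))^-1 ^+ 3).
  apply: taylor_eq (taylorV ltr01 t01 (fun x t _ _ => sg_ge1 _) (fun x _ => sg_ge1 _) Tsg) => // x _.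
  by rewrite -[Num.sqrt _]/(sg (p x)); move: (sg (p x))^-1 => z; field.
pose Q x := 1 + `|q x|.
have Tq : taylor t0 Q (fun t x => q x + t * f2 x) q f2.
  apply: (@taylor_affine _ _ _ _ (1 + `|M2|)).
  - by rewrite addr_ge0.
  - by move=> x _; rewrite /Q addr_ge0.
  - move=> x _; rewrite /Q; have := normr_ge0 (q x); have := normr_ge0 M2.
    by move: (`|q x|) (`|M2|) => a b ? ?; nra.
  - move=> x Ix; rewrite /Q; have := HM2 x Ix; have := ler_norm M2.
    have := normr_ge0 (q x); have := normr_ge0 M2.
    by move: (`|q x|) (`|M2|) => a b ? ? ? ?; nra.
have Tq2 := taylorM t01 Tq Tq.
have T1 := taylorM t01 (taylorM t01 Tu Tq2) (taylorX 5 t01 Ts).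
have T2 := taylorM t01 (taylorM t01 (taylor_cst t0 2) Tq) (taylorX 3 t01 Ts).
have T3 := taylorM t01 Ts Tr.
have Q1 x : 1 <= Q x by rewrite /Q lerDl.
have W1 : taylor t0 (fun x => Q x ^+ 2) _ _ _ := taylorW _ T1.
have W2 : taylor t0 (fun x => Q x ^+ 2) _ _ _ := taylorW _ T2.
have W3 : taylor t0 (fun x => Q x ^+ 2) _ _ _ := taylorW _ T3.
have w1 x : I x -> 1 * (Q x * Q x) * 1 <= Q x ^+ 2 by rewrite mul1r mulr1.
have w2 x : I x -> 1 * Q x * 1 <= Q x ^+ 2.
  by rewrite mul1r mulr1 => _; rewrite expr2 ler_peMl// (le_trans _ (Q1 x)).
have w3 x : I x -> 1 * 1 <= Q x ^+ 2.
  by rewrite mul1r => _; rewrite expr2 mulr_ege1.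
apply: taylor_eq (taylorD (taylorD (W1 w1) (W2 w2)) (W3 w3)) => // x _.
rewrite /Lg_v /Lg_p /Lg_q /=.
by move: (sg (p x))^-1 (u x)^-1 => a b; ring.
Qed.

Lemma intg_Lg_q u p q : adm u p q -> (forall x, Iclosed x -> 0 < u x) ->
  intg (fun x => Lg_q (u x) (p x) (q x)).
Proof.
move=> [up pq sq] u0; have cu := AC_within up; have cp := AC_within pq.
have cs n := @withinX R n _ (within_comp cp isg_continuous).
have qi : intg q by case: pq.
have c1 : {within @Iclosed R, continuous (fun x => 2 * u x * (sg (p x))^-1 ^+ 5)}.
  by apply: withinM; [apply: withinM => //; exact: within_cst|exact: cs].
rewrite /Lg_q; apply: intgD; last first.
  by apply: intg_within; apply: withinM; [exact: within_cst|exact: cs].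
by apply: (eq_intg _ (intgMc c1 qi)) => x _; rewrite mulrAC.
Qed.

Lemma intg_Lg_p u p q : adm u p q -> (forall x, Iclosed x -> 0 < u x) ->
  intg (fun x => Lg_p (u x) (p x) (q x)).
Proof.
move=> [up pq sq] u0; have cu := AC_within up; have cp := AC_within pq.
have cs n := @withinX R n _ (within_comp cp isg_continuous).
have qi : intg q by case: pq.
have c1 : {within @Iclosed R, continuous (fun x => 5 * u x * p x * (sg (p x))^-1 ^+ 7)}.
  apply: withinM; [|exact: cs]; apply: withinM => //.
  by apply: withinM => //; exact: within_cst.
have c2 : {within @Iclosed R, continuous (fun x => 6 * p x * (sg (p x))^-1 ^+ 5)}.
  by apply: withinM; [apply: withinM => //; exact: within_cst|exact: cs].
rewrite /Lg_p; apply: intgB; first apply: intgB.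
- apply: intgN; apply: (eq_intg _ (intgMc c1 sq)) => x _.
  by move: (_ ^+ 7) (_ ^+ 2) => a b; ring.
- apply: (eq_intg _ (intgMc c2 qi)) => x _.
  by move: (_ ^+ 5) => a; ring.
- apply: intg_within; apply: withinM; last exact: withinV.
  by apply: withinM => //; exact: cs.
Qed.

Lemma intg_Lg_v u p q : adm u p q -> (forall x, Iclosed x -> 0 < u x) ->
  intg (fun x => Lg_v (u x) (p x) (q x)).
Proof.
move=> [up pq sq] u0; have cu := AC_within up; have cp := AC_within pq.
have cs n := @withinX R n _ (within_comp cp isg_continuous).
rewrite /Lg_v; apply: intgB.
- by apply: (eq_intg _ (intgMc (cs 5%N) sq)) => x _; rewrite mulrC.
- apply: intg_within; apply: withinM; last by apply: withinX; exact: withinV.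
  exact: (within_comp cp isg_continuous).
Qed.

Lemma intgMr f g : intg f -> measurable_fun I g ->
  (exists M : R, forall x, I x -> `|g x| <= M) -> intg (fun x => f x * g x).
Proof.
move=> fi mg [M gM]; apply: (eq_intg _ (intgM mg gM fi)) => x _.
by rewrite mulrC.
Qed.

(** [f2] is bounded but need not be continuous, since the directions used below have step functions
    as second derivatives. The four boundary values keep [u + t * f] admissible and remove the
    boundary terms of the integrations by parts. *)
Record variation f f1 f2 : Prop := Variation {
  var_AC : AC f f1; var_AC1 : AC f1 f2;
  var_bd : exists M : R, forall x, I x -> `|f2 x| <= M;
  var_l : f (-1) = 0; var_r : f 1 = 0; var_l1 : f1 (-1) = 0; var_r1 : f1 1 = 0 }.

Definition dLg u p q f f1 f2 x : R :=
  Lg_v (u x) (p x) (q x) * f x + Lg_p (u x) (p x) (q x) * f1 x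
  + Lg_q (u x) (p x) (q x) * f2 x.

Lemma intg_dLg u p q f f1 f2 : adm u p q -> (forall x, Iclosed x -> 0 < u x) ->
  variation f f1 f2 -> intg (dLg u p q f f1 f2).
Proof.
move=> upq u0 [ff1 f12 bd _ _ _ _].
have [f2i _] := f12.
rewrite /dLg; apply: intgD; first apply: intgD.
- apply: (eq_intg _ (intgMc (AC_within ff1) (intg_Lg_v upq u0))) => x _.
  by rewrite mulrC.
- apply: (eq_intg _ (intgMc (AC_within f12) (intg_Lg_p upq u0))) => x _.
  by rewrite mulrC.
- apply: intgMr => //; [exact: intg_Lg_q|exact: intg_measurable].
Qed.

Lemma ge0_of_ge_small (a b t0 : R) : 0 <= b -> 0 < t0 ->
  (forall t, 0 < t <= t0 -> 0 <= a + t * b) -> 0 <= a.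
Proof.
move=> b0 t00 H; rewrite leNgt; apply/negP => a0.
(* For this [t], [t * b] stays below [- a / 2], so [a + t * b] is negative; the summand 1 keeps the
   denominator positive when [b = 0]. *)
pose t := Num.min t0 (- a / (2 * (b + 1))).
have b1 : 0 < 2 * (b + 1) by lra.
have tpos : 0 < t by rewrite lt_min t00 divr_gt0// oppr_gt0.
have h1 : t <= t0 by rewrite ge_min lexx.
have h2 : t <= - a / (2 * (b + 1)) by rewrite ge_min lexx orbT.
have := H t; rewrite tpos h1 => /(_ isT).
by rewrite ler_pdivlMr// in h2; nra.
Qed.

(** Only [t > 0] is available, as the obstacle may forbid the opposite direction, hence an
    inequality. Integrating the expansion, minimality gives [0 <= a + t * b] with [a] the first
    variation and [b] the remainder constant, for all small [t > 0]. *)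
Lemma first_variation alpha psi u p q f f1 f2 : 0 < alpha ->
  minimiser (@Wh R) (Nadm_obstacle alpha psi) u ->
  adm u p q -> p 1 = 0 -> p (-1) = 0 ->
  variation f f1 f2 -> (forall x, Iclosed x -> f x = f (- x)) ->
  (exists2 t1 : R, 0 < t1 &
    forall (t : R) x, 0 < t <= t1 -> Iclosed x -> u x + t * f x <= psi x) ->
  0 <= J (dLg u p q f f1 f2).
Proof.
move=> alpha0 [[[Hu u0 [ur ul] _ ue] upsi] umin] upq p1 pl var fe [t1 t10 ft].
have {}u0 x : Iclosed x -> 0 < u x.
  move=> /IclosedE/andP[]; rewrite le_eqVlt => /predU1P[<- _|h1]; first by rewrite ul.
  rewrite le_eqVlt => /predU1P[->|h2]; first by rewrite ur.
  by apply: u0; apply/IopenE; rewrite h1 h2.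
have dLi := intg_dLg upq u0 var.
have [ff1 f12 bd fl fr f1l f1r] := var.
have [t0 /andP[t00 t01] [pos [K K0 HK]]] := taylor_Lg upq u0 ff1 f12 bd.
pose w x := (1 + `|q x|) ^+ 2.
have qi : intg q by case: upq => _ [].
have wi : intg w.
  have := upq => -[_ _ sq].
  apply: (@eq_intg _ (fun x => 1 + 2 * `|q x| + q x ^+ 2)).
    move=> x _; rewrite /w -(real_normK (num_real (q x))).
    by move: (`|q x|) => z; ring.
  apply: intgD => //; apply: intgD; first exact: intg_cst.
  by apply: intgZ; apply/intgP; apply: integrable_norm; exact/intgP.
have w0 : 0 <= J w by apply: Rintegral_ge0 => x _; exact: sqr_ge0.
have m0 : 0 < Num.min t0 t1 by rewrite lt_min t00 t10.
apply: (@ge0_of_ge_small _ (K * J w) (Num.min t0 t1)) => //; first exact: mulr_ge0.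
move=> t /andP[tpos]; rewrite le_min => /andP[tt0 tt1].
pose v x := u x + t * f x; pose vp x := p x + t * f1 x; pose vq x := q x + t * f2 x.
have [up pq sq] := upq.
have f2i : intg f2 by case: f12.
have vadm : adm v vp vq.
  split; [by apply: ACD => //; exact: ACZ|by apply: ACD => //; exact: ACZ|].
  have [M HM] := bd.
  apply: sqD => //; [exact: intg_measurable|exact: intg_measurable (intgZ t f2i)|].
  apply: (@sq_bounded _ _ (`|t| * M)); first exact: intg_measurable (intgZ t f2i).
  by move=> x Ix; rewrite normrM ler_wpM2l// HM.
have v0 x : Iclosed x -> 0 < v x by move=> Ix; apply: pos => //; rewrite ltW.
have vN : Nadm_obstacle alpha psi v.
  split; last by move=> x Ix; apply: ft => //; rewrite tpos.
  apply: (adm_Nadm vadm).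
  - by move=> x /Iopen_closed; exact: v0.
  - by rewrite /v fr mulr0 addr0.
  - by rewrite /v fl mulr0 addr0.
  - by rewrite /vp f1r mulr0 addr0.
  - by rewrite /vp f1l mulr0 addr0.
  - by move=> x Ix; rewrite /v -ue// -fe.
have : (Wh u <= Wh v)%E by rewrite umin; apply: ereal_inf_lbound; exists v.
rewrite (Wh_adm upq u0) (Wh_adm vadm v0) lee_fin => Wuv.
have Li := intg_Lg upq u0; have Lvi := intg_Lg vadm v0.
have : J (fun x => Lg (v x) (vp x) (vq x)) <=
    J (fun x => Lg (u x) (p x) (q x) + (t * dLg u p q f f1 f2 x + (K * t ^+ 2) * w x)).
  apply: le_Rintegral => //.
  - by apply/intgP/intgD => //; apply: intgD; exact: intgZ.
  - move=> x Ix; have tt : 0 <= t <= t0 by rewrite ltW.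
    have [_ _] := HK x t Ix tt.
    by rewrite ler_norml => /andP[_]; rewrite /dLg /v /vp /vq /w; lra.
rewrite RintD//; last by apply: intgD; exact: intgZ.
rewrite (RintD (intgZ t dLi) (intgZ (K * t ^+ 2) wi)) (RintZ t dLi) (RintZ (K * t ^+ 2) wi) => H.
have := le_trans Wuv H; rewrite lerDl.
rewrite (_ : _ + _ = t * (J (dLg u p q f f1 f2) + t * (K * J w))); last first.
  by move: (J w) (J (dLg u p q f f1 f2)) => a b; ring.
by rewrite pmulr_rge0.
Qed.

End Variation.

(** * Concave functions on dense sets *)

Section Concave.
Context {R : realType}.
Local Notation mu := (@lebesgue_measure R).
Local Notation I := (@Iopen R).
Local Notation J f := (\int[mu]_(x in I) f x).
Implicit Types (f g h u p q : R -> R) (x y z : R).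
Opaque intg prim.
#[local] Hint Resolve measurable_Iopen : core.

Lemma AC_id : AC (fun x : R => x) (fun=> 1).
Proof.
apply: AC_C1; last exact: within_cst.
by apply: continuous_within => x; exact: cvg_id.
Qed.

Lemma prim_noninc f : (forall x y, x <= y -> f y <= f x) -> intg f ->
  forall x y, I x -> I y -> x < y ->
  f y * (y - x) <= prim f y - prim f x <= f x * (y - x).
Proof.
move=> fnon fi x y Ix Iy xy.
have [ii pid] := AC_id.
have one : prim (fun=> 1) y - prim (fun=> 1) x = y - x.
  have := pid x (Iopen_closed Ix); have := pid y (Iopen_closed Iy); lra.
pose st t := step y t - step x t.
have st01 t : 0 <= st t.
  rewrite /st /step subr_ge0; case: (leP t x) => tx; last by have /andP[] := step01 y t.
  by rewrite (le_trans tx (ltW xy)).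
have stE t : st t != 0 -> x < t <= y.
  rewrite /st /step; case: (leP t x) => tx; case: (leP t y) => ty //=.
  - by rewrite subrr eqxx.
  - by have := lt_le_trans (lt_le_trans xy (ltW ty)) tx; rewrite ltxx.
  - by rewrite subrr eqxx.
have P g : intg g -> prim g y - prim g x = J (fun t => g t * st t).
  move=> gi; rewrite -RintB; [|exact: intg_step|exact: intg_step].
  by apply: eq_Rint => t _; rewrite mulrBr.
have Pi g : intg g -> intg (fun t => g t * st t).
  move=> gi; apply: (@eq_intg _ (fun t => g t * step y t - g t * step x t)).
    by move=> t _; rewrite mulrBr.
  by apply: intgB; exact: intg_step.
rewrite P// -one P// -!RintZ; try exact: Pi.
apply/andP; split; apply: le_Rintegral => //; try by apply/intgP; exact: Pi.
- by apply/intgP; exact: intgZ _ (Pi _ ii).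
- move=> t _; rewrite mul1r; have [->|/stE/andP[xt ty]] := eqVneq (st t) 0.
    by rewrite !mulr0.
  by apply: ler_wpM2r => //; exact: fnon.
- by apply/intgP; exact: intgZ _ (Pi _ ii).
- move=> t _; rewrite mul1r; have [->|/stE/andP[xt ty]] := eqVneq (st t) 0.
    by rewrite !mulr0.
  by apply: ler_wpM2r => //; apply: fnon; exact: ltW.
Qed.

Definition slope (k : R -> R) x y : R := (k y - k x) / (y - x).

(** The chord inequality multiplied out, over an arbitrary set of points, because the function of
    interest is controlled only at almost every point. *)
Definition concave_on (S : set R) (k : R -> R) :=
  forall x y z, S x -> S y -> S z -> x < y -> y < z ->
    (z - y) * k x + (y - x) * k z <= (z - x) * k y.

Lemma slope_le (S : set R) k x y x' y' : concave_on S k -> S x -> S y -> S x' -> S y' ->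
  x < y -> y <= x' -> x' < y' -> slope k x' y' <= slope k x y.
Proof.
move=> ck Sx Sy Sx' Sy' xy + xy'.
have key a b c : S a -> S b -> S c -> a < b -> b < c -> slope k b c <= slope k a b.
  move=> Sa Sb Sc ab bc; have := ck a b c Sa Sb Sc ab bc.
  rewrite /slope ler_pdivrMr ?subr_gt0// mulrAC ler_pdivlMr ?subr_gt0//.
  by move=> h; lra.
rewrite le_eqVlt => /predU1P[yx|yx]; first by move: xy'; rewrite -yx => xy'; exact: key.
apply: (@le_trans _ _ (slope k y x')); first exact: key.
exact: key.
Qed.

Definition dense_in (S : set R) := forall a b : R, -1 <= a -> a < b -> b <= 1 ->
  exists2 x, S x & a < x < b.

Lemma dense_pair (S : set R) a b : dense_in S -> -1 <= a -> a < b -> b <= 1 ->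
  exists x y, [/\ S x, S y, a < x, x < y & y < b].
Proof.
move=> dS a1 ab b1; have [x Sx /andP[ax xb]] := dS a b a1 ab b1.
have [y Sy /andP[xy yb]] := dS x b (ltW (le_lt_trans a1 ax)) xb b1.
by exists x, y.
Qed.

(** A chord [c, d] is placed to the left of both pairs. Concavity of [k] and of [- k] compare it
    with each pair in opposite directions, so both slopes equal that of the chord, whatever the
    relative position of the pairs. *)
Lemma affine_slope (S : set R) k a b : S `<=` I -> dense_in S -> concave_on S k ->
  concave_on (S `&` `]a, b[) (fun x => - k x) -> -1 <= a ->
  forall x y x' y', S x -> S y -> S x' -> S y' ->
    a < x -> x < y -> y < b -> a < x' -> x' < y' -> y' < b ->
    slope k x y = slope k x' y'.
Proof.
move=> SI dS ck cNk a1 x y x' y' Sx Sy Sx' Sy' ax xy yb ax' xy' yb'.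
have itv z : a < z -> z < b -> `]a, b[%classic z.
  by move=> h1 h2; rewrite /= in_itv /= h1 h2.
have cd : a < Num.min x x' by rewrite lt_min ax.
have mx : Num.min x x' <= x by rewrite ge_min lexx.
have mx' : Num.min x x' <= x' by rewrite ge_min lexx orbT.
have m1 : Num.min x x' <= 1.
  by apply: le_trans mx _; have /IopenE/andP[_ /ltW] := SI x Sx.
have [c [d [Sc Sd ac cd' dm]]] := dense_pair dS a1 cd m1.
have slopeN w z : slope (fun x => - k x) w z = - slope k w z.
  by rewrite /slope -opprD mulNr.
have key w z : S w -> S z -> Num.min x x' <= w -> w < z -> z < b -> slope k c d = slope k w z.
  move=> Sw Sz mw wz zb.
  have dw : d < w by exact: lt_le_trans dm mw.
  apply/eqP; rewrite eq_le; apply/andP; split; last first.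
    by apply: (slope_le ck) => //; exact: ltW.
  rewrite -lerN2 -!slopeN; apply: (slope_le cNk) => //; try (split => //; apply: itv); lra.
by rewrite -(key x y)// -(key x' y').
Qed.

Section ConcaveDensity.
Context (S : set R) (k : R -> R) (eL eR : R).
Context (SI : S `<=` I) (dS : dense_in S) (ck : concave_on S k).
Context (eL1 : -1 < eL <= 1) (eR1 : -1 <= eR < 1).
Context (affL : concave_on (S `&` `]-1, eL[) (fun x => - k x)).
Context (affR : concave_on (S `&` `]eR, 1[) (fun x => - k x)).

(** Slopes decrease from left to right, so the constant slopes of the two affine end pieces bound
    all of them. Without these pieces a concave function may have unbounded slopes at the ends. *)
Lemma slope_bounds : exists sL sR, forall x y, S x -> S y -> x < y ->
  sR <= slope k x y <= sL.
Proof.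
have /andP[eL2 eL3] := eL1; have /andP[eR2 eR3] := eR1.
have [a [b [Sa Sb a1 ab beL]]] := dense_pair dS (lexx _) eL2 eL3.
have [c [d [Sc Sd c1 cd d1]]] := dense_pair dS eR2 eR3 (lexx 1).
exists (slope k a b), (slope k c d) => x y Sx Sy xy.
have /IopenE/andP[x1 x2] := SI Sx; have /IopenE/andP[y1 y2] := SI Sy.
apply/andP; split.
- have m1 : Num.max y eR < 1 by rewrite gt_max y2.
  have m2 : -1 <= Num.max y eR by rewrite le_max eR2 orbT.
  have [c' [d' [Sc' Sd' c1' cd' d1']]] := dense_pair dS m2 m1 (lexx 1).
  move: c1'; rewrite gt_max => /andP[yc' rc'].
  rewrite (affine_slope SI dS ck affR eR2 Sc Sd Sc' Sd')//.
  by apply: (slope_le ck) => //; exact: ltW.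
- have m1 : -1 < Num.min x eL by rewrite lt_min x1.
  have m2 : Num.min x eL <= 1 by rewrite ge_min eL3 orbT.
  have [c' [d' [Sc' Sd' c1' cd' d1']]] := dense_pair dS (lexx _) m1 m2.
  move: d1'; rewrite lt_min => /andP[yc' rc'].
  rewrite (affine_slope SI dS ck affL (lexx _) Sa Sb Sc' Sd')//.
  by apply: (slope_le ck) => //; exact: ltW.
Qed.

(** The point [t] itself need not lie in [S]; by concavity the supremum of these slopes serves as a
    right derivative at [t]. *)
Definition rslopes (t : R) : set R :=
  [set s | exists x y, [/\ S x, S y, t <= x, x < y & s = slope k x y]].

(** Over any pair of points [x < y] of [S], the increments of [k] and of [prim m] both lie between
    [m y * (y - x)] and [m x * (y - x)]. This comparison improves under subdivision and forces
    [k - prim m] to be constant on [S], without continuity of [k]. *)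
Lemma concave_prim : exists (m : R -> R) (c M : R),
  [/\ forall x y, x <= y -> m y <= m x, forall x, `|m x| <= M,
      forall x, S x -> k x = c + prim m x &
      forall a b : R, -1 <= a -> b <= 1 ->
        concave_on (S `&` `]a, b[) (fun x => - k x) ->
        exists s, forall t, a < t < b -> m t = s].
Proof.
have [sL [sR sB]] := slope_bounds.
(* [rslopes t] is empty for [t >= 1]. *)
pose m t := if t < 1 then sup (rslopes t) else sR.
have ne t : t < 1 -> rslopes t !=set0.
  move=> t1; have m1 : Num.max t (-1) < 1 by rewrite gt_max t1; lra.
  have m2 : -1 <= Num.max t (-1) by rewrite le_max lexx orbT.
  have [c [d [Sc Sd c1 cd d1]]] := dense_pair dS m2 m1 (lexx 1).
  move: c1; rewrite gt_max => /andP[tc _].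
  by exists (slope k c d), c, d; split => //; exact: ltW.
have ub t : has_ubound (rslopes t).
  by exists sL => _ [x [y [Sx Sy _ xy ->]]]; have /andP[] := sB x y Sx Sy xy.
have ge_m t x y : t < 1 -> S x -> S y -> t <= x -> x < y -> slope k x y <= m t.
  move=> t1 Sx Sy tx xy; rewrite /m t1; apply: ub_le_sup => //.
  by exists x, y.
have m_le t s : t < 1 -> (forall x y, S x -> S y -> t <= x -> x < y -> slope k x y <= s) ->
    m t <= s.
  move=> t1 H; rewrite /m t1; apply: ge_sup; first exact: ne.
  by move=> _ [x [y [Sx Sy tx xy ->]]]; exact: H.
have mR t : sR <= m t.
  rewrite /m; case: ifPn => // t1; have [_ [x [y [Sx Sy tx xy _]]]] := ne t t1.
  have /andP[h _] := sB x y Sx Sy xy; apply: (le_trans h).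
  by have := ge_m t x y t1 Sx Sy tx xy; rewrite /m t1.
have mL t : m t <= sL.
  have [t1|t1] := boolP (t < 1).
    by apply: m_le => // x y Sx Sy _ xy; have /andP[] := sB x y Sx Sy xy.
  rewrite /m (negbTE t1); have [_ [x [y [Sx Sy tx xy _]]]] := ne 0 ltr01.
  by have /andP[h1 h2] := sB x y Sx Sy xy; exact: le_trans h1 h2.
have mnon x y : x <= y -> m y <= m x.
  move=> xy; have [y1|y1] := boolP (y < 1); last by rewrite {1}/m (negbTE y1).
  apply: m_le => // a b Sa Sb ya ab; apply: ge_m => //.
    exact: le_lt_trans xy y1.
  exact: le_trans xy ya.
have mi : intg m.
  apply: (@intg_bounded _ _ (`|sL| + `|sR|)).
    by apply: (nonincreasing_measurable measurable_Iopen) => x y; exact: mnon.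
  move=> x _; rewrite ler_norml; apply/andP; split.
    by have := mR x; have := ler_norm (- sR); rewrite normrN; have := normr_ge0 sL; lra.
  by have := mL x; have := ler_norm sL; have := normr_ge0 sR; lra.
have step1 x y : S x -> S y -> x < y -> m y * (y - x) <= k y - k x <= m x * (y - x).
  move=> Sx Sy xy; have /IopenE/andP[x1 x2] := SI Sx; have /IopenE/andP[y1 y2] := SI Sy.
  have -> : k y - k x = slope k x y * (y - x).
    by rewrite /slope divfK// subr_eq0 gt_eqF.
  have yx : 0 <= y - x by rewrite subr_ge0 ltW.
  apply/andP; split; apply: ler_wpM2r => //.
    by apply: m_le => // a b Sa Sb ya ab; exact: (slope_le ck).
  exact: ge_m.
pose F x := k x - prim m x.
(* Splitting at a point of the middle third leaves pieces of length at most [2 / 3] of the whole,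
   while the drops of [m] over them add up, so each subdivision gains the factor [2 / 3]. A third is
   used because the midpoint may be missing from [S]. *)
have F1 n x y : S x -> S y -> x < y ->
    `|F y - F x| <= (2 / 3) ^+ n * (y - x) * (m x - m y).
  elim: n x y => [|n IH] x y Sx Sy xy.
    rewrite expr0 mul1r.
    have /andP[h1 h2] := step1 x y Sx Sy xy.
    have /andP[h3 h4] := prim_noninc mnon mi (SI Sx) (SI Sy) xy.
    by rewrite /F ler_norml; apply/andP; split; lra.
  have /IopenE/andP[x1 x2] := SI Sx; have /IopenE/andP[y1 y2] := SI Sy.
  have h1 : -1 <= x + (y - x) / 3 by lra.
  have h2 : x + (y - x) / 3 < y - (y - x) / 3 by lra.
  have h3 : y - (y - x) / 3 <= 1 by lra.
  have [z Sz /andP[xz zy]] := dS h1 h2 h3.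
  have xz' : x < z by lra.
  have zy' : z < y by lra.
  have i1 := IH x z Sx Sz xz'; have i2 := IH z y Sz Sy zy'.
  rewrite (_ : F y - F x = (F y - F z) + (F z - F x)); last by lra.
  apply: le_trans (ler_normD _ _) _; apply: le_trans (lerD i2 i1) _.
  have m1 := mnon _ _ (ltW xz'); have m2 := mnon _ _ (ltW zy').
  rewrite exprS; have : 0 <= (2 / 3 : R) ^+ n by rewrite exprn_ge0// divr_ge0.
  move: (_ ^+ n) => e e0.
  have a1 : 0 <= (2 / 3 * (y - x) - (z - x)) * (m x - m z) by apply: mulr_ge0; lra.
  have a2 : 0 <= (2 / 3 * (y - x) - (y - z)) * (m z - m y) by apply: mulr_ge0; lra.
  have a3 : (y - z) * (m z - m y) + (z - x) * (m x - m z) <= 2 / 3 * (y - x) * (m x - m y).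
    by lra.
  have := ler_wpM2l e0 a3; lra.
have F2 x y : S x -> S y -> x < y -> F y = F x.
  move=> Sx Sy xy; apply/eqP; rewrite -subr_eq0 -normr_le0.
  pose c := (y - x) * (m x - m y).
  have c23 : (fun n => (2 / 3 : R) ^+ n * c) @ \oo --> (0 : R).
    rewrite -(mul0r c); apply: cvgM; last exact: cvg_cst.
    by apply: cvg_expr; rewrite ger0_norm ?divr_ge0//; lra.
  apply: (@cvgr_to_ge _ _ _ _ _ _ _ c23); apply: nearW => n.
  by rewrite /c mulrA; exact: F1.
have [x0 Sx0 _] := dS (lexx _) (proj1 (andP eL1)) (proj2 (andP eL1)).
exists m, (F x0), (`|sL| + `|sR|); split => //.
- move=> x; rewrite ler_norml; apply/andP; split.
    by have := mR x; have := ler_norm (- sR); rewrite normrN; have := normr_ge0 sL; lra.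
  by have := mL x; have := ler_norm sL; have := normr_ge0 sR; lra.
- move=> x Sx; have -> : F x0 = F x.
    by have [xx|xx|->//] := ltgtP x x0; [apply: F2|apply/esym; apply: F2].
  by rewrite /F subrK.
- move=> a b a1 b1 ab; have [ltab|leba] := ltP a b; last first.
    exists 0 => t /andP[h1 h2]; have := lt_trans h1 h2.
    by rewrite ltNge leba.
  have [x1 [y1 [Sx1 Sy1 ax1 xy1 yb1]]] := dense_pair dS a1 ltab b1.
  exists (slope k x1 y1) => t /andP[at' tb].
  have slE := affine_slope SI dS ck ab a1.
  apply/eqP; rewrite eq_le; apply/andP; split.
    apply: m_le; first exact: lt_le_trans tb b1.
    move=> x y Sx Sy tx xy.
    have [c [d [Sc Sd ac cd dt]]] := dense_pair dS a1 at' (ltW (lt_le_trans tb b1)).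
    rewrite -(slE c d x1 y1)//; last exact: lt_trans dt tb.
    apply: (slope_le ck) => //; exact: le_trans (ltW dt) tx.
  have [c [d [Sc Sd tc cd db]]] := dense_pair dS (ltW (le_lt_trans a1 at')) tb b1.
  rewrite (slE x1 y1 c d)//; last exact: lt_trans at' tc.
  by apply: ge_m => //; [exact: lt_le_trans tb b1|exact: ltW].
Qed.

End ConcaveDensity.

End Concave.

(** * Second difference variations *)

Section Obstacle.
Context {R : realType}.
Local Notation mu := (@lebesgue_measure R).
Local Notation I := (@Iopen R).
Local Notation J f := (\int[mu]_(x in I) f x).
Implicit Types (f g h u p q : R -> R) (x y z : R).
Opaque intg prim.
#[local] Hint Resolve measurable_Iopen : core.

Lemma ae_dense (S : set R) : {ae mu, forall x, I x -> S x} -> dense_in S.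
Proof.
move=> [N [mN N0 SN]] a b a1 ab b1.
apply: contrapT => H.
have sub : `]a, b[ `<=` N.
  move=> x /=; rewrite in_itv /= => /andP[ax xb]; apply: SN => /= Sx.
  apply: H; exists x; last by rewrite ax.
  by apply: Sx; apply/IopenE; rewrite (le_lt_trans a1 ax) (lt_le_trans xb b1).
have : (mu `]a, b[ <= mu N)%E by apply: le_measure => //; rewrite inE //; exact: measurable_itv.
rewrite N0 lebesgue_measure_itv /= lte_fin ab -EFinD lee_fin; lra.
Qed.

(** * Piecewise quadratic test directions *)

Definition ramp a x : R := Num.max (x - a) 0.

Lemma ramp0 a x : x <= a -> ramp a x = 0.
Proof. by move=> xa; rewrite /ramp max_r// subr_le0. Qed.

Lemma ramp1 a x : a <= x -> ramp a x = x - a.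
Proof. by move=> xa; rewrite /ramp max_l// subr_ge0. Qed.

Lemma AC_ramp a : -1 <= a <= 1 -> AC (ramp a) (fun t => 1 - step a t).
Proof.
move=> a1; have [ii pid] := @AC_id R.
have si : intg (step a).
  by apply: (eq_intg _ (intg_step a ii)) => t _; rewrite mul1r.
split; first exact: intgB.
move=> x Ix; rewrite primB// [ramp a (-1)]ramp0; last by case/andP: a1.
have p1 : prim (fun=> 1) x = x + 1 by have := pid x Ix; lra.
have Ia : Iclosed a by apply/IclosedE.
have p2 : prim (fun=> 1) a = a + 1 by have := pid a Ia; lra.
have E y z : prim (step y) z = J (fun t => step y t * step z t) by [].
have E1 z : prim (fun=> 1) z = J (fun t => 1 * step z t) by [].
have [xa|ax] := leP x a.
  rewrite ramp0// add0r p1 E.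
  rewrite (@eq_Rint _ _ (fun t => 1 * step x t)) -?E1 ?p1 ?subrr// => t _.
  rewrite /step; case: (leP t x) => tx; last by rewrite !mulr0.
  by rewrite (le_trans tx xa).
rewrite ramp1 ?(ltW ax)// add0r p1 E.
rewrite (@eq_Rint _ _ (fun t => 1 * step a t)) -?E1 ?p2; first by lra.
move=> t _; rewrite /step; case: (leP t a) => ta; last by rewrite mul0r mulr0.
by rewrite (le_trans ta (ltW ax)).
Qed.

Definition ramp2 a x : R := ramp a x ^+ 2 / 2.

Lemma AC_ramp2 a : -1 <= a <= 1 -> AC (ramp2 a) (ramp a).
Proof.
move=> a1; have H := AC_ramp a1.
apply: AC_eq (ACZ 2^-1 (ACM H H)) => x _; first by rewrite /ramp2; field.
rewrite /step; case: leP => xa; last by rewrite mulr0n; field.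
by rewrite ramp0// mulr0 mul0r addr0 mulr0.
Qed.

(* Convex, with second derivative the indicator of ]a, a + e]. *)
Definition tent e a x : R := ramp2 a x - ramp2 (a + e) x.

Definition tent1 e a x : R := ramp a x - ramp (a + e) x.

Definition tent2 e a x : R := step (a + e) x - step a x.

(** Together with [tent_eq] this says that [tent e a x] is the maximum of [m * (x - a) - m ^+ 2 / 2]
    over slopes [m] in [[0, e]]. Each competitor is affine in the base point [a], so the maximum is
    convex in [a]. *)
Lemma tent_ge e a m x : 0 <= m <= e -> m * (x - a) - m ^+ 2 / 2 <= tent e a x.
Proof.
move=> /andP[m0 me]; rewrite /tent /ramp2.
have [xa|ax] := leP x a.
  rewrite !ramp0 //; [|lra].
  have : 0 <= m * (a - x) by apply: mulr_ge0; lra.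
  by have := sqr_ge0 m; lra.
rewrite (ramp1 (ltW ax)); have [xe|ex] := leP x (a + e).
  by rewrite ramp0//; have := sqr_ge0 (x - a - m); lra.
rewrite (ramp1 (ltW ex)).
have : 0 <= (e - m) * (x - a - e) by apply: mulr_ge0; lra.
have := sqr_ge0 (e - m); lra.
Qed.

Lemma tent_eq e a x : 0 <= e -> exists2 m : R, 0 <= m <= e &
  tent e a x = m * (x - a) - m ^+ 2 / 2.
Proof.
move=> e0; rewrite /tent /ramp2; have [xa|ax] := leP x a.
  by exists 0; [lra|rewrite !ramp0 //; lra].
rewrite (ramp1 (ltW ax)); have [xe|ex] := leP x (a + e).
  by exists (x - a); [lra|rewrite ramp0//; lra].
by exists e; [lra|rewrite (ramp1 (ltW ex)); lra].
Qed.

(* Second difference of the convex functions [tent e], hence nonnegative. *)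
Definition bumpv e x y z t : R :=
  (z - y) * tent e x t + (y - x) * tent e z t - (z - x) * tent e y t.

Definition bumpv1 e x y z t : R :=
  (z - y) * tent1 e x t + (y - x) * tent1 e z t - (z - x) * tent1 e y t.

Definition bumpv2 e x y z t : R :=
  (z - y) * tent2 e x t + (y - x) * tent2 e z t - (z - x) * tent2 e y t.

(** Take the slope [m] that is optimal for the middle base point [y]. The lower bounds it gives at
    [x] and [z] are affine in the base point, and their weighted sum is exactly
    [(z - x) * tent e y t]. *)
Lemma bumpv_ge0 e x y z t : 0 <= e -> x < y -> y < z -> 0 <= bumpv e x y z t.
Proof.
move=> e0 xy yz; rewrite /bumpv; have [m m0 ->] := tent_eq y t e0.
have h1 := tent_ge x t m0; have h2 := tent_ge z t m0.
have k1 : 0 <= (z - y) * (tent e x t - (m * (t - x) - m ^+ 2 / 2)) by apply: mulr_ge0; lra.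
have k2 : 0 <= (y - x) * (tent e z t - (m * (t - z) - m ^+ 2 / 2)) by apply: mulr_ge0; lra.
by lra.
Qed.

(** Left of [x] all three tents vanish. Right of [z + e] each equals [e * (t - a) - e ^+ 2 / 2],
    affine in the base point [a], and the second difference cancels. *)
Lemma bumpv_out e x y z t : 0 <= e -> x < y -> y < z -> ~~ (x <= t <= z + e) ->
  bumpv e x y z t = 0.
Proof.
move=> e0 xy yz; rewrite negb_and -!ltNge => /orP[tx|zt].
  by rewrite /bumpv /tent /ramp2 !ramp0; lra.
by rewrite /bumpv /tent /ramp2 !ramp1; lra.
Qed.

Lemma variation_bumpv e x y z : 0 <= e -> -1 <= x -> x < y -> y < z -> z + e <= 1 ->
  variation (bumpv e x y z) (bumpv1 e x y z) (bumpv2 e x y z).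
Proof.
move=> e0 x1 xy yz ze.
have A a : -1 <= a -> a + e <= 1 -> AC (tent e a) (tent1 e a).
  by move=> a1 ae; apply: ACB; apply: AC_ramp2; lra.
have A1 a : -1 <= a -> a + e <= 1 -> AC (tent1 e a) (tent2 e a).
  move=> a1 ae; have h1 : -1 <= a <= 1 by lra.
  have h2 : -1 <= a + e <= 1 by lra.
  by apply: AC_eq (ACB (AC_ramp h1) (AC_ramp h2)) => t _ //; rewrite /tent2; lra.
have zy1 : -1 <= y by lra.
have ze1 : y + e <= 1 by lra.
have xe1 : x + e <= 1 by lra.
have z1 : -1 <= z by lra.
split.
- by apply: ACB; [apply: ACD|]; apply: ACZ; apply: A.
- by apply: ACB; [apply: ACD|]; apply: ACZ; apply: A1.
- exists ((z - y) * 1 + (y - x) * 1 + (z - x) * 1) => t _.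
  have T a : `|tent2 e a t| <= 1.
    rewrite /tent2 ler_norml.
    by have /andP[? ?] := step01 a t; have /andP[? ?] := step01 (a + e) t; apply/andP; lra.
  have K (c a : R) : 0 <= c -> `|c * tent2 e a t| <= c * 1.
    by move=> c0; rewrite normrM (ger0_norm c0); exact: ler_wpM2l.
  apply: le_trans (ler_normB _ _) _; apply: lerD; last by apply: K; lra.
  by apply: le_trans (ler_normD _ _) _; apply: lerD; apply: K; lra.
- by rewrite /bumpv /tent /ramp2 !ramp0; lra.
- by rewrite /bumpv /tent /ramp2 !ramp1; lra.
- by rewrite /bumpv1 /tent1 !ramp0; lra.
- by rewrite /bumpv1 /tent1 !ramp1; lra.
Qed.

Lemma variationN f f1 f2 : variation f f1 f2 ->
  variation (fun x => - f x) (fun x => - f1 x) (fun x => - f2 x).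
Proof.
move=> [A A1 [M HM] l r l1 r1]; split; try by rewrite ?l ?r ?l1 ?r1 oppr0.
- exact: ACN.
- exact: ACN.
- by exists M => x Ix; rewrite normrN; exact: HM.
Qed.

Lemma variation_sym f f1 f2 : variation f f1 f2 ->
  variation (fun x => f x + f (- x)) (fun x => f1 x - f1 (- x))
    (fun x => f2 x + f2 (- x)).
Proof.
move=> [A A1 [M HM] l r l1 r1]; split; rewrite ?opprK ?l ?r ?l1 ?r1 ?addr0 ?subr0//.
- exact: ACD A (AC_opp A).
- apply: AC_eq (ACB A1 (AC_opp A1)) => // x _.
  by rewrite opprK.
- exists (M + M) => x Ix; apply: le_trans (ler_normD _ _) _.
  by apply: lerD; apply: HM => //; exact/Iopen_opp.
Qed.

(** * The first variation along symmetrised directions *)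

Section FirstVariation.
Context (u p q : R -> R) (upq : adm u p q) (u0 : forall x, Iclosed x -> 0 < u x).
Local Notation A := (fun x => Lg_q (u x) (p x) (q x)).
Local Notation B := (fun x => Lg_p (u x) (p x) (q x)).
Local Notation C := (fun x => Lg_v (u x) (p x) (q x)).

Definition Ef x : R := prim (fun t => B t - prim C t) x.

Lemma intg_BC : intg (fun t => B t - prim C t).
Proof.
apply: intgB; first exact: intg_Lg_p.
by apply: intg_within; apply: prim_continuous; exact: intg_Lg_v.
Qed.

Definition defect x : R := A x - Ef x.

Lemma intg_defect : intg defect.
Proof.
apply: intgB; first exact: intg_Lg_q.
by apply: intg_within; apply: prim_continuous; exact: intg_BC.
Qed.

Lemma parts_algebra (a b c d e : R) :
  c + d = 0 -> b - d + e = 0 -> c + b + a = a - e.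
Proof. lra. Qed.

(* Integrating the lower order terms by parts moves both derivatives onto the test function. *)
Lemma dLg_defect f f1 f2 : variation f f1 f2 ->
  J (dLg u p q f f1 f2) = J (fun x => defect x * f2 x).
Proof.
move=> [ff1 f12 bd l r l1 r1].
have Ai := intg_Lg_q upq u0; have Bi := intg_Lg_p upq u0; have Ci := intg_Lg_v upq u0.
have BCi := intg_BC; have [f2i _] := f12; have [f1i _] := ff1.
have pC := AC_prim Ci; have pE := AC_prim BCi.
have i1 := AC_ibp pC ff1; rewrite l r !mulr0 subrr in i1.
have i2 := AC_ibp pE f12; rewrite l1 r1 !mulr0 subrr in i2.
have cf := AC_within ff1; have cf1 := AC_within f12.
have C1 : intg (fun x => C x * f x).
  by apply: (eq_intg _ (intgMc cf Ci)) => x _; rewrite mulrC.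
have B1 : intg (fun x => B x * f1 x).
  by apply: (eq_intg _ (intgMc cf1 Bi)) => x _; rewrite mulrC.
have A1 : intg (fun x => A x * f2 x) by apply: intgMr => //; exact: intg_measurable.
have D1 : intg (fun x => prim C x * f1 x) by exact: intg_prim.
have E1 : intg (fun x => Ef x * f2 x) by exact: intg_prim.
have F1 : intg (fun x => (B x - prim C x) * f1 x).
  by apply: (eq_intg _ (intgMc cf1 BCi)) => x _; rewrite mulrC.
rewrite RintD// in i1; rewrite RintD// in i2.
have H3 : J (fun x => (B x - prim C x) * f1 x) = J (fun x => B x * f1 x) - J (fun x => prim C x * f1 x).
  by rewrite -RintB//; apply: eq_Rint => x _; rewrite mulrBl.
have H4 : J (fun x => defect x * f2 x) = J (fun x => A x * f2 x) - J (fun x => Ef x * f2 x).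
  by rewrite -RintB//; apply: eq_Rint => x _; rewrite mulrBl.
have H5 : J (dLg u p q f f1 f2) = J (fun x => C x * f x) + J (fun x => B x * f1 x) + J (fun x => A x * f2 x).
  by rewrite -!RintD//; exact: intgD.
rewrite H3 in i2; rewrite H5 H4; exact: parts_algebra i1 i2.
Qed.

(* Only even variations are admissible, so only the symmetrisation of [defect] is
   controlled by the first variation. *)
Definition sdefect x : R := defect x + defect (- x).

Lemma intg_sdefect : intg sdefect.
Proof. by apply: intgD; [|apply: intg_opp]; exact: intg_defect. Qed.

(** The substitution of [- x] for [x] moves the reflection from [f2] onto [defect]. *)
Lemma dLg_sym f f1 f2 : variation f f1 f2 ->
  J (dLg u p q (fun x => f x + f (- x)) (fun x => f1 x - f1 (- x))
      (fun x => f2 x + f2 (- x))) = J (fun x => sdefect x * f2 x).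
Proof.
move=> vf; have hi := intg_defect; have [_ [f2i _] bd _ _ _ _] := vf.
rewrite (dLg_defect (variation_sym vf)).
have mf2 := intg_measurable f2i.
have bd' : exists M : R, forall x, I x -> `|f2 (- x)| <= M.
  by have [M HM] := bd; exists M => x /Iopen_opp; exact: HM.
have mf2' : measurable_fun I (fun x => f2 (- x)) := intg_measurable (intg_opp f2i).
have i1 : intg (fun x => defect x * f2 x) by exact: intgMr.
have i2 : intg (fun x => defect x * f2 (- x)) by exact: intgMr.
have i3 : intg (fun x => defect (- x) * f2 x) by apply: intgMr => //; exact: intg_opp.
rewrite (@eq_Rint _ _ (fun x => defect x * f2 x + defect x * f2 (- x))); last first.
  by move=> x _; rewrite mulrDr.
rewrite (@eq_Rint _ (fun x => sdefect x * f2 x) (fun x => defect x * f2 x + defect (- x) * f2 x)); last first.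
  by move=> x _; rewrite mulrDl.
rewrite !RintD//; congr (_ + _); rewrite -(Rint_opp i2).
by apply: eq_Rint => x _; rewrite opprK.
Qed.

(** Each [tent2 e a] is the indicator of []a, a + e]], against which [sdefect] integrates to an
    increment of its primitive. Division by [e] then recovers [sdefect] at the three base points in
    the limit. *)
Lemma sdefect_bumpv2 e x y z : J (fun t => sdefect t * bumpv2 e x y z t) =
  (z - y) * (prim sdefect (x + e) - prim sdefect x) + (y - x) * (prim sdefect (z + e) - prim sdefect z)
  - (z - x) * (prim sdefect (y + e) - prim sdefect y).
Proof.
have ki := intg_sdefect.
have s a : intg (fun t => sdefect t * step a t) by exact: intg_step.
have E a : prim sdefect (a + e) - prim sdefect a = J (fun t => sdefect t * tent2 e a t).
  by rewrite -RintB//; apply: eq_Rint => t _; rewrite mulrBr.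
have T a : intg (fun t => sdefect t * tent2 e a t).
  apply: (@eq_intg _ (fun t => sdefect t * step (a + e) t - sdefect t * step a t)).
    by move=> t _; rewrite mulrBr.
  exact: intgB.
rewrite !E -!RintZ// -RintD; [|exact: intgZ|exact: intgZ].
rewrite -RintB; [|by apply: intgD; exact: intgZ|exact: intgZ].
apply: eq_Rint => t _; rewrite /bumpv2; move: (tent2 e x t) (tent2 e z t) (tent2 e y t) (sdefect t).
by move=> a b c d; ring.
Qed.

(** A condition implied by being a Lebesgue point, and just what the difference quotients need. It
    selects the points at which the value of [sdefect], which depends on the representative [q], is
    meaningful. *)
Definition good x := I x /\ is_derive x (1 : R) (prim sdefect) (sdefect x).

Lemma good_ae : {ae mu, forall x, I x -> good x}.
Proof. by apply: aeS (prim_ae_derive intg_sdefect) => x H Ix; split => //; exact: H. Qed.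

Lemma good_quot x : good x -> (prim sdefect (x + e) - prim sdefect x) / e @[e --> 0^'+] --> sdefect x.
Proof.
move=> [Ix dx].
have : (fun e : R => e^-1 *: (prim sdefect (e *: (1 : R) + x) - prim sdefect x)) @ 0^' --> sdefect x.
  have [d E] := dx; rewrite -E; exact: d.
move=> /cvg_dnbhs_at_right; apply: cvg_trans; apply: near_eq_cvg.
near=> e; rewrite [e *: 1]mulr1 [e + x]addrC.
by rewrite [LHS]mulrC.
Unshelve. all: by end_near. Qed.

(* [b] is the sign of admissible variations. *)
Lemma sdefect_limit (b : R) x y z (e0 : R) : good x -> good y -> good z -> 0 < e0 ->
  (forall e, 0 < e < e0 -> 0 <= b * J (fun t => sdefect t * bumpv2 e x y z t)) ->
  0 <= b * ((z - y) * sdefect x + (y - x) * sdefect z - (z - x) * sdefect y).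
Proof.
move=> gx gy gz e00 H.
have L : b * ((z - y) * ((prim sdefect (x + e) - prim sdefect x) / e) +
    (y - x) * ((prim sdefect (z + e) - prim sdefect z) / e)
    - (z - x) * ((prim sdefect (y + e) - prim sdefect y) / e)) @[e --> 0^'+] -->
    b * ((z - y) * sdefect x + (y - x) * sdefect z - (z - x) * sdefect y).
  apply: cvgM; first exact: cvg_cst.
  apply: cvgB; [apply: cvgD|]; apply: cvgM; try exact: cvg_cst; exact: good_quot.
apply: (cvgr_to_ge L); near=> e.
have e1 : 0 < e by near: e; exact: nbhs_right_gt.
have e2 : e < e0 by near: e; exact: nbhs_right_lt.
have h : 0 < e < e0 by rewrite e1.
have := H e h.
rewrite sdefect_bumpv2 -(pmulr_rge0 _ (_ : 0 < e^-1)) ?invr_gt0//.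
set a1 := prim sdefect (x + e) - _; set a2 := prim sdefect (z + e) - _; set a3 := prim sdefect (y + e) - _.
by rewrite (_ : e^-1 * _ = b * ((z - y) * (a1 / e) + (y - x) * (a2 / e) - (z - x) * (a3 / e))) //; ring.
Unshelve. all: by end_near. Qed.

End FirstVariation.

End Obstacle.

(** * Regularity of minimisers *)

Section Minimiser.
Context {R : realType}.
Local Notation mu := (@lebesgue_measure R).
Local Notation I := (@Iopen R).
Local Notation J f := (\int[mu]_(x in I) f x).
Implicit Types (f g h p q : R -> R) (x y z : R).
Opaque intg prim.
#[local] Hint Resolve measurable_Iopen : core.

Context (alpha : R) (psi u : R -> R).
Context (alpha_gt0 : 0 < alpha) (psi_cont : {within @Iclosed R, continuous psi})
  (psi_bnd : psi 1 = psi (-1)) (psi_bnd_gt : alpha < psi (-1))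
  (psi_sym : forall x, Iopen x -> psi x = psi (- x))
  (u_min : minimiser (@Wh R) (Nadm_obstacle alpha psi) u).

Lemma min_even x : Iclosed x -> u x = u (- x).
Proof. by move: u_min => [[[_ _ _ _ ue] _] _]; exact: ue. Qed.

Lemma min_psi x : Iclosed x -> u x <= psi x.
Proof. by move: u_min => [[_ upsi] _]; exact: upsi. Qed.

Lemma min_bnd : u 1 = alpha /\ u (-1) = alpha.
Proof. by move: u_min => [[[_ _ ub _ _] _] _]. Qed.

Lemma min_gt0 x : Iclosed x -> 0 < u x.
Proof.
move: u_min => [[[_ u0 _ _ _] _] _]; have [ur ul] := min_bnd.
move=> /IclosedE/andP[]; rewrite le_eqVlt => /predU1P[<- _|h1]; first by rewrite ul.
rewrite le_eqVlt => /predU1P[->|h2]; first by rewrite ur.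
by apply: u0; apply/IopenE; rewrite h1 h2.
Qed.

Lemma psi_even x : Iclosed x -> psi x = psi (- x).
Proof.
move=> /IclosedE/andP[]; rewrite le_eqVlt => /predU1P[<- _|h1]; first by rewrite opprK psi_bnd.
rewrite le_eqVlt => /predU1P[->|h2]; first by rewrite psi_bnd.
by apply: psi_sym; apply/IopenE; rewrite h1 h2.
Qed.

(** * Concavity of the symmetrised defect, and affinity off the coincidence set *)

Section Derivatives.
Context (p q : R -> R) (upq : adm u p q) (p1 : p 1 = 0) (pl : p (-1) = 0).
Local Notation k := (sdefect u p q).

Lemma intg_sdefect_var f f1 f2 : variation f f1 f2 -> intg (fun x => k x * f2 x).
Proof.
move=> [_ [f2i _] bd _ _ _ _]; apply: intgMr => //; last exact: intg_measurable.
exact: intg_sdefect upq min_gt0.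
Qed.

Lemma sdefect_concave : concave_on (good u p q) k.
Proof.
move=> x y z gx gy gz xy yz.
have [/IopenE/andP[x1 _] _] := gx; have [/IopenE/andP[_ z1] _] := gz.
suff : 0 <= -1 * ((z - y) * k x + (y - x) * k z - (z - x) * k y) by lra.
have e0 : 0 < 1 - z by lra.
apply: (sdefect_limit upq min_gt0 gx gy gz e0) => e /andP[e1 ez].
have ze : z + e <= 1 by lra.
have vb := variation_bumpv (ltW e1) (ltW x1) xy yz ze.
have va := variationN vb.
have := first_variation alpha_gt0 u_min upq p1 pl (variation_sym va).
rewrite (dLg_sym upq min_gt0 va) => H.
rewrite -RintZ; last exact: intg_sdefect_var vb.
rewrite (@eq_Rint _ _ (fun t => k t * - bumpv2 e x y z t)); last first.
  by move=> t _; rewrite mulN1r mulrN.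
apply: H; first by move=> t _; rewrite opprK addrC.
(* Lowering [u] respects the obstacle for every step size, so the bound 1 is arbitrary. *)
exists 1 => // t s /andP[t0 _] Is.
have b1 := bumpv_ge0 s (ltW e1) xy yz; have b2 := bumpv_ge0 (- s) (ltW e1) xy yz.
have : 0 <= t * (bumpv e x y z s + bumpv e x y z (- s)).
  by apply: mulr_ge0; [exact: ltW|exact: addr_ge0].
have := min_psi Is; lra.
Qed.

Lemma sdefect_affine a b : -1 <= a -> b <= 1 -> (forall x, a < x < b -> u x < psi x) ->
  concave_on (good u p q `&` `]a, b[) (fun x => - k x).
Proof.
move=> a1 b1 uab x y z [gx Ax] [gy _] [gz Az] xy yz.
move: Ax Az; rewrite /= !in_itv /= => /andP[ax _] /andP[_ zb].
suff : 0 <= 1 * ((z - y) * k x + (y - x) * k z - (z - x) * k y) by lra.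
have e0 : 0 < b - z by lra.
apply: (sdefect_limit upq min_gt0 gx gy gz e0) => e /andP[e1 ez].
have ze : z + e <= 1 by lra.
have x1 : -1 <= x by lra.
have vb := variation_bumpv (ltW e1) x1 xy yz ze.
have := first_variation alpha_gt0 u_min upq p1 pl (variation_sym vb).
rewrite (dLg_sym upq min_gt0 vb) mul1r => H.
apply: H; first by move=> t _; rewrite opprK addrC.
have cu := AC_within (adm1 upq).
have cd : {within @Iclosed R, continuous (fun t => psi t - u t)}.
  by move=> t; apply: cvgB; [exact: psi_cont|exact: cu].
have xze : x <= z + e by lra.
(* The bump is supported in [[x, z + e]], a compact subset of []a, b[], where the gap [psi - u]
   attains a positive minimum. *)
have [c cI Hc] : exists2 c, c \in `[x, z + e] &
    forall t, t \in `[x, z + e] -> psi c - u c <= psi t - u t.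
  apply: (EVT_min xze); apply: continuous_subspaceW cd => t /=.
  by rewrite in_itv /= => /andP[h1 h2]; apply/IclosedE; apply/andP; split; lra.
pose d := psi c - u c.
have d0 : 0 < d.
  rewrite subr_gt0; apply: uab; move: cI; rewrite in_itv /= => /andP[h1 h2].
  by apply/andP; split; lra.
have [M M0 HM] := within_bounded (AC_within (var_AC vb)).
have M2 : 0 < 2 * M by lra.
(* The symmetrised bump is at most [2 * M], so this step size raises [u] by no more than the gap
   [d]. *)
exists (d / (2 * M)); first by rewrite divr_gt0.
move=> t s /andP[t0 tM] Is.
have Is' : Iclosed (- s) by exact/Iclosed_opp.
(* Either the direction vanishes at [s], or one of [s] and [- s] lies in the support of the bump;
   evenness of [u] and [psi] carries the gap over to the reflected support. *)
have [out|nout] := boolP (~~ (x <= s <= z + e) && ~~ (x <= - s <= z + e)).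
  have /andP[n1 n2] := out.
  rewrite !bumpv_out ?addr0 ?mulr0 ?addr0//; try exact: ltW.
  exact: min_psi.
have ds : d <= psi s - u s.
  move: nout; rewrite negb_and !negbK => /orP[i1|i2].
    by apply: Hc; rewrite in_itv.
  by rewrite (psi_even Is) (min_even Is); apply: Hc; rewrite in_itv.
have tb : t * (bumpv e x y z s + bumpv e x y z (- s)) <= d.
  have h1 : bumpv e x y z s + bumpv e x y z (- s) <= 2 * M.
    have := HM s Is; have := HM (- s) Is'; rewrite !ler_norml => /andP[_ ?] /andP[_ ?]; lra.
  apply: le_trans (ler_wpM2l (ltW t0) h1) _.
  by rewrite -ler_pdivlMr.
lra.
Qed.

End Derivatives.

Lemma near_ends : exists eL eR : R, [/\ -1 < eL <= 1, -1 <= eR < 1,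
  forall x, -1 < x < eL -> u x < psi x & forall x, eR < x < 1 -> u x < psi x].
Proof.
have [p [q [upq _ _]]] := Nadm_adm (proj1 (proj1 u_min)).
have cu := AC_within (adm1 upq).
have cd : {within @Iclosed R, continuous (fun t => psi t - u t)}.
  by move=> t; apply: cvgB; [exact: psi_cont|exact: cu].
have N11 : -1 < 1 :> R by lra.
have [_ cl cr] := (continuous_within_itvP _ N11).1 cd.
have [ur ul] := min_bnd.
have l0 : 0 < psi (-1) - u (-1) by rewrite ul subr_gt0.
have r0 : 0 < psi 1 - u 1 by rewrite ur psi_bnd subr_gt0.
have [dl /= dl0 Hl] : \forall t \near (-1)^'+, 0 < psi t - u t by exact: (cvgr_gt _ cl).
have [dr /= dr0 Hr] : \forall t \near 1^'-, 0 < psi t - u t by exact: (cvgr_gt _ cr).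
(* The cap at 2, the length of the interval, keeps [eL] and [eR] within [[-1, 1]]. *)
have m1 : Num.min dl 2 <= dl by rewrite ge_min lexx.
have m2 : Num.min dl 2 <= 2 by rewrite ge_min lexx orbT.
have m3 : 0 < Num.min dl 2 by rewrite lt_min dl0 ltr0n.
have n1 : Num.min dr 2 <= dr by rewrite ge_min lexx.
have n2 : Num.min dr 2 <= 2 by rewrite ge_min lexx orbT.
have n3 : 0 < Num.min dr 2 by rewrite lt_min dr0 ltr0n.
exists (-1 + Num.min dl 2), (1 - Num.min dr 2); split; [lra|lra| |].
- move=> x /andP[h1 h2]; rewrite -subr_gt0; apply: Hl => //=.
  by rewrite ltr0_norm; lra.
- move=> x /andP[h1 h2]; rewrite -subr_gt0; apply: Hr => //=.
  by rewrite gtr0_norm; lra.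
Qed.

Lemma sdefect_prim p q : adm u p q -> p 1 = 0 -> p (-1) = 0 ->
  exists (m : R -> R) (c M : R),
  [/\ forall x y, x <= y -> m y <= m x, forall x, `|m x| <= M,
      ae_eq_on I (sdefect u p q) (fun x => c + prim m x) &
      forall a b : R, -1 <= a -> b <= 1 -> (forall x, a < x < b -> u x < psi x) ->
        exists s, forall t, a < t < b -> m t = s].
Proof.
move=> upq p1 pl; have [eL [eR [eL1 eR1 HL HR]]] := near_ends.
have Gae := good_ae upq min_gt0.
have GI : good u p q `<=` I by move=> x [].
have affL := sdefect_affine upq p1 pl (lexx (-1)) (proj2 (andP eL1)) HL.
have affR := sdefect_affine upq p1 pl (proj1 (andP eR1)) (lexx 1) HR.
have [m [c [M [m1 m2 m3 m4]]]] :=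
  concave_prim GI (ae_dense Gae) (sdefect_concave upq p1 pl) eL1 eR1 affL affR.
exists m, c, M; split => //.
- by apply: aeS Gae => x H Ix; exact: m3 (H Ix).
- by move=> a b a1 b1 uab; apply: m4 => //; exact: sdefect_affine.
Qed.

(** Reflecting the even [u] gives the second density [- p (- x)]; densities agree almost everywhere,
    and continuous ones everywhere. *)
Lemma adm_odd p q : adm u p q -> forall x, Iclosed x -> p (- x) = - p x.
Proof.
move=> [up pq _]; have A := AC_opp up; have cp := AC_within pq.
have A' : AC u (fun x => - p (- x)).
  by apply: AC_eq A => // x Ix; rewrite -min_even.
have E := AC_unique up A'.
have cp' : {within @Iclosed R, continuous (fun x => - p (- x))}.
  by apply: withinN; exact: AC_within (AC_opp pq).
by move=> x Ix; rewrite (ae_eq_within cp cp' E Ix) opprK.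
Qed.

Lemma adm_even p q : adm u p q -> ae_eq_on I q (fun x => q (- x)).
Proof.
move=> upq; have [_ pq _] := upq; apply: (AC_unique pq).
apply: AC_eq (ACN (AC_opp pq)) => x Ix; last by rewrite opprK.
by rewrite (adm_odd upq Ix) opprK.
Qed.

Lemma sg_odd p q x : adm u p q -> Iclosed x -> sg (p (- x)) = sg (p x).
Proof. by move=> upq Ix; rewrite (adm_odd upq Ix) /sg sqrrN. Qed.

(* The continuous representative of [Lg_q] along the minimiser: [u] being even, so is
   [Lg_q], and it is recovered from [sdefect = c + prim m]. *)
Definition Abar p q (m : R -> R) (c : R) x : R :=
  (c + prim m x + (Ef u p q x + Ef u p q (- x))) / 2.

Definition Abar' p q (m : R -> R) x : R :=
  (m x + ((Lg_p (u x) (p x) (q x) - prim (fun t => Lg_v (u t) (p t) (q t)) x)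
   - (Lg_p (u (- x)) (p (- x)) (q (- x)) - prim (fun t => Lg_v (u t) (p t) (q t)) (- x)))) / 2.

Lemma AC_Abar p q m c : adm u p q -> intg m -> AC (Abar p q m c) (Abar' p q m).
Proof.
move=> upq mi; have BCi := intg_BC upq min_gt0; have E := AC_prim BCi.
apply: AC_eq (ACZ 2^-1 (ACD (ACD (AC_cst c) (AC_prim mi)) (ACD E (AC_opp E)))).
  by move=> x _; rewrite /Abar mulrC.
by move=> x _; rewrite /Abar' add0r mulrC.
Qed.

Lemma Abar_ae p q m c : adm u p q -> ae_eq_on I (sdefect u p q) (fun x => c + prim m x) ->
  ae_eq_on I (fun x => Lg_q (u x) (p x) (q x)) (Abar p q m c).
Proof.
move=> upq kE; apply: aeS (aeI kE (adm_even upq)) => x [h1 h2] Ix.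
have Ic := Iopen_closed Ix; have := h1 Ix; rewrite /sdefect /defect /Abar => <-.
have -> : Lg_q (u (- x)) (p (- x)) (q (- x)) = Lg_q (u x) (p x) (q x).
  by rewrite /Lg_q (sg_odd upq Ic) -(min_even Ic) -(h2 Ix).
by field.
Qed.

(* [Lg_q] is affine in [q]: solving for [q]. *)
Definition qof p (A : R -> R) x : R :=
  (A x - 2 * (sg (p x))^-1 ^+ 3) * ((u x)^-1 * sg (p x) ^+ 5 / 2).

Lemma solve_Lg_q p q x : 0 < u x -> q x = qof p (fun x => Lg_q (u x) (p x) (q x)) x.
Proof.
move=> u0; rewrite /qof /Lg_q; have := sg_gt0 (p x).
move: (sg (p x)) (u x) u0 (q x) => s w w0 b s0.
by field; rewrite !gt_eqF.
Qed.

Lemma within_qof p q A : adm u p q -> {within @Iclosed R, continuous A} ->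
  {within @Iclosed R, continuous (qof p A)}.
Proof.
move=> upq cA; have cp := AC_within (adm2 upq); have cu := AC_within (adm1 upq).
apply: withinM.
  apply: withinD => //; apply: withinN; apply: withinM; first exact: within_cst.
  by apply: withinX; exact: (within_comp cp isg_continuous).
apply: withinM; last exact: within_cst.
apply: withinM; first by apply: withinV => // x; exact: min_gt0.
by apply: withinX; exact: (within_comp cp sg_continuous).
Qed.

(** Only the class of [q] matters in [adm], so it may be exchanged for the continuous function
    obtained by solving [Lg_q = Abar] for the second derivative. *)
Lemma adm_continuous : exists p q, [/\ adm u p q, p 1 = 0, p (-1) = 0 &
  {within @Iclosed R, continuous q}].
Proof.
have [p [q [upq p1 pl]]] := Nadm_adm (proj1 (proj1 u_min)).
have [m [c [M [m1 m2 m3 _]]]] := sdefect_prim upq p1 pl.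
have mi : intg m.
  apply: (@intg_bounded _ _ M) => //.
  by apply: (nonincreasing_measurable measurable_Iopen) => x y; exact: m1.
have AA := AC_Abar c upq mi; have cA := AC_within AA.
have cq := within_qof upq cA.
have qE : ae_eq_on I q (qof p (Abar p q m c)).
  apply: aeS (Abar_ae upq m3) => x H Ix; rewrite {1}(solve_Lg_q p q (min_gt0 (Iopen_closed Ix))).
  by rewrite /qof H.
exists p, (qof p (Abar p q m c)); split => //.
have [up pq sq] := upq; split => //.
  exact: AC_ae pq (within_measurable cq) qE.
have [M' _ HM] := within_bounded cq.
apply: (@sq_bounded _ _ M'); first exact: within_measurable.
by move=> x /Iopen_closed; exact: HM.
Qed.

(* Nonnegativity makes products of such functions monotone again. *)
Definition mono f := (exists M : R, forall x, I x -> 0 <= f x <= M) /\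
  forall x y, I x -> I y -> x <= y -> f x <= f y.

(** Bounded variation in the form of a Jordan decomposition: sums and products are then handled by
    algebra on monotone functions, with no estimate of variations. *)
Definition dm f := exists a b : R -> R,
  [/\ mono a, mono b & forall x, I x -> f x = a x - b x].

Lemma monoD f g : mono f -> mono g -> mono (fun x => f x + g x).
Proof.
move=> [[M HM] Hf] [[N HN] Hg]; split; last by move=> x y Ix Iy xy; rewrite lerD ?Hf ?Hg.
exists (M + N) => x Ix; have /andP[a1 a2] := HM x Ix; have /andP[b1 b2] := HN x Ix.
by rewrite addr_ge0// lerD.
Qed.

Lemma monoM f g : mono f -> mono g -> mono (fun x => f x * g x).
Proof.
move=> [[M HM] Hf] [[N HN] Hg]; split; last first.
  move=> x y Ix Iy xy; have /andP[a1 _] := HM x Ix; have /andP[b1 _] := HN x Ix.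
  by apply: ler_pM => //; [exact: Hf|exact: Hg].
exists (M * N) => x Ix; have /andP[a1 a2] := HM x Ix; have /andP[b1 b2] := HN x Ix.
by rewrite mulr_ge0// ler_pM.
Qed.

Lemma mono_cst (c : R) : 0 <= c -> mono (fun=> c).
Proof. by move=> c0; split => //; exists c => x _; rewrite c0 lexx. Qed.

Lemma dm_eq f g : (forall x, I x -> f x = g x) -> dm f -> dm g.
Proof. by move=> fg [a [b [ma mb E]]]; exists a, b; split => // x Ix; rewrite -fg// E. Qed.

Lemma dmD f g : dm f -> dm g -> dm (fun x => f x + g x).
Proof.
move=> [a [b [ma mb E]]] [a' [b' [ma' mb' E']]].
exists (fun x => a x + a' x), (fun x => b x + b' x); split; [exact: monoD|exact: monoD|].
by move=> x Ix; rewrite E// E'//; lra.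
Qed.

Lemma dmN f : dm f -> dm (fun x => - f x).
Proof.
by move=> [a [b [ma mb E]]]; exists b, a; split => // x Ix; rewrite E// opprB.
Qed.

Lemma dmM f g : dm f -> dm g -> dm (fun x => f x * g x).
Proof.
move=> [a [b [ma mb E]]] [a' [b' [ma' mb' E']]].
exists (fun x => a x * a' x + b x * b' x), (fun x => a x * b' x + b x * a' x); split.
- by apply: monoD; exact: monoM.
- by apply: monoD; exact: monoM.
- by move=> x Ix; rewrite E// E'//; ring.
Qed.

Lemma dm_cst (c : R) : dm (fun=> c).
Proof.
exists (fun=> `|c| + c), (fun=> `|c|); split; [apply: mono_cst|apply: mono_cst|] => //.
  by have := ler_norm (- c); rewrite normrN; lra.
by move=> x _; rewrite addrAC subrr add0r.
Qed.

Lemma dmX f n : dm f -> dm (fun x => f x ^+ n).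
Proof.
move=> df; elim: n => [|n IH]; first exact: (dm_cst 1).
by apply: dm_eq (dmM df IH) => x _; rewrite exprS.
Qed.

Definition bdd f := exists M : R, forall x, I x -> `|f x| <= M.

Lemma bddD f g : bdd f -> bdd g -> bdd (fun x => f x + g x).
Proof.
move=> [M HM] [N HN]; exists (M + N) => x Ix; apply: le_trans (ler_normD _ _) _.
by apply: lerD; [exact: HM|exact: HN].
Qed.

Lemma bddM f g : bdd f -> bdd g -> bdd (fun x => f x * g x).
Proof.
move=> [M HM] [N HN]; exists (M * N) => x Ix; rewrite normrM.
by apply: ler_pM => //; [exact: HM|exact: HN].
Qed.

Lemma bdd_within f : {within @Iclosed R, continuous f} -> bdd f.
Proof.
by move=> cf; have [M _ HM] := within_bounded cf; exists M => x /Iopen_closed; exact: HM.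
Qed.

(** Adding [|M| * x] makes the density nonnegative, hence the function nondecreasing; the further
    constant [L + |M|] makes both parts nonnegative on the interval. *)
Lemma dm_AC F f : AC F f -> bdd f -> dm F.
Proof.
move=> Ff [M HM]; have [L _ HL] := within_bounded (AC_within Ff).
have AG := ACD Ff (ACZ `|M| (@AC_id R)).
have [gi Gg] := AG.
have monog x y : I x -> I y -> x <= y -> F x + `|M| * x <= F y + `|M| * y.
  move=> Ix Iy xy; rewrite (Gg x (Iopen_closed Ix)) (Gg y (Iopen_closed Iy)).
  rewrite lerD2l; apply: le_Rintegral => //.
  - exact/intgP/intg_step.
  - exact/intgP/intg_step.
  - move=> t It; apply: ler_wpM2l.
      by have := HM t It; have := ler_norm M; rewrite ler_norml => h /andP[h1 h2]; lra.
    rewrite /step; case: (leP t x) => tx; last by have /andP[] := step01 y t.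
    by rewrite (le_trans tx xy).
exists (fun x => F x + `|M| * x + (L + `|M|)), (fun x => `|M| * x + (L + `|M|)); split.
- split; last by move=> x y Ix Iy xy; rewrite lerD2r monog.
  exists (2 * (L + `|M|)) => x Ix; have /IopenE/andP[x1 x2] := Ix.
  have := HL x (Iopen_closed Ix); rewrite ler_norml => /andP[h1 h2].
  have M0 := normr_ge0 M.
  have k1 : 0 <= `|M| * (1 - x) by apply: mulr_ge0 => //; lra.
  have k2 : 0 <= `|M| * (1 + x) by apply: mulr_ge0 => //; lra.
  by apply/andP; split; lra.
- split; last by move=> x y Ix Iy xy; rewrite lerD2r ler_wpM2l.
  exists (L + 2 * `|M|) => x Ix; have /IopenE/andP[x1 x2] := Ix.
  have := HL x (Iopen_closed Ix) => h; have L0 := le_trans (normr_ge0 _) h.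
  have M0 := normr_ge0 M.
  have k1 : 0 <= `|M| * (1 - x) by apply: mulr_ge0 => //; lra.
  have k2 : 0 <= `|M| * (1 + x) by apply: mulr_ge0 => //; lra.
  by apply/andP; split; lra.
- by move=> x _; move: (`|M|) => a; lra.
Qed.

Lemma dm_noninc (m : R -> R) (M : R) : (forall x y, x <= y -> m y <= m x) ->
  (forall x, `|m x| <= M) -> dm m.
Proof.
move=> mn mM; have M0 : 0 <= M := le_trans (normr_ge0 _) (mM 0).
exists (fun=> M), (fun x => M - m x); split.
- exact: mono_cst.
- split; last by move=> x y _ _ xy; rewrite lerD2l lerN2 mn.
  by exists (2 * M) => x _; have := mM x; rewrite ler_norml => /andP[? ?]; apply/andP; split; lra.
- by move=> x _; lra.
Qed.

(** [mono] constrains [f] on the open interval only. Its lower and upper bounds, 0 and [M], are used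
    as endpoint values, so the extension is monotone on the closed interval. *)
Lemma mono_BV f : mono f -> exists2 g, bounded_variation (-1) 1 g &
  forall x, I x -> f x = g x.
Proof.
move=> [[M HM] Hf].
exists (fun x => if x <= -1 then 0 else if x < 1 then f x else M).
  apply: nondecreasing_bounded_variation => x y; rewrite !in_itv /= => /andP[x1 x2] /andP[y1 y2] xy.
  have I0 : I 0 by apply/IopenE; lra.
  have /andP[h1 h2] := HM 0 I0.
  have M0 : 0 <= M by apply: le_trans h2.
  have nI z : ~~ (z <= -1) -> z < 1 -> I z.
    by rewrite -ltNge => z1 z2; apply/IopenE; rewrite z1 z2.
  case: ifPn => [x3|x3].
    case: ifPn => // y3; case: ifPn => // y4.
    by have /andP[] := HM y (nI y y3 y4).
  have y3 : ~~ (y <= -1) by apply: contra x3; exact: le_trans xy.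
  rewrite (negbTE y3); case: ifPn => x4; case: ifPn => y4 //.
  - exact: Hf (nI x x3 x4) (nI y y3 y4) xy.
  - by have /andP[] := HM x (nI x x3 x4).
  - by move: x4; rewrite (le_lt_trans xy y4).
by move=> x /IopenE/andP[x1 x2]; rewrite leNgt x1 /= x2.
Qed.

Lemma dm_BV f : dm f -> exists2 g, bounded_variation (-1) 1 g &
  forall x, I x -> f x = g x.
Proof.
move=> [a [b [/mono_BV[ga BVa Ea] /mono_BV[gb BVb Eb] E]]].
exists (ga \+ (\- gb)); last by move=> x Ix; rewrite E// Ea// Eb.
by apply: bounded_variationD => //; exact: bounded_variationN.
Qed.

Lemma AC_eqr F f g : (forall x, I x -> f x = g x) -> AC F f -> AC F g.
Proof. by move=> fg; exact: AC_eq. Qed.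

Lemma ACX n F f : AC F f -> AC (fun x => F x ^+ n) (fun x => n%:R * F x ^+ n.-1 * f x).
Proof.
move=> Ff; elim: n => [|n IH].
  by apply: AC_eq (AC_cst 1) => x _; rewrite ?expr0// !mul0r.
apply: AC_eq (ACM Ff IH) => x _; first by rewrite exprS.
by case: n {IH} => [|n]; rewrite -?natr1 /= ?exprS ?expr0; ring.
Qed.

(** * The third derivative, and smoothness off the coincidence set *)

Section Regular.
Context (p q : R -> R) (upq : adm u p q)
  (cq : {within @Iclosed R, continuous q}) (m : R -> R) (c M : R)
  (m_noninc : forall x y, x <= y -> m y <= m x) (m_bd : forall x, `|m x| <= M)
  (kE : ae_eq_on I (sdefect u p q) (fun x => c + prim m x))
  (m_loc : forall a b : R, -1 <= a -> b <= 1 -> (forall x, a < x < b -> u x < psi x) ->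
    exists s, forall t, a < t < b -> m t = s).

Local Notation A := (Abar p q m c).
Local Notation B := (fun x => Lg_p (u x) (p x) (q x)).
Local Notation C := (fun x => Lg_v (u x) (p x) (q x)).
Local Notation s := (fun x => (sg (p x))^-1).
Local Notation sig := (fun x => sg (p x)).
Local Notation r := (fun x => (u x)^-1).

Lemma intg_m : intg m.
Proof.
apply: (@intg_bounded _ _ M) => //.
by apply: (nonincreasing_measurable measurable_Iopen) => x y; exact: m_noninc.
Qed.

Lemma within_u : {within @Iclosed R, continuous u}.
Proof. exact: AC_within (adm1 upq). Qed.

Lemma within_p : {within @Iclosed R, continuous p}.
Proof. exact: AC_within (adm2 upq). Qed.

Lemma within_s : {within @Iclosed R, continuous s}.
Proof. exact: (within_comp within_p isg_continuous). Qed.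

Lemma within_sig : {within @Iclosed R, continuous sig}.
Proof. exact: (within_comp within_p sg_continuous). Qed.

Lemma within_r : {within @Iclosed R, continuous r}.
Proof. exact: (withinV within_u min_gt0). Qed.

Lemma within_A : {within @Iclosed R, continuous A}.
Proof. exact: AC_within (AC_Abar c upq intg_m). Qed.

(** With [q] continuous, the almost everywhere identity between [Lg_q] and [A] holds at every point
    and can be solved for [q] there. *)
Lemma q_eq x : Iclosed x -> q x = qof p A x.
Proof.
move=> Ix; rewrite (solve_Lg_q p q (min_gt0 Ix)) /qof; congr ((_ - _) * _).
have cLg_q : {within @Iclosed R, continuous (fun x => Lg_q (u x) (p x) (q x))}.
  apply: withinD; apply: withinM; try exact: within_cst; try (apply: withinX; exact: within_s).
  apply: withinM => //; apply: withinM; [exact: within_cst|exact: within_u].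
exact: (ae_eq_within cLg_q within_A (Abar_ae upq kE) Ix).
Qed.

Lemma within_opp f : {within @Iclosed R, continuous f} ->
  {within @Iclosed R, continuous (fun x => f (- x))}.
Proof.
move=> /subspace_continuousP cf; apply/subspace_continuousP => x Ix.
have L := cf (- x) ((Iclosed_opp x).2 Ix).
apply: (@cvg_comp _ _ _ -%R f _ (within (@Iclosed R) (nbhs (- x)))) => // P HP.
have H : \forall t \near x, Iclosed (- t) -> P (- t).
  exact: (@oppr_continuous _ _ x _ HP).
by apply: filterS H => t H It; apply: H; apply/Iclosed_opp.
Qed.

Lemma q_even x : Iclosed x -> q (- x) = q x.
Proof.
move=> Ix; apply/esym; apply: (ae_eq_within cq _ (adm_even upq) Ix).
exact: within_opp.
Qed.

Lemma within_B : {within @Iclosed R, continuous B}.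
Proof.
have X n := @withinX R n _ within_s.
have c1 := within_u; have c2 := within_p; have c3 := within_r.
apply: withinD; first apply: withinD; apply: withinN.
- apply: withinM; [|exact: X]; apply: withinM => //; apply: withinM; last exact: withinX.
  by apply: withinM => //; exact: within_cst.
- apply: withinM; [|exact: X]; apply: withinM => //.
  by apply: withinM => //; exact: within_cst.
- by apply: withinM => //; apply: withinM => //; exact: X.
Qed.

Lemma within_C : {within @Iclosed R, continuous C}.
Proof.
apply: withinD; first by apply: withinM; apply: withinX => //; exact: within_s.
by apply: withinN; apply: withinM; [exact: within_s|apply: withinX; exact: within_r].
Qed.

(* [Lg_p] is odd and [Lg_v] even along the minimiser, so that [Ef x + Ef (- x)] has
   derivative [2 * B + Wf]. *)
Definition Wf x : R := prim C (- x) - prim C x.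

Lemma AC_Wf : AC Wf (fun x => - 2 * C x).
Proof.
have P := AC_prim (intg_Lg_v upq min_gt0).
apply: AC_eqr (ACB (AC_opp P) P) => x Ix; have Ic := Iopen_closed Ix.
have -> : Lg_v (u (- x)) (p (- x)) (q (- x)) = Lg_v (u x) (p x) (q x).
  by rewrite /Lg_v (sg_odd upq Ic) -(min_even Ic) (q_even Ic).
by move: (Lg_v _ _ _) => a; lra.
Qed.

Lemma AC_A : AC A (fun x => (m x + 2 * B x + Wf x) / 2).
Proof.
apply: AC_eqr (AC_Abar c upq intg_m) => x Ix; have Ic := Iopen_closed Ix.
have -> : Abar' p q m x = (m x + ((B x - prim C x) - (B (- x) - prim C (- x)))) / 2 by [].
have -> : B (- x) = - B x.
  rewrite /Lg_p (sg_odd upq Ic) -(min_even Ic) (q_even Ic) (adm_odd upq Ic).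
  by move: (sg (p x))^-1 (u x)^-1 => a b; ring.
by rewrite /Wf; move: (B x) (prim C x) (prim C (- x)) => a b d; lra.
Qed.

Lemma dv_u x : I x -> is_derive x (1 : R) u (p x).
Proof.
by move=> Ix; apply: (AC_derive (adm1 upq) Ix); exact: within_interior within_p Ix.
Qed.

Lemma dv_p x : I x -> is_derive x (1 : R) p (q x).
Proof. by move=> Ix; apply: (AC_derive (adm2 upq) Ix); exact: within_interior cq Ix. Qed.

Lemma dv_sig x : I x -> is_derive x (1 : R) sig (p x * q x * s x).
Proof.
move=> Ix; apply: (is_derive_eq (dvcomp (dv_sg (p x)) (dv_p Ix))).
by rewrite mulrAC.
Qed.

Lemma dv_inv f x a : f x != 0 -> is_derive x (1 : R) f a ->
  is_derive x (1 : R) (fun t => (f t)^-1) (- a * (f x)^-1 ^+ 2).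
Proof.
move=> f0 fa; apply: (is_derive_eq (is_deriveV f0 fa)).
by rewrite exprVn [_ *: _]/(_ * _) mulrC mulrN -mulNr.
Qed.

Lemma dv_s x : I x -> is_derive x (1 : R) s (- (p x * q x * s x ^+ 3)).
Proof.
move=> Ix.
apply: (is_derive_eq (@dv_inv (fun x => sg (p x)) x _ (lt0r_neq0 (sg_gt0 (p x))) (dv_sig Ix))).
by move: (s x) => a; ring.
Qed.

Lemma dv_r x : I x -> is_derive x (1 : R) r (- (p x * r x ^+ 2)).
Proof.
move=> Ix; have u0 := lt0r_neq0 (min_gt0 (Iopen_closed Ix)).
by apply: (is_derive_eq (@dv_inv u x _ u0 (dv_u Ix))); rewrite mulNr.
Qed.

Lemma AC_sig : AC sig (fun x => p x * q x * s x).
Proof.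
apply: AC_C1; [exact: within_sig| |exact: dv_sig].
by apply: withinM; [apply: withinM => //; exact: within_p|exact: within_s].
Qed.

Lemma AC_s : AC s (fun x => - (p x * q x * s x ^+ 3)).
Proof.
apply: AC_C1; [exact: within_s| |exact: dv_s].
by apply: withinN; apply: withinM; [apply: withinM => //; exact: within_p|apply: withinX; exact: within_s].
Qed.

Lemma AC_r : AC r (fun x => - (p x * r x ^+ 2)).
Proof.
apply: AC_C1; [exact: within_r| |exact: dv_r].
by apply: withinN; apply: withinM; [exact: within_p|apply: withinX; exact: within_r].
Qed.

(** The product rule applied to [qof p A], with the density of [A] from [AC_A]. The only ingredient
    that may be discontinuous is [m]. *)
Definition q' x : R :=
  ((m x + 2 * B x + Wf x) / 2 - 2 * (3%:R * s x ^+ 2 * - (p x * q x * s x ^+ 3)))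
    * (r x * sig x ^+ 5 / 2)
  + (A x - 2 * s x ^+ 3)
    * ((- (p x * r x ^+ 2) * sig x ^+ 5
        + r x * (5%:R * sig x ^+ 4 * (p x * q x * s x))) / 2).

Lemma AC_q : AC q q'.
Proof.
have H1 := ACB AC_A (ACZ 2 (ACX 3 AC_s)).
have H2 := ACZ 2^-1 (ACM AC_r (ACX 5 AC_sig)).
apply: AC_eq (ACM H1 H2) => x Ix.
  by rewrite (q_eq Ix) /qof; congr (_ * _); rewrite mulrC.
by rewrite /q' /=; congr (_ * _ + _ * _); rewrite mulrC.
Qed.

Lemma bdd_q' : bdd q'.
Proof.
have bm : bdd m by exists M.
have bB := bdd_within within_B; have bW := bdd_within (AC_within AC_Wf).
have bp := bdd_within within_p; have bq := bdd_within cq; have bA := bdd_within within_A.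
have X f n : {within @Iclosed R, continuous f} -> bdd (fun x => f x ^+ n).
  by move=> cf; apply: bdd_within; exact: withinX.
have K (a : R) : bdd (fun=> a) by exists `|a|.
have N f : bdd f -> bdd (fun x => - f x).
  by move=> [L HL]; exists L => x Ix; rewrite normrN; exact: HL.
have bs := bdd_within within_s; have br := bdd_within within_r.
have X1 n := X _ n within_s; have X2 n := X _ n within_r; have X3 n := X _ n within_sig.
have ns : bdd (fun x => - (p x * q x * s x ^+ 3)) by apply: N; apply: bddM; [apply: bddM|exact: X1].
rewrite /q'; repeat first [exact: ns|exact: K|exact: X1|exact: X2|exact: X3|assumption
  |apply: bddD|apply: bddM|apply: N].
Qed.

(** [m] is monotone and bounded; every other ingredient is built from absolutely continuous
    functions with bounded density, which [dm_AC] covers. For [q] itself this boundedness is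
    [bdd_q']. *)
Lemma dm_q' : dm q'.
Proof.
have dmm : dm m by exact: dm_noninc m_noninc m_bd.
have dq : dm q := dm_AC AC_q bdd_q'.
have dp : dm p := dm_AC (adm2 upq) (bdd_within cq).
have du : dm u := dm_AC (adm1 upq) (bdd_within within_p).
have bd2 f F : AC F f -> {within @Iclosed R, continuous f} -> dm F.
  by move=> Ff cf; exact: dm_AC Ff (bdd_within cf).
have ds : dm s.
  apply: bd2 AC_s _; apply: withinN; apply: withinM; last by apply: withinX; exact: within_s.
  by apply: withinM => //; exact: within_p.
have dsig : dm sig.
  apply: bd2 AC_sig _; apply: withinM; last exact: within_s.
  by apply: withinM => //; exact: within_p.
have dr : dm r.
  by apply: bd2 AC_r _; apply: withinN; apply: withinM; [exact: within_p|apply: withinX; exact: within_r].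
have dW : dm Wf.
  by apply: bd2 AC_Wf _; apply: withinM; [exact: within_cst|exact: within_C].
have dA : dm A.
  apply: (dm_AC AC_A); apply: bddM; last by exists `|2^-1|.
  apply: bddD; last exact: bdd_within (AC_within AC_Wf).
  apply: bddD; first by exists M.
  by apply: bdd_within; apply: withinM; [exact: within_cst|exact: within_B].
have dB : dm B.
  by rewrite /Lg_p; repeat first [exact: dm_cst|apply: dmX|assumption|apply: dmD|apply: dmN|apply: dmM].
by rewrite /q'; repeat first [exact: dm_cst|apply: dmX|assumption|apply: dmD|apply: dmN|apply: dmM].
Qed.

Lemma derive1_u x : I x -> derive1 u x = p x.
Proof. by move=> /dv_u/dv_derive1. Qed.

Lemma dv_derive1_u x : I x -> is_derive x (1 : R) (derive1 u) (q x).
Proof.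
move=> Ix; apply: dv_near (dv_p Ix).
by apply: filterS (nbhs_Iopen Ix) => t It; rewrite derive1_u.
Qed.

Lemma derive2_u x : I x -> derive1n 2 u x = q x.
Proof. by move=> /dv_derive1_u/dv_derive1. Qed.

Lemma min_C2 : Ck_closed 2 u.
Proof.
split; first exact: within_u.
- move=> [|[|//]] x _ Ix /=.
    by have := dv_u Ix => H.
  by have := dv_derive1_u Ix => H.
- move=> [|[|[|//]]] _.
  + by exists u => //; exact: within_u.
  + by exists p; [exact: within_p|move=> x Ix; rewrite -derive1_u].
  + by exists q => // x Ix; rewrite derive2_u.
Qed.

Lemma min_weak : is_weak_derivative I (derive1n 2 u) q'.
Proof.
apply: weak_ae (AC_weak AC_q); last by apply: aeW => x Ix; rewrite derive2_u.
apply: open_integrable_locally; first exact: open_Iopen.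
by apply/intgP; apply: eq_intg (intg_within cq) => x Ix; rewrite derive2_u.
Qed.

Lemma min_BV : in_BV (weak_derive I (derive1n 2 u)).
Proof.
have wd : weakly_differentiable I (derive1n 2 u) by exists q'; exact: min_weak.
have [g BVg gE] := dm_BV dm_q'; exists g => //.
by apply: aeS (weak_unique (weak_derive_spec wd) min_weak) => x H Ix; rewrite H// gE.
Qed.

(* On the noncoincidence set the derivatives of these generators are polynomials in
   them, since [q_eq] makes [q] one. *)
Inductive field_alg : (R -> R) -> Prop :=
| alg_cst a : field_alg (fun=> a)
| alg_u : field_alg u
| alg_p : field_alg p
| alg_A : field_alg A
| alg_W : field_alg Wf
| alg_m : field_alg m
| alg_s : field_alg s
| alg_sig : field_alg sig
| alg_r : field_alg r
| alg_D f g : field_alg f -> field_alg g -> field_alg (fun x => f x + g x)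
| alg_M f g : field_alg f -> field_alg g -> field_alg (fun x => f x * g x).

Lemma algX n f : field_alg f -> field_alg (fun x => f x ^+ n).
Proof.
move=> Hf; elim: n => [|n IH]; first exact: alg_cst.
by rewrite (_ : (fun x => _) = fun x => f x * f x ^+ n); [exact: alg_M|apply/funext => x; rewrite exprS].
Qed.

Lemma algN f : field_alg f -> field_alg (fun x => - f x).
Proof.
move=> Hf; rewrite (_ : (fun x => _) = fun x => -1 * f x); last by apply/funext => x; rewrite mulN1r.
by apply: alg_M => //; exact: alg_cst.
Qed.

Lemma alg_q : field_alg (qof p A).
Proof.
rewrite /qof; repeat first [exact: alg_cst|exact: alg_A|exact: alg_r|apply: algX; exact: alg_s
  |apply: algX; exact: alg_sig|apply: alg_D|apply: algN|apply: alg_M].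
Qed.

Local Notation N := (noncoincidence u psi).

Lemma open_noncoincidence : open N.
Proof.
rewrite openE => x [Ix ux]; rewrite /interior.
have cu := within_interior within_u Ix; have cpsi := within_interior psi_cont Ix.
have h0 : 0 < psi x - u x by rewrite subr_gt0.
near=> t; split; first by near: t; exact: nbhs_Iopen.
rewrite -subr_gt0; near: t.
exact: cvgr_gt _ (cvgB cpsi cu) _ h0.
Unshelve. all: by end_near.
Qed.

Lemma dv_m x : N x -> is_derive x (1 : R) m 0.
Proof.
move=> Nx; have /nbhs_ballP[e /= e0 he] := open_nbhs_nbhs (conj open_noncoincidence Nx).
have H t : x - e < t < x + e -> N t.
  by move=> /andP[t1 t2]; apply: he; rewrite /ball /= ltr_norml; apply/andP; split; lra.
have /IopenE/andP[x1 x2] := proj1 Nx.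
have nI (t : R) : I t -> t != -1 /\ t != 1.
  by move=> /IopenE/andP[t1 t2]; split; [rewrite gt_eqF|rewrite lt_eqF].
(* The ball lies in [N], hence in the open interval; were it to reach past an endpoint, that
   endpoint would belong to it. *)
have a1 : -1 <= x - e.
  rewrite leNgt; apply/negP => h.
  have [|/nI[/eqP//]] := H (-1).
  by apply/andP; split; lra.
have b1 : x + e <= 1.
  rewrite leNgt; apply/negP => h.
  have [|/nI[_ /eqP//]] := H 1.
  by apply/andP; split; lra.
have [k mk] := m_loc a1 b1 (fun t Ht => proj2 (H t Ht)).
apply: (dv_near _ (dvc k x)); apply/nbhs_ballP; exists e => //= t.
by rewrite /ball /= ltr_norml => /andP[t1 t2]; rewrite mk//; apply/andP; split; lra.
Qed.

Lemma dv_Wf x : I x -> is_derive x (1 : R) Wf (- 2 * C x).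
Proof.
move=> Ix; apply: (AC_derive AC_Wf Ix); apply: cvgM; first exact: cvg_cst.
exact: (within_interior within_C Ix).
Qed.

Lemma dv_A x : N x -> is_derive x (1 : R) A ((m x + 2 * B x + Wf x) / 2).
Proof.
move=> Nx; have Ix := proj1 Nx; apply: (AC_derive AC_A Ix).
apply: cvgM; last exact: cvg_cst; apply: cvgD; last exact: dv_cont (dv_Wf Ix).
apply: cvgD; first exact: dv_cont (dv_m Nx).
by apply: cvgM; [exact: cvg_cst|exact: (within_interior within_B Ix)].
Qed.

Ltac alg := repeat first [exact: alg_cst|exact: alg_q|exact: alg_u|exact: alg_p|exact: alg_A
  |exact: alg_W|exact: alg_m|exact: alg_s|exact: alg_sig|exact: alg_r
  |apply: algX|apply: algN|apply: alg_D|apply: alg_M].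

Lemma alg_derive f : field_alg f ->
  exists2 g, field_alg g & forall x, N x -> is_derive x (1 : R) f (g x).
Proof.
have qE x : N x -> q x = qof p A x by move=> [Ix _]; exact: q_eq (Iopen_closed Ix).
elim=> [a|||||||||f1 f2 _ [g1 a1 d1] _ [g2 a2 d2]|f1 f2 b1 [g1 a1 d1] b2 [g2 a2 d2]].
- by exists (fun=> 0); [alg|move=> x _; exact: dvc].
- by exists p; [alg|move=> x [Ix _]; exact: dv_u].
- by exists (qof p A); [alg|move=> x Nx; rewrite -qE//; apply: dv_p; case: Nx].
- exists (fun x => (m x + 2 * Lg_p (u x) (p x) (qof p A x) + Wf x) / 2); first by rewrite /Lg_p; alg.
  by move=> x Nx; rewrite -qE//; exact: dv_A.
- exists (fun x => -2 * Lg_v (u x) (p x) (qof p A x)); first by rewrite /Lg_v; alg.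
  by move=> x Nx; rewrite -qE//; apply: dv_Wf; case: Nx.
- by exists (fun=> 0); [alg|exact: dv_m].
- exists (fun x => - (p x * qof p A x * s x ^+ 3)); first by alg.
  by move=> x Nx; rewrite -qE//; apply: dv_s; case: Nx.
- exists (fun x => p x * qof p A x * s x); first by alg.
  by move=> x Nx; rewrite -qE//; apply: dv_sig; case: Nx.
- exists (fun x => - (p x * r x ^+ 2)); first by alg.
  by move=> x [Ix _]; exact: dv_r.
- by exists (fun x => g1 x + g2 x); [alg|move=> x Nx; apply: dvD; [exact: d1|exact: d2]].
- exists (fun x => g1 x * f2 x + f1 x * g2 x); first by apply: alg_D; exact: alg_M.
  by move=> x Nx; apply: dvM; [exact: d1|exact: d2].
Qed.

Lemma min_smooth : smooth_on N u.
Proof. exact: (@smooth_closure _ _ field_alg open_noncoincidence alg_derive) alg_u. Qed.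

End Regular.

Lemma regularity : [/\ Ck_closed 2 u, weakly_differentiable I (derive1n 2 u),
  in_BV (weak_derive I (derive1n 2 u)) & smooth_on (noncoincidence u psi) u].
Proof.
have [p [q [upq p1 pl cq]]] := adm_continuous.
(* [sdefect] depends on the representative of the second derivative, so [m] and [c] are obtained
   anew for the continuous [q]. *)
have [m [c [M [m_noninc m_bd kE m_loc]]]] := sdefect_prim upq p1 pl.
split; [exact: min_C2 upq cq| |exact: (min_BV upq cq m_noninc m_bd kE)|
  exact: (min_smooth upq cq m_noninc m_bd kE m_loc)].
by exists (q' p q m c); exact: (min_weak upq cq m_noninc m_bd kE).
Qed.

End Minimiser.

Unset Implicit Arguments.

Theorem proposition3p10 (R : realType) (alpha : R) (psi : R -> R)
    (alpha_gt0 : 0 < alpha)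
    (psi_cont : {within @Iclosed R, continuous psi})
    (psi_gt0 : forall x, Iclosed x -> 0 < psi x)
    (psi_bnd : psi 1 = psi (-1))
    (psi_bnd_gt : alpha < psi (-1))
    (psi_sym : forall x, Iopen x -> psi x = psi (- x))
    (u : R -> R)
    (u_min : minimiser (@Wh R) (Nadm_obstacle alpha psi) u) :
  [/\ Ck_closed 2 u,
      weakly_differentiable (@Iopen R) (derive1n 2 u),
      in_BV (weak_derive (@Iopen R) (derive1n 2 u)) &
      smooth_on (noncoincidence u psi) u].
Proof. exact: (regularity alpha_gt0 psi_cont psi_bnd psi_bnd_gt psi_sym u_min). Qed.
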